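(* Let $D\subset\mathbb{C}$ be a domain, let $\mathcal{F}$ be a family of meromorphic functions on $D$, and let $k,p,m,n$ be positive integers satisfying (a) $\displaystyle \frac{k+2(p+1)}{n}+\frac{p+1}{m}+\frac{k(p+1)}{mn}<1$, and (b) $\displaystyle \frac{p+1}{m}+2\left(\frac{k+p+1}{n}\right)<1$. Let $\psi\not\equiv 0$ be a holomorphic function on $D$ all of whose zeros have multiplicity at most $p$. Suppose that for every $f\in\mathcal{F}$: (1) every zero in $D$ of $(f^n)^{(k)}-\psi$ has multiplicity at least $m$; (2) $\psi$ and $f$ have no common zeros in $D$; (3) if $f$ has poles in $D$, then the number of poles of $f$ in $D$ is greater than or equal to the number of zeros of $f$ in $D$ (counted with multiplicity). Then $\mathcal{F}$ is normal in $D$.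
   Context: A domain is a nonempty connected open subset of $\mathbb{C}$. A family of meromorphic functions on a domain $D$ is normal in $D$ if every sequence in the family has a subsequence that converges, uniformly on compact subsets of $D$ with respect to the spherical metric, to a meromorphic function on $D$ or to the constant $\infty$. $f^n$ denotes the $n$-th power of $f$ and $(f^n)^{(k)}$ its $k$-th derivative. A condition that all zeros have a given multiplicity holds vacuously when there are no zeros. *)

(* Defs.v *)
From HB Require Import structures.
From mathcomp Require Import all_boot all_order all_algebra.
From mathcomp Require Import all_classical all_reals all_analysis.
From mathcomp Require Import complex.
Set Implicit Arguments.
Unset Strict Implicit.
Unset Printing Implicit Defensive.
Import Order.TTheory GRing.Theory Num.Theory numFieldNormedType.Exports.
Local Open Scope classical_set_scope.
Local Open Scope ring_scope.

(* The complex plane R[i] as a normed space over itself, so that [open],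
   [compact], [connected] refer to its usual topology, and [derivable f z 1]
   and [derive1n] are complex differentiation. *)
Set Warnings "-redundant-canonical-projection".
HB.instance Definition _ (R : rcfType) := PseudoPointedMetric.copy R[i] R[i]^o.
HB.instance Definition _ (R : rcfType) := NormedModule.copy R[i] R[i]^o.
Set Warnings "redundant-canonical-projection".

(* The Riemann sphere; [None] is the point at infinity. *)
Definition sphere (R : realType) := option R[i].

Section Defs.
Variable R : realType.
Local Notation C := R[i].
Local Notation cnorm := (@ComplexField.Normc.normc R).
Implicit Types (D K : set C) (g h psi : C -> C) (f : C -> sphere R) (a z : C).

Definition complex_domain D := [/\ D !=set0, open D & connected D].

Definition holomorphic D g := forall z, D z -> derivable g z 1.

Definition holomorphic_at g a := \forall z \near a, derivable g z 1.

(* Functions into the sphere are total on C; every notion below relative to an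
   open set D depends only on the values taken on D. *)

Definition pole_of_order f a (j : nat) :=
  [/\ f a = None, (0 < j)%N &
    exists h, [/\ holomorphic_at h a, h a != 0 &
      \forall z \near a^', f z = Some (h z / (z - a) ^+ j)]].

Definition meromorphic D f := forall a, D a ->
  (exists2 g, holomorphic_at g a & \forall z \near a, f z = Some (g z)) \/
  (exists j, pole_of_order f a j).

Definition divisible_at f a (j : nat) :=
  exists2 h, holomorphic_at h a &
    \forall z \near a, f z = Some ((z - a) ^+ j * h z).

(* It is +oo when f vanishes identically near a. *)
Definition zero_mult f a : \bar R :=
  ereal_sup [set (j%:R)%:E | j in divisible_at f a].

(* At a pole this is the supremum of a singleton. *)
Definition pole_mult f a : \bar R :=
  ereal_sup [set (j%:R)%:E | j in pole_of_order f a].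

Definition zeros D f := [set a | D a /\ f a = Some 0].

Definition poles D f := [set a | D a /\ f a = None].

(* Counted with multiplicity, possibly +oo. *)
Definition num_zeros D f : \bar R := \esum_(a in zeros D f) zero_mult f a.

Definition num_poles D f : \bar R := \esum_(a in poles D f) pole_mult f a.

Definition of_fun g : C -> sphere R := fun z => Some (g z).

Definition mpow f (n : nat) : C -> sphere R :=
  fun z => omap (fun w => w ^+ n) (f z).

(* The value of [odflt 0] at poles is irrelevant: the poles of a meromorphic
   function are isolated, and its derivatives have the same poles. *)
Definition mderive (k : nat) f : C -> sphere R := fun z =>
  omap (fun=> derive1n k (fun w => odflt 0 (f w)) z) (f z).

Definition msub f psi : C -> sphere R :=
  fun z => omap (fun w => w - psi z) (f z).

(* The spherical metric in its chordal form, for the sphere of diameter 1. *)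
Definition spherical_dist (x y : sphere R) : R :=
  match x, y with
  | Some z, Some w =>
      cnorm (z - w) /
        (Num.sqrt (1 + cnorm z ^+ 2) * Num.sqrt (1 + cnorm w ^+ 2))
  | Some z, None | None, Some z => (Num.sqrt (1 + cnorm z ^+ 2))^-1
  | None, None => 0
  end.

Definition spherically_locally_uniform_cvg D
    (u : nat -> C -> sphere R) (f : C -> sphere R) :=
  forall K, compact K -> K `<=` D -> forall e : R, 0 < e ->
    \forall i \near \oo, forall z, K z -> spherical_dist (u i z) (f z) < e.

Definition normal_family D (F : set (C -> sphere R)) :=
  forall u : nat -> C -> sphere R, (forall i, F (u i)) ->
  exists s : nat -> nat, {homo s : i j / (i < j)%N} /\
  exists f, (meromorphic D f \/ forall z, D z -> f z = None) /\
    spherically_locally_uniform_cvg D (u \o s) f.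

End Defs.

(* Main.v *)
(* By the Zalcman rescaling principle, if the family is not normal at a, then
   blow-ups F_j of the functions f^n converge to a function F meromorphic in the plane
   whose zeros and poles have order at least n and for which all zeros of
   R = F^(k) - c z^l have order at least m, l being the order of psi at a, or 0.
   Such an F is constant and l = 0: put W = F^(k+l+1) = R^(l+1).  Condition (a) allows
   exponents b/N, c/N for which Phi = W^N / (F^b R^c) is entire, nonzero only where F
   and R are finite and nonzero.  Blowing up once more where Phi is large makes Phi
   nearly constant, so that F and R have no zeros and F'/F, R'/R are bounded; a last
   blow-up makes these logarithmic derivatives constant, which is incompatible with
   the differential equations.  Hence W = 0, F is a polynomial of degree less than n
   with zeros of order at least n, that is, a constant.
   Complex integration is carried out on squares.  Rescalings come from an elementary
   point-picking lemma, and the alternative |f^n| << rho^k |psi| or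
   |f^n| >> rho^k |psi| on discs of radius rho takes the place of Marty's criterion. *)

Require Import Defs.
From mathcomp Require Import all_boot all_order all_algebra.
From mathcomp Require Import all_classical all_reals all_analysis.
From mathcomp Require Import complex.
From mathcomp Require Import zify ring lra.
Import Order.TTheory GRing.Theory Num.Theory numFieldNormedType.Exports.
Local Open Scope classical_set_scope.
Local Open Scope ring_scope.

Set Implicit Arguments.
Unset Strict Implicit.
Unset Printing Implicit Defensive.

(** * Complex differentiability *)

(** The constant 8 carries the nonconstancy of the blow-up limit. Point picking yields discs of
    radius rho on which both |f^n| <= 8 rho^k |psi| and rho^k |psi| <= 8 |f^n| fail somewhere, while
    on a far larger disc one of the two always holds at half that scale; passing from (rho / 2)^k to
    rho^k turns 8 into 8 * 2^k. In the limit there are a point with 8 |F| <= |c z^l| and one with 8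
    |c z^l| <= |F| or F infinite, which a constant F with l = 0 cannot satisfy. At a zero a of psi
    there are two regimes: centres that stay within a bounded multiple of the scale from a, where
    psi rescales to c z^l, and centres that escape, where it rescales to a constant. So the
    exponents are needed for the order l and for the order 0, and l <= p provides both. That psi and
    f have no common zeros keeps 1 / f^n holomorphic where |f^n| dominates, and gives F(0) != 0 if l
    > 0. Hence zeros of F and of R never coincide, and the order of Phi can be counted at each kind
    separately. *)

Notation cn := (@ComplexField.Normc.normc _).
Notation rC x := (real_complex_def (Phant _) x).
Notation re := (@complex.Re _).
Notation im := (@complex.Im _).

Section Norm.
Variable R : realType.
Local Notation C := R[i].
Implicit Types (z w a : C) (x y : R).

(** The norm of [R[i]] is itself a complex number; [cn] is the same modulus as an element of [R], so
    that estimates become real inequalities open to [lra]. *)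
Lemma cnE z : `|z| = rC (cn z). Proof. by []. Qed.
Lemma cn_ge0 z : 0 <= cn z. Proof. by case: z => x y /=; rewrite sqrtr_ge0. Qed.
Lemma cn0 : cn (0 : C) = 0. Proof. exact: ComplexField.Normc.normc0. Qed.
Lemma cn1 : cn (1 : C) = 1. Proof. exact: ComplexField.Normc.normc1. Qed.
Lemma cnM z w : cn (z * w) = cn z * cn w.
Proof. exact: ComplexField.Normc.normcM. Qed.
Lemma cnV z : cn z^-1 = (cn z)^-1. Proof. exact: ComplexField.Normc.normcV. Qed.
Lemma cnf z w : cn (z / w) = cn z / cn w. Proof. by rewrite cnM cnV. Qed.
Lemma cnX z n : cn (z ^+ n) = cn z ^+ n.
Proof. by elim: n => [|n IH]; rewrite ?expr0 ?cn1// !exprS cnM IH. Qed.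
Lemma cnN z : cn (- z) = cn z. Proof. by apply: complexI; rewrite -!cnE normrN. Qed.
Lemma cnD z w : cn (z + w) <= cn z + cn w.
Proof. by rewrite -lecR rmorphD /= -!cnE ler_normD. Qed.
Lemma cnB z w : cn (z - w) <= cn z + cn w.
Proof. by rewrite -[cn w]cnN; apply: cnD. Qed.
Lemma cnC z w : cn (z - w) = cn (w - z). Proof. by rewrite -cnN opprB. Qed.
Lemma cn_tri a z w : cn (z - w) <= cn (z - a) + cn (a - w).
Proof. by rewrite -[z - w](subrKA a) cnD. Qed.
Lemma cn_lb z w : cn z - cn w <= cn (z - w) :> R.
Proof. by rewrite lerBlDr -{1}(subrK w z) cnD. Qed.
Lemma cn_eq0 z : (cn z == 0) = (z == 0).
Proof.
apply/eqP/eqP => [|->]; last exact: cn0.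
exact: ComplexField.Normc.eq0_normc.
Qed.
Lemma cn_gt0 z : (0 < cn z) = (z != 0).
Proof. by rewrite lt_def cn_ge0 andbT cn_eq0. Qed.
Lemma cnr x : cn (rC x : C) = `|x|.
Proof. by rewrite /= expr0n addr0 sqrtr_sqr. Qed.
Lemma cn_Re z : `|re z| <= cn z.
Proof.
case: z => x y /=; rewrite -sqrtr_sqr ler_sqrt ?lerDl ?sqr_ge0//.
by rewrite addr_ge0 ?sqr_ge0.
Qed.
Lemma cn_Im z : `|im z| <= cn z.
Proof.
case: z => x y /=; rewrite -sqrtr_sqr ler_sqrt ?lerDr ?sqr_ge0//.
by rewrite addr_ge0 ?sqr_ge0.
Qed.
Lemma cni : cn ('i%C : C) = 1.
Proof. by rewrite /= expr0n add0r expr1n sqrtr1. Qed.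
Lemma cn_ReIm z : cn z <= `|re z| + `|im z|.
Proof.
rewrite {1}[z]complexE -[X in _ <= X + _]cnr; apply: (le_trans (cnD _ _)).
by rewrite lerD2l cnM cni mul1r cnr.
Qed.
Lemma cn_nat n : cn (n%:R : C) = n%:R.
Proof. by rewrite -(rmorph_nat (real_complex R)) cnr ger0_norm. Qed.

End Norm.

Lemma rC_gt0 (R : realType) (e : R[i]) : 0 < e -> exists2 d : R, 0 < d & e = rC d.
Proof.
case: e => x y; rewrite ltcE /= => /andP[/eqP -> x0].
by exists x.
Qed.

Definition disc (R : realType) (a : R[i]) (r : R) : set R[i] :=
  [set z | cn (z - a) < r].

Section Disc.
Variable R : realType.
Local Notation C := R[i].
Implicit Types (z w a : C) (r s : R) (f g : C -> C).

Lemma nbhs_discP z (P : set C) :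
  nbhs z P <-> exists2 r, 0 < r & disc z r `<=` P.
Proof.
split=> [/nbhs_normP[e /= e0 h]|[r r0 h]].
  have [d d0 de] := rC_gt0 e0; exists d => // w zw; apply: h => /=.
  by rewrite de cnE ltcR cnC.
apply/nbhs_normP; exists (rC r) => /=; first by rewrite ltcR.
by move=> w /=; rewrite cnE ltcR cnC => /h.
Qed.

Lemma disc_center a r : 0 < r -> disc a r a.
Proof. by move=> r0; rewrite /disc /= subrr cn0. Qed.

Lemma disc_in a r z s : cn (z - a) + s <= r -> disc z s `<=` disc a r.
Proof.
move=> h w /= zw; apply: le_lt_trans (cn_tri z _ _) _.
by rewrite addrC; apply: lt_le_trans h; rewrite ltrD2l.
Qed.

Lemma disc_sub a r s : r <= s -> disc a r `<=` disc a s.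
Proof. by move=> rs; apply: disc_in; rewrite subrr cn0 add0r. Qed.

Lemma disc_nbhs a r z : disc a r z -> nbhs z (disc a r).
Proof.
move=> az; apply/nbhs_discP; exists (r - cn (z - a)); first by rewrite subr_gt0.
by apply: disc_in; rewrite subrKC.
Qed.

Lemma disc_open a r : open (disc a r).
Proof. by rewrite openE => z /disc_nbhs. Qed.

Lemma cvg_discP (T : Type) (F : set_system T) (FF : Filter F) (f : T -> C) (l : C) :
  f @ F --> l <-> forall e : R, 0 < e -> \forall t \near F, cn (f t - l) < e.
Proof.
split=> [h e e0|h P /nbhs_discP[r r0 rP]].
  by apply: (h (disc l e)); apply/nbhs_discP; exists e.
by apply: filterS (h r r0) => t /rP.
Qed.

Lemma cont_discP (f : C -> C) z :
  {for z, continuous f} <->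
  forall e : R, 0 < e -> exists2 d, 0 < d & forall w, cn (w - z) < d -> cn (f w - f z) < e.
Proof.
have P := cvg_discP (nbhs_filter z) f (f z); split=> [/P h e e0|h].
  by have /nbhs_discP[d d0 hd] := h _ e0; exists d => // w /hd.
by apply/P => e e0; have [d d0 hd] := h e e0; apply/nbhs_discP; exists d.
Qed.

(** Division-free form of complex differentiability: the error estimate also makes sense at [w = z],
    and Taylor estimates feed into it directly. *)
Definition hasd (f : C -> C) z (d : C) := forall e : R, 0 < e ->
  exists2 s, 0 < s & forall w, cn (w - z) < s ->
    cn (f w - f z - d * (w - z)) <= e * cn (w - z).

Lemma hasdP f z d : hasd f z d <-> is_derive z (1 : C) f d.
Proof.
have key : hasd f z d <-> (fun h : C => h^-1 *: (f (h *: 1 + z) - f z)) @ 0^' --> d.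
  have P := cvg_discP (dnbhs_filter (0 : C)) (fun h : C => h^-1 *: (f (h *: 1 + z) - f z)) d.
  split=> [h|/P h e e0].
    apply/P => e e0; have e20 : 0 < e / 2 by rewrite divr_gt0.
    have [s s0 hs] := h _ e20; apply/nbhs_discP; exists s => // w /=.
    rewrite /disc /= subr0 => ws w0; have := hs (w + z); rewrite addrK => /(_ ws).
    have -> : w^-1 *: (f (w *: 1 + z) - f z) - d = w^-1 * (f (w + z) - f z - d * w).
      by rewrite /GRing.scale /= mulr1 [RHS]mulrBr mulrCA mulVf// mulr1.
    rewrite cnM cnV => h1.
    apply: (@le_lt_trans _ _ (e / 2)); last by rewrite ltr_pdivrMr// ltr_pMr// ltr1n.
    by rewrite mulrC ler_pdivrMr// cn_gt0.
  have /nbhs_discP[s s0 hs] := h _ e0.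
  exists s => // w ws; have [->|wz] := eqVneq w z; first by rewrite !subrr mulr0 subr0 cn0 mulr0.
  have wz0 : w - z != 0 by rewrite subr_eq0.
  have := hs (w - z); rewrite /disc /= subr0 => /(_ ws wz0).
  have -> : (w - z)^-1 *: (f ((w - z) *: 1 + z) - f z) - d
          = (w - z)^-1 * (f w - f z - d * (w - z)).
    by rewrite /GRing.scale /= mulr1 subrK [RHS]mulrBr mulrCA mulVf// mulr1.
  by rewrite cnM cnV mulrC ltr_pdivrMr ?cn_gt0// => /ltW.
rewrite key; split=> [h|[h1 <-]]; last exact: h1.
by apply: DeriveDef; [apply: (cvgP d); exact: h|apply: cvg_lim => //; exact: h].
Qed.

Lemma hasd_uniq f z d d' : hasd f z d -> hasd f z d' -> d = d'.
Proof. by move=> /hasdP[_ <-] /hasdP[_ <-]. Qed.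

Lemma hasd_dv f z : derivable f z 1 -> hasd f z (derive1 f z).
Proof. by move=> /derivableP/hasdP; rewrite derive1E. Qed.

Lemma hasd_derivable f z d : hasd f z d -> derivable f z 1.
Proof. by move=> /hasdP[]. Qed.

Lemma hasdE f z d : hasd f z d -> derive1 f z = d.
Proof. by move=> /hasdP[_ <-]; rewrite derive1E. Qed.

Lemma derivable_cont f z : derivable f z 1 -> {for z, continuous f}.
Proof. by move=> /derivable1_diffP /differentiable_continuous. Qed.

Lemma hasd_cont f z d : hasd f z d -> {for z, continuous f}.
Proof. by move=> /hasd_derivable /derivable_cont. Qed.

Lemma hasd_near f g z d : (\forall w \near z, f w = g w) -> hasd f z d -> hasd g z d.
Proof.
move=> /[dup] /nbhs_singleton fgz /nbhs_discP[r r0 fg] h e e0.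
have [s s0 hs] := h e e0; exists (Num.min r s); first by rewrite lt_min r0.
by move=> w; rewrite lt_min => /andP[wr ws]; rewrite -fgz -fg// hs.
Qed.

Lemma hasd_cst (c : C) z : hasd (fun=> c) z 0.
Proof. apply/hasdP; exact: is_derive_cst. Qed.

Lemma hasd_id z : hasd (fun w => w) z 1.
Proof. apply/hasdP; exact: is_derive_id. Qed.

Lemma hasdD f g z a b : hasd f z a -> hasd g z b -> hasd (fun w => f w + g w) z (a + b).
Proof. by move=> /hasdP fa /hasdP ga; apply/hasdP; exact: is_deriveD. Qed.

Lemma hasdN f z a : hasd f z a -> hasd (fun w => - f w) z (- a).
Proof. by move=> /hasdP fa; apply/hasdP; exact: is_deriveN. Qed.

Lemma hasdB f g z a b : hasd f z a -> hasd g z b -> hasd (fun w => f w - g w) z (a - b).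
Proof. by move=> fa gb; apply: hasdD => //; apply: hasdN. Qed.

Lemma hasdM f g z a b :
  hasd f z a -> hasd g z b -> hasd (fun w => f w * g w) z (a * g z + f z * b).
Proof.
move=> /hasdP fa /hasdP gb; apply/hasdP.
have -> : a * g z + f z * b = f z *: b + g z *: a.
  by rewrite /GRing.scale /= addrC [g z * a]mulrC.
exact: (is_deriveM fa gb).
Qed.

Lemma hasdZ (c : C) f z a : hasd f z a -> hasd (fun w => c * f w) z (c * a).
Proof. by move=> fa; have := hasdM (hasd_cst c z) fa; rewrite mul0r add0r. Qed.

Lemma hasdX f z a n : hasd f z a -> hasd (fun w => f w ^+ n) z (n%:R * f z ^+ n.-1 * a).
Proof.
move=> fa; elim: n => [|n IH].
  by rewrite mul0r mul0r; apply: hasd_cst.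
have -> : (fun w => f w ^+ n.+1) = (fun w => f w * f w ^+ n).
  by apply/funext => w; rewrite exprS.
suff -> : n.+1%:R * f z ^+ n.+1.-1 * a = a * f z ^+ n + f z * (n%:R * f z ^+ n.-1 * a).
  exact: hasdM.
case: n {IH} => [|n] /=; first by rewrite !expr0 mulr0n mulr1n; ring.
rewrite !exprS -[n.+2%:R]natr1 /=; move: (n.+1%:R : C) (f z ^+ n : C) => c x; ring.
Qed.

Lemma hasdV f z a : f z != 0 -> hasd f z a -> hasd (fun w => (f w)^-1) z (- a / f z ^+ 2).
Proof.
move=> fz0 /hasdP fa; apply/hasdP; case: fa => h1 h2; apply: DeriveDef.
  exact: derivableV.
rewrite (deriveV fz0 h1) h2 /GRing.scale /= !mulNr mulrC; congr (- (_ * _)).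
Qed.

Lemma hasd_affine f (c r : C) z d :
  hasd f (c + r * z) d -> hasd (fun w => f (c + r * w)) z (d * r).
Proof.
have [->|r0] := eqVneq r 0.
  rewrite mulr0 => _; have -> : (fun w => f (c + 0 * w)) = (fun=> f c).
    by apply/funext => w; rewrite mul0r addr0.
  exact: hasd_cst.
have cr0 : 0 < cn r by rewrite cn_gt0.
move=> h e e0; have [s s0 hs] := h (e / cn r) (divr_gt0 e0 cr0).
exists (s / cn r); first exact: divr_gt0.
have E w : c + r * w - (c + r * z) = r * (w - z) by ring.
move=> w wz; have := hs (c + r * w); rewrite E cnM.
have -> : e / cn r * (cn r * cn (w - z)) = e * cn (w - z) by rewrite mulrA divfK ?gt_eqF.
by rewrite -(mulrA d r); apply; rewrite mulrC -ltr_pdivlMr.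
Qed.

Lemma derivable_near f g z :
  (\forall w \near z, f w = g w) -> derivable f z 1 -> derivable g z 1.
Proof. by move=> fg /hasd_dv /(hasd_near fg) /hasd_derivable. Qed.

Lemma derive1_near f g z : (\forall w \near z, f w = g w) -> derive1 f z = derive1 g z.
Proof. by move=> fg; rewrite !derive1E; apply: near_eq_derive. Qed.

Lemma derive1n_near f g z i : (\forall w \near z, f w = g w) -> derive1n i f z = derive1n i g z.
Proof.
elim: i f g => [|i IH] f g fg; first exact: nbhs_singleton fg.
rewrite !derive1Sn; apply: IH; apply: filterS (nbhs_interior fg) => w.
exact: derive1_near.
Qed.

Lemma near_discE (P : C -> Prop) z : (\forall w \near z, P w) ->
  exists2 r : R, 0 < r & forall w, cn (w - z) < r -> P w.
Proof. by move=> /nbhs_discP. Qed.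

Lemma near_discI (P : C -> Prop) z (r : R) : 0 < r -> (forall w, cn (w - z) < r -> P w) ->
  \forall w \near z, P w.
Proof. by move=> r0 h; apply/nbhs_discP; exists r. Qed.

End Disc.

(** * Cauchy's theorem on squares *)

Section SegmentIntegral.
Variable R : realType.
Local Notation C := R[i].
Local Notation mu := (@lebesgue_measure R).
Implicit Types (a b x t M : R) (p q : R -> C).

(** The point [s] is not confined to [[a, b]]: the integrands come from functions continuous in the
    plane at each point of a contour, so endpoints need no special treatment. *)
Definition cseg a b p := forall t, a <= t <= b -> forall e : R, 0 < e ->
  exists2 d, 0 < d & forall s, `|s - t| < d -> cn (p s - p t) < e.

Definition cint a b p : C :=
  Complex (\int[mu]_(t in `[a, b]) re (p t))%R (\int[mu]_(t in `[a, b]) im (p t))%R.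

Lemma cseg_int a b p : cseg a b p ->
  mu.-integrable `[a, b] (EFin \o (fun t => re (p t))) /\
  mu.-integrable `[a, b] (EFin \o (fun t => im (p t))).
Proof.
move=> h; have key (g : {additive C -> R}) : (forall z, `|g z| <= cn z) ->
    mu.-integrable `[a, b] (EFin \o (fun t => g (p t))).
  move=> gn; apply: continuous_compact_integrable; first exact: segment_compact.
  apply: continuous_in_subspaceT => t /set_mem /=; rewrite in_itv /= => tab.
  apply/cvgrPdist_lt => e e0; have [d d0 hd] := h t tab e e0.
  near=> s; rewrite distrC -raddfB; apply: le_lt_trans (gn _) _; apply: hd.
  by rewrite distrC; near: s; apply/nbhs_ballP; exists d.
by split; [apply: (key (@complex.Re R : C -> R)) => z; exact: cn_Re
         |apply: (key (@complex.Im R : C -> R)) => z; exact: cn_Im].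
Unshelve. all: by end_near. Qed.

Lemma csegB a b p q : cseg a b p -> cseg a b q -> cseg a b (fun t => p t - q t).
Proof.
move=> hp hq t tab e e0; have e20 : 0 < e / 2 by rewrite divr_gt0.
have [d d0 hd] := hp t tab _ e20; have [d' d'0 hd'] := hq t tab _ e20.
exists (Num.min d d'); first by rewrite lt_min d0.
move=> s; rewrite lt_min => /andP[sd sd'].
have -> : p s - q s - (p t - q t) = (p s - p t) - (q s - q t) by ring.
apply: le_lt_trans (cnB _ _) _; rewrite [e]splitr.
by apply: ltrD; [exact: hd|exact: hd'].
Qed.

Lemma eq_cint a b p q : (forall t, a <= t <= b -> p t = q t) -> cint a b p = cint a b q.
Proof.
move=> pq; congr Complex; apply: eq_Rintegral => t /set_mem /=; rewrite in_itv /= => tab;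
  by rewrite pq.
Qed.

Lemma cintB a b p q : cseg a b p -> cseg a b q ->
  cint a b (fun t => p t - q t) = cint a b p - cint a b q.
Proof.
move=> /cseg_int[p1 p2] /cseg_int[q1 q2]; rewrite /cint.
under eq_Rintegral do rewrite raddfB.
under [X in Complex _ X]eq_Rintegral do rewrite raddfB.
by rewrite !RintegralB.
Qed.

Lemma cintZ a b (c : C) p : cseg a b p -> cint a b (fun t => c * p t) = c * cint a b p.
Proof.
move=> /cseg_int[p1 p2]; rewrite /cint; case: c => u v.
have E t : (Complex u v) * p t =
    Complex (u * re (p t) - v * im (p t)) (u * im (p t) + v * re (p t)).
  by case: (p t).
under eq_Rintegral do rewrite E /=.
under [X in Complex _ X]eq_Rintegral do rewrite E /=.
have i1 (r : R) : mu.-integrable `[a, b] (EFin \o (fun t => r * re (p t))).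
  by apply: (integrableZl _ _ p1) => //; exact: measurable_itv.
have i2 (r : R) : mu.-integrable `[a, b] (EFin \o (fun t => r * im (p t))).
  by apply: (integrableZl _ _ p2) => //; exact: measurable_itv.
by rewrite RintegralB// RintegralD// !RintegralZl.
Qed.

Lemma cint_cst a b (c : C) : a <= b -> cint a b (fun=> c) = c * rC (b - a).
Proof.
move=> ab; rewrite /cint !Rintegral_cst//= lebesgue_measure_itv /= lte_fin.
case: c => u v; rewrite /real_complex_def; simpc.
by move: ab; rewrite le_eqVlt => /predU1P[->|->]; rewrite ?ltxx ?subrr ?mulr0.
Qed.

Lemma cint_split a b x p : a <= x <= b -> cseg a b p ->
  cint a b p = cint a x p + cint x b p.
Proof.
move=> /andP[ax xb] /cseg_int[p1 p2]; rewrite /cint; simpc.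
have H (f : R -> R) : mu.-integrable `[a, b] (EFin \o f) ->
    (\int[mu]_(t in `[a, b]) f t =
     \int[mu]_(t in `[a, x]) f t + \int[mu]_(t in `[x, b]) f t)%R.
  move=> fi; rewrite -(Rintegral_itv_obnd_cbnd (r := x)).
    by rewrite -(@Rintegral_itvB _ _ (BLeft a) (BRight b) x)// ?bnd_simp// subrKC.
  by apply: integrableS fi => //; apply: subset_itv; rewrite bnd_simp.
by rewrite !H.
Qed.

(** Real and imaginary parts are estimated separately, whence the factor 2. Sharp constants do not
    matter later: the maximum principle, where a factor would hurt, removes it by taking powers. *)
Lemma cn_cint a b M p : a <= b -> cseg a b p -> (forall t, a <= t <= b -> cn (p t) <= M) ->
  cn (cint a b p) <= 2 * M * (b - a).
Proof.
move=> ab /cseg_int[p1 p2] pM; rewrite /cint.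
have E : M * (b - a) = (\int[mu]_(t in `[a, b]) M)%R.
  rewrite Rintegral_cst//= lebesgue_measure_itv /= lte_fin.
  by move: ab; rewrite le_eqVlt => /predU1P[->|->]; rewrite ?ltxx ?subrr.
have ci : mu.-integrable `[a, b] (EFin \o (fun=> M)).
  apply: continuous_compact_integrable; first exact: segment_compact.
  by apply: continuous_subspaceT => t; apply: cvg_cst.
have B (f : R -> R) : mu.-integrable `[a, b] (EFin \o f) ->
    (forall t, a <= t <= b -> `|f t| <= M) -> `|\int[mu]_(t in `[a, b]) f t|%R <= M * (b - a).
  move=> fi fM; apply: le_trans (le_normr_Rintegral _ fi) _ => //.
  by rewrite E; apply: le_Rintegral => //; exact: integrable_norm.
apply: le_trans (cn_ReIm _) _ => /=; rewrite -mulrA mulr_natl mulr2n; apply: lerD.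
  by apply: B => // t tab; exact: le_trans (cn_Re _) (pM t tab).
by apply: B => // t tab; exact: le_trans (cn_Im _) (pM t tab).
Qed.

End SegmentIntegral.

Section RectangleIntegral.
Variable R : realType.
Local Notation C := R[i].
Implicit Types (x y : R) (f g : C -> C) (z w : C).

Definition rect x1 x2 y1 y2 : set C :=
  [set z | x1 <= re z <= x2 /\ y1 <= im z <= y2].

Definition bdry x1 x2 y1 y2 : set C :=
  [set z | rect x1 x2 y1 y2 z /\ [\/ re z = x1, re z = x2, im z = y1 | im z = y2]].

(** This is the counterclockwise integral of [f dz]: bottom minus top edge, plus i times right minus
    left edge. *)
Definition rint x1 x2 y1 y2 f : C :=
  cint x1 x2 (fun x => f (Complex x y1) - f (Complex x y2)) +
  'i%C * cint y1 y2 (fun y => f (Complex x2 y) - f (Complex x1 y)).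

Lemma cseg_h a b y f : (forall x, a <= x <= b -> {for Complex x y, continuous f}) ->
  cseg a b (fun x => f (Complex x y)).
Proof.
move=> h t tab e e0; have /cont_discP/(_ e e0)[d d0 hd] := h t tab.
exists d => // s st; apply: hd.
have -> : Complex s y - Complex t y = rC (s - t) by apply/eqP; rewrite eq_complex /=; apply/andP; split; apply/eqP; ring.
by rewrite cnr.
Qed.

Lemma cseg_v a b x f : (forall y, a <= y <= b -> {for Complex x y, continuous f}) ->
  cseg a b (fun y => f (Complex x y)).
Proof.
move=> h t tab e e0; have /cont_discP/(_ e e0)[d d0 hd] := h t tab.
exists d => // s st; apply: hd.
have -> : Complex x s - Complex x t = 'i%C * rC (s - t).
  by apply/eqP; rewrite eq_complex /=; apply/andP; split; apply/eqP; ring.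
by rewrite cnM cni mul1r cnr.
Qed.

Section Rect.
Variables x1 x2 y1 y2 : R.
Hypotheses (x12 : x1 <= x2) (y12 : y1 <= y2).
Local Notation bd := (bdry x1 x2 y1 y2).
Local Notation I := (rint x1 x2 y1 y2).

Let bd1 x : x1 <= x <= x2 -> bd (Complex x y1).
Proof. by move=> h; split; [rewrite /rect /= h lexx y12|apply: Or43]. Qed.
Let bd2 x : x1 <= x <= x2 -> bd (Complex x y2).
Proof. by move=> h; split; [rewrite /rect /= h lexx y12|apply: Or44]. Qed.
Let bd3 y : y1 <= y <= y2 -> bd (Complex x1 y).
Proof. by move=> h; split; [rewrite /rect /= h lexx x12|apply: Or41]. Qed.
Let bd4 y : y1 <= y <= y2 -> bd (Complex x2 y).
Proof. by move=> h; split; [rewrite /rect /= h lexx x12|apply: Or42]. Qed.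

Let cs f : (forall z, bd z -> {for z, continuous f}) ->
  [/\ cseg x1 x2 (fun x => f (Complex x y1)), cseg x1 x2 (fun x => f (Complex x y2)),
      cseg y1 y2 (fun y => f (Complex x1 y)) & cseg y1 y2 (fun y => f (Complex x2 y))].
Proof.
move=> h; split; [apply: cseg_h => x hx|apply: cseg_h => x hx|
  apply: cseg_v => x hx|apply: cseg_v => x hx]; apply: h.
- exact: bd1.
- exact: bd2.
- exact: bd3.
- exact: bd4.
Qed.

Lemma eq_rint f g : (forall z, bd z -> f z = g z) -> I f = I g.
Proof.
move=> fg; congr (_ + 'i%C * _); apply: eq_cint => t ht.
  by rewrite !fg//; [exact: bd2|exact: bd1].
by rewrite !fg//; [exact: bd3|exact: bd4].
Qed.

Lemma rintB f g :
  (forall z, bd z -> {for z, continuous f}) -> (forall z, bd z -> {for z, continuous g}) ->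
  I (fun z => f z - g z) = I f - I g.
Proof.
move=> /cs[f1 f2 f3 f4] /cs[g1 g2 g3 g4]; rewrite /rint.
have E1 : cint x1 x2 (fun x => f (Complex x y1) - g (Complex x y1)
      - (f (Complex x y2) - g (Complex x y2))) =
    cint x1 x2 (fun x => (f (Complex x y1) - f (Complex x y2))
      - (g (Complex x y1) - g (Complex x y2))) by apply: eq_cint => x _; ring.
have E2 : cint y1 y2 (fun y => f (Complex x2 y) - g (Complex x2 y)
      - (f (Complex x1 y) - g (Complex x1 y))) =
    cint y1 y2 (fun y => (f (Complex x2 y) - f (Complex x1 y))
      - (g (Complex x2 y) - g (Complex x1 y))) by apply: eq_cint => x _; ring.
rewrite E1 E2 cintB; [|exact: csegB|exact: csegB].
by rewrite [X in 'i%C * X]cintB; [ring|exact: csegB|exact: csegB].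
Qed.

Lemma rintZ (c : C) f : (forall z, bd z -> {for z, continuous f}) ->
  I (fun z => c * f z) = c * I f.
Proof.
move=> /cs[f1 f2 f3 f4]; rewrite /rint.
under eq_cint do rewrite -mulrBr.
under [X in 'i%C * X]eq_cint do rewrite -mulrBr.
by rewrite !cintZ; [ring|exact: csegB|exact: csegB].
Qed.

(** Opposite edges differ by constants, and the two contributions are [b i (y1 - y2) (x2 - x1)] and
    its negative. This is the exact case that Goursat's argument subtracts. *)
Lemma rint_affine (a b : C) : I (fun z => a + b * z) = 0.
Proof.
rewrite /rint.
have E1 x : a + b * Complex x y1 - (a + b * Complex x y2) = b * 'i%C * rC (y1 - y2).
  rewrite -mulrA; have -> : 'i%C * rC (y1 - y2) = Complex x y1 - Complex x y2 :> C; last by ring.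
  by apply/eqP; rewrite eq_complex /=; apply/andP; split; apply/eqP; ring.
have E2 y : a + b * Complex x2 y - (a + b * Complex x1 y) = b * rC (x2 - x1).
  have -> : rC (x2 - x1) = Complex x2 y - Complex x1 y :> C; last by ring.
  by apply/eqP; rewrite eq_complex /=; apply/andP; split; apply/eqP; ring.
under eq_cint do rewrite E1.
under [X in 'i%C * X]eq_cint do rewrite E2.
rewrite !cint_cst// -[y1 - y2]opprB raddfN /=.
by move: (rC (y2 - y1) : C) (rC (x2 - x1) : C) => u v; ring.
Qed.

Lemma cn_rint f M : (forall z, bd z -> {for z, continuous f}) ->
  (forall z, bd z -> cn (f z) <= M) -> cn (I f) <= 4 * M * ((x2 - x1) + (y2 - y1)).
Proof.
move=> /cs[f1 f2 f3 f4] fM; rewrite mulrDr; apply: le_trans (cnD _ _) _.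
rewrite cnM cni mul1r.
have -> : 4 * M = 2 * (M + M) by ring.
apply: lerD; apply: cn_cint => //; try exact: csegB.
  by move=> t ht; apply: le_trans (cnB _ _) _; rewrite lerD// fM//; [exact: bd1|exact: bd2].
by move=> t ht; apply: le_trans (cnB _ _) _; rewrite lerD// fM//; [exact: bd4|exact: bd3].
Qed.

End Rect.

Lemma rint_splitx x1 x2 y1 y2 x f : x1 <= x <= x2 -> y1 <= y2 ->
  (forall z, bdry x1 x y1 y2 z -> {for z, continuous f}) ->
  (forall z, bdry x x2 y1 y2 z -> {for z, continuous f}) ->
  rint x1 x2 y1 y2 f = rint x1 x y1 y2 f + rint x x2 y1 y2 f.
Proof.
move=> /andP[x1x xx2] y12 hl hr.
have hx y : y = y1 \/ y = y2 -> cseg x1 x2 (fun x => f (Complex x y)).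
  move=> yE; apply: cseg_h => t /andP[x1t tx2].
  have yy : y1 <= y <= y2 by case: yE => ->; rewrite lexx y12.
  have yO : [\/ t = x1, t = x, y = y1 | y = y2] /\ [\/ t = x, t = x2, y = y1 | y = y2].
    by case: yE => ->; split; try (by apply: Or43); apply: Or44.
  case: yO => yO1 yO2; have [tx|/ltW xt] := leP t x.
    by apply: hl; split => //; rewrite /rect /= x1t tx yy.
  by apply: hr; split => //; rewrite /rect /= tx2 xt yy.
have h1 := hx y1 (or_introl erefl); have h2 := hx y2 (or_intror erefl).
have v1 : cseg y1 y2 (fun y => f (Complex x1 y)).
  by apply: cseg_v => y hy; apply: hl; split; [rewrite /rect /= hy lexx x1x|apply: Or41].
have v2 : cseg y1 y2 (fun y => f (Complex x2 y)).
  by apply: cseg_v => y hy; apply: hr; split; [rewrite /rect /= hy lexx xx2|apply: Or42].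
have v3 : cseg y1 y2 (fun y => f (Complex x y)).
  by apply: cseg_v => y hy; apply: hl; split; [rewrite /rect /= hy lexx x1x|apply: Or42].
rewrite /rint (cint_split (x := x)) ?x1x//; last exact: csegB.
rewrite !(@cintB _ y1 y2)//; ring.
Qed.

Lemma rint_splity x1 x2 y1 y2 y f : x1 <= x2 -> y1 <= y <= y2 ->
  (forall z, bdry x1 x2 y1 y z -> {for z, continuous f}) ->
  (forall z, bdry x1 x2 y y2 z -> {for z, continuous f}) ->
  rint x1 x2 y1 y2 f = rint x1 x2 y1 y f + rint x1 x2 y y2 f.
Proof.
move=> x12 /andP[y1y yy2] hl hr.
have hx x : x = x1 \/ x = x2 -> cseg y1 y2 (fun y => f (Complex x y)).
  move=> xE; apply: cseg_v => t /andP[y1t ty2].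
  have xx : x1 <= x <= x2 by case: xE => ->; rewrite lexx x12.
  have xO y0 y3 : [\/ x = x1, x = x2, t = y0 | t = y3].
    by case: xE => ->; [apply: Or41|apply: Or42].
  have [ty|/ltW yt] := leP t y.
    by apply: hl; split => //; rewrite /rect /= y1t ty xx.
  by apply: hr; split => //; rewrite /rect /= ty2 yt xx.
have h1 := hx x1 (or_introl erefl); have h2 := hx x2 (or_intror erefl).
have v1 : cseg x1 x2 (fun x => f (Complex x y1)).
  by apply: cseg_h => x h; apply: hl; split; [rewrite /rect /= h lexx y1y|apply: Or43].
have v2 : cseg x1 x2 (fun x => f (Complex x y2)).
  by apply: cseg_h => x h; apply: hr; split; [rewrite /rect /= h lexx yy2|apply: Or44].
have v3 : cseg x1 x2 (fun x => f (Complex x y)).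
  by apply: cseg_h => x h; apply: hl; split; [rewrite /rect /= h lexx y1y|apply: Or44].
rewrite /rint (cint_split (a := y1) (x := y)) ?y1y//; last exact: csegB.
rewrite !(@cintB _ x1 x2)//; ring.
Qed.

End RectangleIntegral.

Section Goursat.
Variable R : realType.
Local Notation C := R[i].
Implicit Types (x y : R) (f g : C -> C) (z w p : C).

Lemma pow2_gt0 n : 0 < 2 ^+ n :> R. Proof. by rewrite exprn_gt0. Qed.

Lemma pow2_small (K e : R) : 0 < e -> exists n, K / 2 ^+ n < e.
Proof.
move=> e0; have [n Kn] : exists n : nat, K / e < n%:R.
  by exists (Num.bound `|K / e|); apply: le_lt_trans (ler_norm _) (archi_boundP (normr_ge0 _)).
exists n; rewrite ltr_pdivrMr ?pow2_gt0// mulrC -ltr_pdivrMr//.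
by apply: lt_le_trans Kn _; rewrite -natrX ler_nat ltnW// ltn_expl.
Qed.

Lemma pow2_le0 (K a : R) : (forall n, a <= K / 2 ^+ n) -> a <= 0.
Proof.
move=> h; rewrite leNgt; apply/negP => a0; have [n] := pow2_small K a0.
by rewrite ltNge h.
Qed.

Lemma half_pow (L : R) n : L / 2 ^+ n = L / 2 ^+ n.+1 + L / 2 ^+ n.+1.
Proof.
by rewrite exprS; have := pow2_gt0 n; move: (2 ^+ n) => t t0; field; rewrite gt_eqF.
Qed.

Lemma geo_cvgR (a : nat -> R) L : 0 <= L -> (forall n, `|a n.+1 - a n| <= L / 2 ^+ n) ->
  exists l, forall n, `|a n - l| <= 2 * L / 2 ^+ n.
Proof.
move=> L0 h; pose b n := a n - 2 * L / 2 ^+ n; pose c n := a n + 2 * L / 2 ^+ n.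
have b1 n : b n <= b n.+1 /\ c n.+1 <= c n.
  have := h n; rewrite ler_norml /b /c -!mulrA [L / 2 ^+ n]half_pow => /andP[]; lra.
have bc n : b n <= c n.
  rewrite /b /c; have : 0 <= 2 * L / 2 ^+ n by rewrite divr_ge0 ?mulr_ge0// ltW ?pow2_gt0.
  by lra.
have bD n k : b n <= b (n + k)%N.
  by elim: k => [|k IH]; rewrite ?addn0// addnS (le_trans IH) ?(b1 _).1.
have cD n k : c (n + k)%N <= c n.
  by elim: k => [|k IH]; rewrite ?addn0// addnS (le_trans _ IH) ?(b1 _).2.
have bcm n m : b n <= c m.
  by apply: le_trans (bD n m) _; apply: le_trans (bc _) _; rewrite addnC.
exists (sup (range b)) => n.
have hs : has_sup (range b).
  by split; [exists (b 0%N), 0%N|exists (c 0%N) => _ [m _ <-]].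
have : b n <= sup (range b) by apply: sup_ubound; [case: hs|exists n].
have : sup (range b) <= c n by apply: ge_sup => [|_ [m _ <-]//]; case: hs.
rewrite /c {2}/b; move: (sup _) => l h1 h2; rewrite ler_norml; apply/andP; split; lra.
Qed.

Lemma geo_cvg (p : nat -> C) L : 0 <= L -> (forall n, cn (p n.+1 - p n) <= L / 2 ^+ n) ->
  exists l, forall n, cn (p n - l) <= 4 * L / 2 ^+ n.
Proof.
move=> L0 h.
have [|l hl] := @geo_cvgR (fun n => re (p n)) L L0.
  by move=> n; rewrite -raddfB; exact: le_trans (cn_Re _) (h n).
have [|k hk] := @geo_cvgR (fun n => im (p n)) L L0.
  by move=> n; rewrite -raddfB; exact: le_trans (cn_Im _) (h n).
exists (Complex l k) => n; apply: le_trans (cn_ReIm _) _.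
have -> : 4 * L / 2 ^+ n = 2 * L / 2 ^+ n + 2 * L / 2 ^+ n by ring.
by rewrite !raddfB /=; exact: lerD (hl n) (hk n).
Qed.

Lemma dep_choice (T : Type) (P : nat -> T -> Prop) (Q : nat -> T -> T -> Prop) t0 :
  P 0%N t0 -> (forall n t, P n t -> exists2 t', P n.+1 t' & Q n t t') ->
  exists s : nat -> T, [/\ s 0%N = t0, forall n, P n (s n) & forall n, Q n (s n) (s n.+1)].
Proof.
move=> P0 h.
have /choice[F hF] : forall nt : nat * T, exists t',
    P nt.1 nt.2 -> P nt.1.+1 t' /\ Q nt.1 nt.2 t'.
  move=> [n t] /=; have [/h[t' ? ?]|] := pselect (P n t); first by exists t'.
  by exists t0.
pose s := fix s n := if n is m.+1 then F (m, s m) else t0.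
have Ps n : P n (s n) by elim: n => //= n IH; case: (hF (n, s n) IH).
by exists s; split => // n; case: (hF (n, s n) (Ps n)).
Qed.

(* Cousin's lemma for the dyadic subdivisions of a rectangle: a property that is
   inherited from the four quarters and holds for small rectangles near each
   point holds for the whole rectangle. *)
Lemma cousin (x0 y0 w h : R) (P : nat -> R -> R -> Prop) : 0 <= w -> 0 <= h ->
  (forall n x y, P n.+1 x y -> P n.+1 (x + w / 2 ^+ n.+1) y ->
     P n.+1 x (y + h / 2 ^+ n.+1) -> P n.+1 (x + w / 2 ^+ n.+1) (y + h / 2 ^+ n.+1) ->
     P n x y) ->
  (forall p, rect x0 (x0 + w) y0 (y0 + h) p -> exists2 d, 0 < d & forall n x y,
     (forall z, rect x (x + w / 2 ^+ n) y (y + h / 2 ^+ n) z ->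
        cn (z - p) < d /\ cn (z - p) <= 5 * (w + h) / 2 ^+ n) -> P n x y) ->
  P 0%N x0 y0.
Proof.
move=> w0 h0 Psub Ploc; apply: contrapT => nP.
pose Q n (t : R * R) := [/\ ~ P n t.1 t.2,
  x0 <= t.1, t.1 + w / 2 ^+ n <= x0 + w, y0 <= t.2 & t.2 + h / 2 ^+ n <= y0 + h].
pose S n (t t' : R * R) := (t'.1 = t.1 \/ t'.1 = t.1 + w / 2 ^+ n.+1) /\
   (t'.2 = t.2 \/ t'.2 = t.2 + h / 2 ^+ n.+1).
have wn n : 0 <= w / 2 ^+ n by rewrite divr_ge0// ltW ?pow2_gt0.
have hn n : 0 <= h / 2 ^+ n by rewrite divr_ge0// ltW ?pow2_gt0.
have [||s [s0 sQ sS]] := @dep_choice _ Q S (x0, y0).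
- by split => //=; rewrite expr0 divr1.
- move=> n [x y] [/= nPn x0x xw y0y yh].
  have := wn n.+1; have := hn n.+1 => hn1 wn1.
  move: xw yh; rewrite [w / _]half_pow [h / _]half_pow !addrA => xw yh.
  have [P1|?] := pselect (P n.+1 x y); last first.
    by exists (x, y); split => //=; [lra|lra|left|left].
  have [P2|?] := pselect (P n.+1 (x + w / 2 ^+ n.+1) y); last first.
    by exists (x + w / 2 ^+ n.+1, y); split => //=; [lra|lra|right|left].
  have [P3|?] := pselect (P n.+1 x (y + h / 2 ^+ n.+1)); last first.
    by exists (x, y + h / 2 ^+ n.+1); split => //=; [lra|lra|left|right].
  exists (x + w / 2 ^+ n.+1, y + h / 2 ^+ n.+1); last by split; right.
  by split => //=; [move=> P4; exact/nPn/Psub|lra|lra].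
pose p n : C := Complex (s n).1 (s n).2.
have wh0 : 0 <= w + h by rewrite addr_ge0.
have [|l hl] := @geo_cvg p (w + h) wh0.
  move=> n; apply: le_trans (cn_ReIm _) _; rewrite !raddfB /p /=.
  rewrite half_pow; case: (sS n) => s1 s2; have := wn n.+1; have := hn n.+1 => hn1 wn1.
  rewrite mulrDl -[X in X <= _]addr0; apply: lerD; last by rewrite addr_ge0.
  by apply: lerD; [case: s1 => ->|case: s2 => ->];
    rewrite ?subrr ?normr0// addrC addKr ger0_norm.
have re_l n : `|(s n).1 - re l| <= 4 * (w + h) / 2 ^+ n.
  by rewrite -[(s n).1]/(re (p n)) -raddfB; exact: le_trans (cn_Re _) (hl n).
have im_l n : `|(s n).2 - im l| <= 4 * (w + h) / 2 ^+ n.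
  by rewrite -[(s n).2]/(im (p n)) -raddfB; exact: le_trans (cn_Im _) (hl n).
have lR : rect x0 (x0 + w) y0 (y0 + h) l.
  split; apply/andP; split; rewrite -subr_le0; apply: (@pow2_le0 (4 * (w + h))) => n;
    have [_ a1 a2 a3 a4] := sQ n; have := wn n; have := hn n => hn1 wn1;
    by have := re_l n; have := im_l n; rewrite !ler_norml => /andP[] b1 b2 /andP[]; lra.
have [d d0 hd] := Ploc l lR.
have [n hnd] := pow2_small (5 * (w + h)) d0.
have [+ _ _ _ _] := sQ n; apply; apply: hd => z [/andP[z1 z2] /andP[z3 z4]].
suff H : cn (z - l) <= 5 * (w + h) / 2 ^+ n by split=> //; exact: le_lt_trans hnd.
apply: le_trans (cn_tri (p n) _ _) _.
have -> : 5 * (w + h) / 2 ^+ n = (w / 2 ^+ n + h / 2 ^+ n) + 4 * (w + h) / 2 ^+ n by ring.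
apply: lerD => //; apply: le_trans (cn_ReIm _) _; rewrite !raddfB /p /=.
by apply: lerD; rewrite ger0_norm ?subr_ge0// lerBlDl.
Qed.

Lemma rint_quarter (x y w h : R) f : 0 <= w -> 0 <= h ->
  (forall z, rect x (x + (w + w)) y (y + (h + h)) z -> {for z, continuous f}) ->
  rint x (x + (w + w)) y (y + (h + h)) f =
    rint x (x + w) y (y + h) f + rint x (x + w) (y + h) (y + h + h) f +
    (rint (x + w) (x + w + w) y (y + h) f +
     rint (x + w) (x + w + w) (y + h) (y + h + h) f).
Proof.
move=> w0 h0 cf.
have cf' a b c d : x <= a -> b <= x + (w + w) -> y <= c -> d <= y + (h + h) ->
    forall z, bdry a b c d z -> {for z, continuous f}.
  move=> xa bx yc dy z [[/andP[az zb] /andP[cz zd]] _]; apply: cf; split.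
    by rewrite (le_trans xa)// (le_trans zb).
  by rewrite (le_trans yc)// (le_trans zd).
have Ex : rint x (x + (w + w)) y (y + (h + h)) f =
    rint x (x + w) y (y + (h + h)) f + rint (x + w) (x + (w + w)) y (y + (h + h)) f.
  by apply: rint_splitx; [apply/andP; split; lra|lra|apply: cf'; lra|apply: cf'; lra].
have Ey a b : x <= a -> a <= b -> b <= x + (w + w) -> rint a b y (y + (h + h)) f =
    rint a b y (y + h) f + rint a b (y + h) (y + (h + h)) f.
  move=> xa ab bx.
  by apply: rint_splity; [lra|apply/andP; split; lra|apply: cf'; lra|apply: cf'; lra].
by rewrite Ex !Ey ?addrA//; clear Ex Ey cf cf'; lra.
Qed.

Lemma halves_in (x x1 w W : R) : 0 <= w -> x1 <= x -> x + (w + w) <= x1 + W ->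
  [/\ x1 <= x + w, x + w <= x1 + W & x + w + w <= x1 + W].
Proof. by move=> *; split; lra. Qed.

Lemma rect_in x1 x2 y1 y2 a b c d : a <= x1 -> x2 <= b -> c <= y1 -> y2 <= d ->
  rect x1 x2 y1 y2 `<=` rect a b c d.
Proof.
move=> ax xb cy yd z [/andP[z1 z2] /andP[z3 z4]].
by split; apply/andP; split; [exact: le_trans z1|exact: le_trans xb
  |exact: le_trans z3|exact: le_trans yd].
Qed.

(** Goursat's bisection in positive form: the bound [e / 4^n] adds up over four quarters. Near a
    point [p] it holds because the tangent of [f] at [p], whose integral vanishes, can be
    subtracted; the remaining integrand and the perimeter are both of order [1 / 2^n]. *)
Lemma goursat_size x1 y1 (w h : R) f : 0 <= w -> 0 <= h ->
  (forall z, rect x1 (x1 + w) y1 (y1 + h) z -> derivable f z 1) ->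
  rint x1 (x1 + w) y1 (y1 + h) f = 0.
Proof.
move=> w0 h0 df; apply/eqP; rewrite -cn_eq0 eq_le cn_ge0 andbT.
apply/ler_addgt0Pl => e e0; rewrite addr0.
pose P n x y := x1 <= x -> x + w / 2 ^+ n <= x1 + w -> y1 <= y -> y + h / 2 ^+ n <= y1 + h ->
  cn (rint x (x + w / 2 ^+ n) y (y + h / 2 ^+ n) f) <= e / 2 ^+ n / 2 ^+ n.
suff : P 0%N x1 y1 by rewrite /P expr0 !divr1; apply.
have wn n : 0 <= w / 2 ^+ n by rewrite divr_ge0// ltW ?pow2_gt0.
have hn n : 0 <= h / 2 ^+ n by rewrite divr_ge0// ltW ?pow2_gt0.
apply: (@cousin _ _ w h) => // [n x y|p pR].
  have := wn n.+1; have := hn n.+1 => hn1 wn1.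
  rewrite /P [w / 2 ^+ n]half_pow [h / 2 ^+ n]half_pow => P1 P2 P3 P4 xx1 xx2 yy1 yy2.
  rewrite rint_quarter//; last first.
    by move=> z /(rect_in xx1 xx2 yy1 yy2) /df /derivable_cont.
  apply: le_trans (cnD _ _) _.
  have -> : e / 2 ^+ n / 2 ^+ n =
     (e / 2 ^+ n.+1 / 2 ^+ n.+1 + e / 2 ^+ n.+1 / 2 ^+ n.+1) +
     (e / 2 ^+ n.+1 / 2 ^+ n.+1 + e / 2 ^+ n.+1 / 2 ^+ n.+1).
    by rewrite [e / 2 ^+ n]half_pow mulrDl [_ / 2 ^+ n.+1 / _]half_pow.
  have [a1 a2 a5] := halves_in wn1 xx1 xx2.
  have [a3 a4 a6] := halves_in hn1 yy1 yy2.
  have b1 := P1 xx1 a2 yy1 a4.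
  have b2 := P2 a1 a5 yy1 a4.
  have b3 := P3 xx1 a2 a3 a6.
  have b4 := P4 a1 a5 a3 a6.
  exact: lerD (le_trans (cnD _ _) (lerD b1 b3)) (le_trans (cnD _ _) (lerD b2 b4)).
have dfp := hasd_dv (df p pR).
(* From [cn_rint]: 4 times [5 (w + h) / 2^n], the bound on the distance to [p], times the edge sum
   [(w + h) / 2^n]. The added 1 keeps the divisor positive for a degenerate rectangle. *)
have K0 : 0 < 20 * (w + h) ^+ 2 + 1 by rewrite ltr_wpDl// mulr_ge0// sqr_ge0.
have [d d0 hd] := dfp _ (divr_gt0 e0 K0); exists d => // n x y hz xx1 xx2 yy1 yy2.
have wn1 := wn n; have hn1 := hn n.
have inR z : bdry x (x + w / 2 ^+ n) y (y + h / 2 ^+ n) z -> derivable f z 1.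
  by move=> [/(rect_in xx1 xx2 yy1 yy2) /df].
pose D := derive1 f p.
have xx : x <= x + w / 2 ^+ n by rewrite lerDl.
have yy : y <= y + h / 2 ^+ n by rewrite lerDl.
have cA z : {for z, continuous (fun z => (f p - D * p) + D * z)}.
  exact: hasd_cont (hasdD (hasd_cst _ _) (hasdZ D (hasd_id z))).
have -> : rint x (x + w / 2 ^+ n) y (y + h / 2 ^+ n) f =
    rint x (x + w / 2 ^+ n) y (y + h / 2 ^+ n) (fun z => f z - (f p - D * p + D * z)).
  have I0 := rint_affine xx yy (f p - D * p) D.
  have -> := rintB xx yy (fun z zb => derivable_cont (inR z zb)) (fun z _ => cA z).
  by rewrite I0 subr0.
apply: (le_trans (cn_rint (M := e / (20 * (w + h) ^+ 2 + 1) * (5 * (w + h) / 2 ^+ n)) xx yy _ _)).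
- by move=> z zb; exact: (cvgB (derivable_cont (inR z zb)) (cA z)).
- move=> z [zr _]; have [zd zs] := hz z zr.
  have -> : f z - (f p - D * p + D * z) = f z - f p - D * (z - p) by ring.
  by apply: le_trans (hd z zd) _; rewrite ler_wpM2l// divr_ge0 ?ltW.
have -> : 4 * (e / (20 * (w + h) ^+ 2 + 1) * (5 * (w + h) / 2 ^+ n)) *
    (x + w / 2 ^+ n - x + (y + h / 2 ^+ n - y)) =
    (20 * (w + h) ^+ 2) / (20 * (w + h) ^+ 2 + 1) * (e / 2 ^+ n / 2 ^+ n) by ring.
rewrite ler_piMl//; first by rewrite !divr_ge0// ltW// pow2_gt0.
by rewrite ler_pdivrMr// mul1r lerDl.
Qed.

Theorem goursat x1 x2 y1 y2 f : x1 <= x2 -> y1 <= y2 ->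
  (forall z, rect x1 x2 y1 y2 z -> derivable f z 1) -> rint x1 x2 y1 y2 f = 0.
Proof.
by have := @goursat_size x1 y1 (x2 - x1) (y2 - y1) f; rewrite !subrKC !subr_ge0; apply.
Qed.

End Goursat.

Section CauchyFormula.
Variable R : realType.
Local Notation C := R[i].
Local Notation mu := (@lebesgue_measure R).
Implicit Types (x y : R) (f g : C -> C) (z w p : C).

Lemma cont_cst (c : C) z : {for z, continuous (fun=> c : C)}.
Proof. exact: hasd_cont (hasd_cst c z). Qed.

Lemma contB f g z : {for z, continuous f} -> {for z, continuous g} ->
  {for z, continuous (fun z => f z - g z)}.
Proof. by move=> hf hg; exact: (cvgB hf hg). Qed.

Lemma contM f g z : {for z, continuous f} -> {for z, continuous g} ->
  {for z, continuous (fun z => f z * g z)}.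
Proof. by move=> hf hg; have H := cvgM hf hg; exact: H. Qed.

(** Four strips are cut off one after the other; none contains [w], so Goursat's theorem makes each
    integral zero. This lets a contour around a singularity shrink. *)
Lemma rect_trim x1 x2 y1 y2 a b c d w f : x1 <= a -> a < re w -> re w < b -> b <= x2 ->
  y1 <= c -> c < im w -> im w < d -> d <= y2 ->
  (forall z, rect x1 x2 y1 y2 z -> z != w -> derivable f z 1) ->
  rint x1 x2 y1 y2 f = rint a b c d f.
Proof.
move=> xa aw wb bx yc cw wd dy df.
have c1 z : re z != re w -> rect x1 x2 y1 y2 z -> derivable f z 1.
  by move=> zw /df; apply; apply: contra_neq zw => ->.
have c2 z : im z != im w -> rect x1 x2 y1 y2 z -> derivable f z 1.
  by move=> zw /df; apply; apply: contra_neq zw => ->.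
have ab : a <= b := ltW (lt_trans aw wb).
have cd : c <= d := ltW (lt_trans cw wd).
have y12 : y1 <= y2 := le_trans yc (le_trans cd dy).
have ax2 : a <= x2 := le_trans ab bx.
have cy2 : c <= y2 := le_trans cd dy.
have zl x : x <= a -> (x == re w) = false by move=> xa'; rewrite lt_eqF// (le_lt_trans xa').
have zr x : b <= x -> (x == re w) = false by move=> xa'; rewrite gt_eqF// (lt_le_trans wb).
have zd y : y <= c -> (y == im w) = false by move=> xa'; rewrite lt_eqF// (le_lt_trans xa').
have zu y : d <= y -> (y == im w) = false by move=> xa'; rewrite gt_eqF// (lt_le_trans wd).
have bdc (p1 p2 q1 q2 : R) z : bdry p1 p2 q1 q2 z -> x1 <= p1 -> p2 <= x2 -> y1 <= q1 -> q2 <= y2 ->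
    (p1 == re w) = false -> (p2 == re w) = false -> (q1 == im w) = false ->
    (q2 == im w) = false -> {for z, continuous f}.
  move=> [zR zO] h1 h2 h3 h4 e1 e2 e3 e4; apply: derivable_cont.
  have zR' := rect_in h1 h2 h3 h4 zR.
  by case: zO => E; [apply: c1|apply: c1|apply: c2|apply: c2] => //; rewrite E ?e1 ?e2 ?e3 ?e4.
have G (p1 p2 q1 q2 : R) : p1 <= p2 -> q1 <= q2 -> x1 <= p1 -> p2 <= x2 -> y1 <= q1 -> q2 <= y2 ->
    [\/ p2 <= a, b <= p1, q2 <= c | d <= q1] -> rint p1 p2 q1 q2 f = 0.
  move=> p12 q12 h1 h2 h3 h4 hO; apply: goursat => // z zR.
  have zR' := rect_in h1 h2 h3 h4 zR.
  have [/andP[z1 z2] /andP[z3 z4]] := zR.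
  case: hO => hO; [apply: c1|apply: c1|apply: c2|apply: c2] => //.
  - by rewrite zl// (le_trans z2 hO).
  - by rewrite zr// (le_trans hO z1).
  - by rewrite zd// (le_trans z4 hO).
  - by rewrite zu// (le_trans hO z3).
have x1a : (x1 == re w) = false by exact: zl.
have x2a : (x2 == re w) = false by exact: zr.
have y1a : (y1 == im w) = false by exact: zd.
have y2a : (y2 == im w) = false by exact: zu.
have aa : (a == re w) = false by exact: zl.
have bb : (b == re w) = false by exact: zr.
have cc : (c == im w) = false by exact: zd.
have dd : (d == im w) = false by exact: zu.
rewrite (@rint_splitx _ x1 x2 y1 y2 a)// ?xa//; last 2 first.
- by move=> z /bdc; apply.
- by move=> z /bdc; apply.
rewrite (G x1 a)//; last by apply: Or41.
rewrite add0r (@rint_splitx _ a x2 y1 y2 b)// ?ab//; last 2 first.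
- by move=> z /bdc; apply.
- by move=> z /bdc; apply=> //; exact: le_trans xa ab.
rewrite (G b x2)//; [|exact: le_trans xa ab|exact: Or42].
rewrite addr0 (@rint_splity _ a b y1 y2 c)// ?yc//; last 2 first.
- by move=> z /bdc; apply.
- by move=> z /bdc; apply.
rewrite (G a b y1 c)//; last exact: Or43.
rewrite add0r (@rint_splity _ a b c y2 d)// ?cd//; last 2 first.
- by move=> z /bdc; apply.
- by move=> z /bdc; apply=> //; exact: le_trans yc cd.
rewrite (G a b d y2)//; [by rewrite addr0|exact: le_trans yc cd|exact: Or44].
Qed.

(** The primitive [2 atan ((x - c) / e)] runs from [- pi / 2] to [pi / 2]. Each pair of opposite
    edges of a square contributes this integral, times i, to that of [1 / (z - w)]. *)
Lemma int_atan (c e : R) : 0 < e ->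
  (\int[mu]_(x in `[c - e, c + e]) (2 * e / (e ^+ 2 + (x - c) ^+ 2)))%R = pi.
Proof.
move=> e0; have e1 : e != 0 by rewrite gt_eqF.
pose F x : R := 2 * atan ((x - c) / e).
have dn x : e ^+ 2 + (x - c) ^+ 2 != 0.
  by rewrite gt_eqF// ltr_pwDl ?sqr_ge0// exprn_gt0.
have dF x : is_derive x 1 F (2 * e / (e ^+ 2 + (x - c) ^+ 2)).
  have -> : 2 * e / (e ^+ 2 + (x - c) ^+ 2) =
      2 *: (e^-1 *: (1 + ((x - c) / e) ^+ 2)^-1).
    rewrite /GRing.scale /=; field; rewrite e1 /=.
    by have := dn x; apply: contra_neq => <-; ring.
  apply: is_deriveZ.
  have h : is_derive x 1 (fun x => (x - c) / e) e^-1.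
    have -> : (fun x => (x - c) / e) = e^-1 *: (fun x => x - c).
      by apply/funext => t; rewrite /GRing.scale /= mulrC.
    have h0 : is_derive x 1 (fun x => x - c) (1 - 0) by apply: is_deriveB.
    by have := is_deriveZ e^-1 h0; rewrite subr0 [_ *: 1]mulr1.
  by rewrite [_ *: _]mulrC; exact: (@is_derive1_comp _ _ _ _ _ _ (is_derive1_atan _) h).
have cF x : {for x, continuous F}.
  by apply: differentiable_continuous; apply/derivable1_diffP; case: (dF x).
have cg : continuous (fun x => 2 * e / (e ^+ 2 + (x - c) ^+ 2) : R).
  move=> x; apply: cvgM; first exact: cvg_cst.
  apply: cvgV; first exact: dn.
  apply: cvgD; first exact: cvg_cst.
  have xc : {for x, continuous (fun x => x - c)} by apply: cvgB; [exact: cvg_id|exact: cvg_cst].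
  exact: (cvgM xc xc).
rewrite /Rintegral (@continuous_FTC2 R _ F) //=.
- rewrite /F; have -> : c + e - c = e by ring.
  have -> : c - e - c = - e by ring.
  by rewrite mulNr divff// atanN atan1; field.
- by lra.
- exact: continuous_subspaceT.
- split; [by move=> x _; case: (dF x)|apply: cvg_at_right_filter; exact: cF
    |apply: cvg_at_left_filter; exact: cF].
- by move=> x _; rewrite derive1E; case: (dF x).
Qed.

Definition two_pi_i : C := Complex 0 (pi + pi).

Lemma two_pi_i_neq0 : two_pi_i != 0.
Proof.
by rewrite /two_pi_i eq_complex /= eqxx /= gt_eqF// addr_gt0 ?pi_gt0.
Qed.

Lemma rint_inv w (e : R) : 0 < e ->
  rint (re w - e) (re w + e) (im w - e) (im w + e) (fun z => (z - w)^-1) = two_pi_i.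
Proof.
move=> e0; rewrite /rint.
have inv_sum (s : R) : s ^+ 2 + e ^+ 2 != 0 by rewrite gt_eqF// ltr_wpDl ?sqr_ge0// exprn_gt0.
have E1 x : (Complex x (im w - e) - w)^-1 - (Complex x (im w + e) - w)^-1 =
    Complex 0 (2 * e / (e ^+ 2 + (x - re w) ^+ 2)).
  case: w => u v /=; rewrite [LHS]/(_ + _) /=.
  have -> : v - e - v = - e by ring.
  have -> : v + e - v = e by ring.
  have := inv_sum (x - u); rewrite [e ^+ 2 + _]addrC => h.
  by congr Complex; rewrite ?sqrrN; field; rewrite h.
have E2 y : (Complex (re w + e) y - w)^-1 - (Complex (re w - e) y - w)^-1 =
    Complex (2 * e / (e ^+ 2 + (y - im w) ^+ 2)) 0.
  case: w {E1} => u v /=; rewrite [LHS]/(_ + _) /=.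
  have -> : u - e - u = - e by ring.
  have -> : u + e - u = e by ring.
  have := inv_sum (y - v); rewrite [_ ^+ 2 + e ^+ 2]addrC => h.
  by congr Complex; rewrite ?sqrrN; field; rewrite h.
rewrite (eq_cint (fun x _ => E1 x)) (eq_cint (fun x _ => E2 x)) /cint /=.
rewrite !int_atan// /Rintegral !integral0 /=.
by apply/eqP; rewrite eq_complex /=; apply/andP; split; apply/eqP; ring.
Qed.

(** The contour shrinks to a square of half side [t] about [w], where [f w / (z - w)] is subtracted.
    The remaining difference quotient is at most [M] in modulus, so its integral is at most
    [16 M t], as small as desired. *)
Theorem cauchy_rect x1 x2 y1 y2 f w : x1 < re w < x2 -> y1 < im w < y2 ->
  (forall z, rect x1 x2 y1 y2 z -> derivable f z 1) ->
  rint x1 x2 y1 y2 (fun z => f z / (z - w)) = f w * two_pi_i.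
Proof.
move=> /andP[xw wx] /andP[yw wy] df.
have dfw : hasd f w (derive1 f w).
  by apply/hasd_dv/df; split; rewrite !ltW.
have [r r0 hr] := dfw 1 ltr01.
apply/eqP; rewrite -subr_eq0 -cn_eq0 eq_le cn_ge0 andbT.
pose M := cn (derive1 f w) + 1.
have M0 : 0 < M by rewrite ltr_wpDl ?cn_ge0.
apply/ler_addgt0Pl => e e0; rewrite addr0.
pose s := Num.min (Num.min (re w - x1) (x2 - re w)) (Num.min (im w - y1) (y2 - im w)).
have s0 : 0 < s by rewrite /s !lt_min !subr_gt0 xw wx yw.
pose t := Num.min (s / 2) (Num.min (r / 4) (e / (16 * M))).
have t0 : 0 < t by rewrite /t !lt_min !divr_gt0 ?mulr_gt0.
have ts : t < s by rewrite /t gt_min; apply/orP; left; rewrite ltr_pdivrMr//; lra.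
have tr : 4 * t <= r by rewrite mulrC -ler_pdivlMr// /t !ge_min lexx !orbT.
have te : 16 * M * t <= e by rewrite mulrC -ler_pdivlMr ?mulr_gt0// /t !ge_min lexx !orbT.
have /andP[/andP[s1 s2] /andP[s3 s4]] : ((s <= re w - x1) && (s <= x2 - re w)) &&
    ((s <= im w - y1) && (s <= y2 - im w)) by rewrite /s !ge_min !lexx ?orbT.
have dg z : rect x1 x2 y1 y2 z -> z != w -> derivable (fun z => f z / (z - w)) z 1.
  move=> zR zw; have zw0 : z - w != 0 by rewrite subr_eq0.
  apply: hasd_derivable (hasdM (hasd_dv (df z zR)) _).
  apply: hasdV => //; exact: hasdB (hasd_id z) (hasd_cst w z).
move: (t) (t0) (ts) (tr) (te) => {}t {}t0 {}ts {}tr {}te.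
rewrite (@rect_trim _ _ _ _ (re w - t) (re w + t) (im w - t) (im w + t) w)//; try lra.
have bw z : bdry (re w - t) (re w + t) (im w - t) (im w + t) z ->
    [/\ z != w, cn (z - w) < r & rect x1 x2 y1 y2 z].
  move=> [zR zO]; split.
  - by apply/eqP => zw; rewrite zw in zO; case: zO; lra.
  - case: zR => /andP[z1 z2] /andP[z3 z4].
    apply: le_lt_trans (cn_ReIm _) _; rewrite !raddfB.
    have n1 : `|re z - re w| <= t by rewrite ler_norml; apply/andP; split; lra.
    have n2 : `|im z - im w| <= t by rewrite ler_norml; apply/andP; split; lra.
    by lra.
  - by apply: rect_in zR; lra.
have xx : re w - t <= re w + t by lra.
have yy : im w - t <= im w + t by lra.
pose I := rint (re w - t) (re w + t) (im w - t) (im w + t).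
have c1 z : bdry (re w - t) (re w + t) (im w - t) (im w + t) z ->
   {for z, continuous (fun z => f z / (z - w))}.
  by move=> /bw[zw _ zR]; exact: derivable_cont (dg z zR zw).
have c2 z : bdry (re w - t) (re w + t) (im w - t) (im w + t) z ->
   {for z, continuous (fun z => (z - w)^-1)}.
  move=> /bw[zw _ zR]; have zw0 : z - w != 0 by rewrite subr_eq0.
  exact: hasd_cont (@hasdV _ (fun z => z - w) z _ zw0 (hasdB (hasd_id z) (hasd_cst w z))).
have c3 z : bdry (re w - t) (re w + t) (im w - t) (im w + t) z ->
   {for z, continuous (fun z => f w * (z - w)^-1)}.
  by move=> /c2 h; exact: contM (cont_cst (c := f w) (z := z)) h.
rewrite -(rint_inv w t0) -(rintZ xx yy (f w) c2) -(rintB xx yy c1 c3).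
apply: le_trans te.
have -> : 16 * M * t = 4 * M * ((re w + t - (re w - t)) + (im w + t - (im w - t))) by ring.
apply: (cn_rint xx yy).
  by move=> z zb; exact: contB (c1 z zb) (c3 z zb).
move=> z /bw[zw zr _]; have zw0 : 0 < cn (z - w) by rewrite cn_gt0 subr_eq0.
rewrite -mulrBl cnf ler_pdivrMr//.
have -> : f z - f w = (f z - f w - derive1 f w * (z - w)) + derive1 f w * (z - w) by ring.
apply: le_trans (cnD _ _) _; rewrite addrC /M mulrDl cnM lerD2l.
exact: hr.
Qed.

End CauchyFormula.

Section Contour.
Variable R : realType.
Local Notation C := R[i].
Implicit Types (x y : R) (f g phi : C -> C) (z w p a : C).

Lemma rect_bounded x0 y0 (w h : R) f : 0 <= w -> 0 <= h ->
  (forall z, rect x0 (x0 + w) y0 (y0 + h) z -> {for z, continuous f}) ->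
  exists M, forall z, rect x0 (x0 + w) y0 (y0 + h) z -> cn (f z) <= M.
Proof.
move=> w0 h0 cf.
pose P n x y := exists M, forall z, rect x (x + w / 2 ^+ n) y (y + h / 2 ^+ n) z ->
  cn (f z) <= M.
suff : P 0%N x0 y0 by rewrite /P expr0 !divr1.
apply: (@cousin _ _ _ w h) => // [n x y [M1 h1] [M2 h2] [M3 h3] [M4 h4]|p pR].
  exists (Num.max (Num.max M1 M2) (Num.max M3 M4)) => z [/andP[z1 z2] /andP[z3 z4]].
  rewrite !le_max; move: z2 z4; rewrite [w / _]half_pow [h / _]half_pow !addrA => z2 z4.
  have [z5|/ltW z5] := leP (re z) (x + w / 2 ^+ n.+1);
    have [z6|/ltW z6] := leP (im z) (y + h / 2 ^+ n.+1).
  - by rewrite h1//; split; apply/andP.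
  - by rewrite h3 ?orbT//; split; apply/andP.
  - by rewrite h2 ?orbT//; split; apply/andP.
  - by rewrite h4 ?orbT//; split; apply/andP.
have /cont_discP/(_ 1 ltr01)[d d0 hd] := cf p pR.
exists d => // n x y hz; exists (cn (f p) + 1) => z /hz[/hd zd _].
by rewrite -lerBlDl (le_trans (cn_lb _ _))// ltW.
Qed.

(** A square of half side [h] lies between the circles of radius [h] and [2 h] about its centre;
    that is how discs enter the estimates below. *)
Definition contour a h := bdry (re a - h) (re a + h) (im a - h) (im a + h).

Definition contour_int a h phi : C :=
  (two_pi_i R)^-1 * rint (re a - h) (re a + h) (im a - h) (im a + h) phi.

Lemma rect_center a h z : rect (re a - h) (re a + h) (im a - h) (im a + h) z ->
  cn (z - a) <= 2 * h.
Proof.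
move=> [/andP[z1 z2] /andP[z3 z4]].
apply: le_trans (cn_ReIm _) _; rewrite !raddfB.
have : `|re z - re a| <= h by rewrite ler_norml; apply/andP; split; lra.
have : `|im z - im a| <= h by rewrite ler_norml; apply/andP; split; lra.
lra.
Qed.

Lemma ctr_dist a h z : 0 < h -> contour a h z -> h <= cn (z - a) <= 2 * h.
Proof.
move=> h0 [/[dup] zR /rect_center -> zO]; rewrite andbT.
have [] : h <= `|re z - re a| \/ h <= `|im z - im a|.
- have e1 (u : R) : h <= `|u - h - u| by rewrite addrAC subrr sub0r normrN ler_norm.
  have e2 (u : R) : h <= `|u + h - u| by rewrite addrAC subrr add0r ler_norm.
  by case: zO => ->; [left; exact: e1|left; exact: e2|right; exact: e1|right; exact: e2].
- by rewrite -raddfB => /le_trans; apply; exact: cn_Re.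
- by rewrite -raddfB => /le_trans; apply; exact: cn_Im.
Qed.

Section Fixed.
Variables (a : C) (h : R).
Hypothesis h0 : 0 < h.

Let xx : re a - h <= re a + h. Proof. by have := h0; lra. Qed.
Let yy : im a - h <= im a + h. Proof. by have := h0; lra. Qed.

Let ctr_pt : contour a h (Complex (re a + h) (im a)).
Proof.
have H := h0; split; last exact: Or42.
by split => /=; apply/andP; split; lra.
Qed.

Lemma cIB f g : (forall z, contour a h z -> {for z, continuous f}) ->
  (forall z, contour a h z -> {for z, continuous g}) ->
  contour_int a h (fun z => f z - g z) = contour_int a h f - contour_int a h g.
Proof. by move=> cf cg; rewrite /contour_int (rintB xx yy cf cg) mulrBr. Qed.

Lemma cIZ (c : C) f : (forall z, contour a h z -> {for z, continuous f}) ->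
  contour_int a h (fun z => c * f z) = c * contour_int a h f.
Proof. by move=> cf; rewrite /contour_int (rintZ xx yy c cf) mulrCA. Qed.

Lemma eq_cI f g : (forall z, contour a h z -> f z = g z) -> contour_int a h f = contour_int a h g.
Proof. by move=> fg; rewrite /contour_int (eq_rint xx yy fg). Qed.

(** The factor [16 h] is 4 times the sum [4 h] of two edge lengths; [1 / (2 pi)] is simply bounded
    by 1. *)
Lemma cn_cI f M : (forall z, contour a h z -> {for z, continuous f}) ->
  (forall z, contour a h z -> cn (f z) <= M) -> cn (contour_int a h f) <= 16 * h * M.
Proof.
move=> cf fM; have M0 : 0 <= M.
  exact: le_trans (cn_ge0 _) (fM _ ctr_pt).
rewrite /contour_int cnM; have := cn_rint xx yy cf fM.
have -> : 4 * M * (re a + h - (re a - h) + (im a + h - (im a - h))) = 16 * h * M by ring.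
move=> H; apply: le_trans H; rewrite ler_piMl ?cn_ge0// cnV invf_le1 ?cn_gt0 ?two_pi_i_neq0//.
apply: le_trans (cn_Im _); rewrite /= ger0_norm; have := pi_ge2 R; lra.
Qed.

Lemma cauchy_formula f w : (forall z, cn (z - a) <= 2 * h -> derivable f z 1) -> cn (w - a) < h ->
  f w = contour_int a h (fun z => f z / (z - w)).
Proof.
move=> df wh; rewrite /contour_int (@cauchy_rect _ _ _ _ _ f w).
- by rewrite mulrC mulfK// two_pi_i_neq0.
- have := le_lt_trans (cn_Re (w - a)) wh; rewrite raddfB /= ltr_norml => /andP[u1 u2].
  by apply/andP; split; lra.
- have := le_lt_trans (cn_Im (w - a)) wh; rewrite raddfB /= ltr_norml => /andP[u1 u2].
  by apply/andP; split; lra.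
- by move=> z /rect_center /df.
Qed.

Lemma ctr_sep w z : cn (w - a) < h -> contour a h z -> h - cn (w - a) <= cn (z - w).
Proof.
move=> wh /(ctr_dist h0)/andP[hz _]; rewrite lerBlDr (le_trans hz)//.
by rewrite -[z - a](subrKA w) (le_trans (cnD _ _)).
Qed.

Lemma ctr_neq w z : cn (w - a) < h -> contour a h z -> z - w != 0.
Proof. by move=> wh zc; rewrite -cn_gt0 (lt_le_trans _ (ctr_sep wh zc))// subr_gt0. Qed.

Lemma cont_inv w z n : z - w != 0 -> {for z, continuous (fun z => (z - w) ^- n)}.
Proof.
move=> zw; have hX := hasdX n (hasdB (hasd_id z) (hasd_cst w z)).
have zwn : (fun z => (z - w) ^+ n) z != 0 by rewrite expf_neq0.
exact: hasd_cont (@hasdV _ (fun z => (z - w) ^+ n) z _ zwn hX).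
Qed.

Section Transform.
Variables (phi : C -> C) (M : R).
Hypothesis cphi : forall z, contour a h z -> {for z, continuous phi}.
Hypothesis phiM : forall z, contour a h z -> cn (phi z) <= M.

(** Up to the factor [(n - 1)!] this is the derivative of order [n - 1] of the Cauchy integral of
    [phi]. As [phi] need only be continuous on the contour, it also serves to remove
    singularities. *)
Definition cauchy_transform n w := contour_int a h (fun z => phi z * (z - w) ^- n).

Lemma cont_kernel w n z : cn (w - a) < h -> contour a h z ->
  {for z, continuous (fun z => phi z * (z - w) ^- n)}.
Proof. by move=> wh zc; exact: contM (cphi zc) (cont_inv (n := n) (ctr_neq wh zc)). Qed.

Let M0 : 0 <= M.
Proof. exact: le_trans (cn_ge0 _) (phiM ctr_pt). Qed.

Lemma cn_CT n w d : 0 < d -> cn (w - a) <= h - d -> cn (cauchy_transform n w) <= 16 * h * M / d ^+ n.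
Proof.
move=> d0 wh; have wh' : cn (w - a) < h by lra.
rewrite -mulrA; apply: cn_cI => [z zc|z zc]; first exact: cont_kernel.
rewrite cnM cnV cnX; apply: ler_pM => //; rewrite ?cn_ge0 ?invr_ge0 ?exprn_ge0 ?cn_ge0 ?phiM//.
rewrite lef_pV2 ?posrE ?exprn_gt0//; last by rewrite cn_gt0 (ctr_neq wh').
rewrite lerXn2r ?nnegrE ?cn_ge0 ?(ltW d0)//; apply: le_trans (ctr_sep wh' zc); lra.
Qed.

Lemma CT_lip w w' d : 0 < d -> cn (w - a) <= h - d -> cn (w' - a) <= h - d ->
  cn (cauchy_transform 1 w' - cauchy_transform 1 w) <= 16 * h * M / d ^+ 2 * cn (w' - w).
Proof.
move=> d0 wh wh'; have wh1 : cn (w - a) < h by lra.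
have wh1' : cn (w' - a) < h by lra.
rewrite -cIB; [|by move=> z; exact: cont_kernel|by move=> z; exact: cont_kernel].
have -> : 16 * h * M / d ^+ 2 * cn (w' - w) = 16 * h * (M * cn (w' - w) / d ^+ 2) by ring.
apply: cn_cI => [z zc|z zc]; first by exact: contB (cont_kernel (n := 1) wh1' zc)
  (cont_kernel (n := 1) wh1 zc).
have n1 := ctr_neq wh1 zc; have n2 := ctr_neq wh1' zc.
have -> : phi z * (z - w') ^- 1 - phi z * (z - w) ^- 1 =
    phi z * (w' - w) / ((z - w) * (z - w')).
  by rewrite !expr1; field; apply/andP.
have s1 : d <= cn (z - w) by apply: le_trans (ctr_sep wh1 zc); lra.
have s2 : d <= cn (z - w') by apply: le_trans (ctr_sep wh1' zc); lra.
rewrite cnf !cnM; apply: ler_pM; rewrite ?mulr_ge0 ?invr_ge0 ?mulr_ge0 ?cn_ge0//.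
  by rewrite ler_wpM2r ?cn_ge0 ?phiM.
rewrite lef_pV2 ?posrE ?exprn_gt0 ?mulr_gt0 ?cn_gt0//.
by rewrite expr2 ler_pM// (ltW d0).
Qed.

(** An exact identity of kernels replaces differentiation under the integral sign: the remainder of
    [1 / (z - w')] after its linear Taylor polynomial at [w] is
    [(w' - w)^2 / ((z - w)^2 (z - w'))]. *)
Lemma CT1_taylor w w' d : 0 < d -> cn (w - a) <= h - d -> cn (w' - a) <= h - d ->
  cn (cauchy_transform 1 w' - cauchy_transform 1 w - cauchy_transform 2 w * (w' - w)) <= 16 * h * M / d ^+ 3 * cn (w' - w) ^+ 2.
Proof.
move=> d0 wh wh'; have wh1 : cn (w - a) < h by lra.
have wh1' : cn (w' - a) < h by lra.
rewrite [_ * (w' - w)]mulrC -cIZ; last by move=> z; exact: cont_kernel.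
rewrite -cIB; [|by move=> z; exact: cont_kernel|by move=> z; exact: cont_kernel].
rewrite -cIB; last 2 first.
- by move=> z zc; exact: contB (cont_kernel (n := 1) wh1' zc) (cont_kernel (n := 1) wh1 zc).
- by move=> z zc; exact: contM (cont_cst (c := w' - w) (z := z)) (cont_kernel (n := 2) wh1 zc).
have -> : 16 * h * M / d ^+ 3 * cn (w' - w) ^+ 2 =
  16 * h * (M * cn (w' - w) ^+ 2 / d ^+ 3) by ring.
apply: cn_cI => [z zc|z zc].
  apply: contB; last exact: contM (cont_cst (c := w' - w) (z := z)) (cont_kernel (n := 2) wh1 zc).
  exact: contB (cont_kernel (n := 1) wh1' zc) (cont_kernel (n := 1) wh1 zc).
have n1 := ctr_neq wh1 zc; have n2 := ctr_neq wh1' zc.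
have -> : phi z * (z - w') ^- 1 - phi z * (z - w) ^- 1 - (w' - w) * (phi z * (z - w) ^- 2) =
    phi z * (w' - w) ^+ 2 / ((z - w) ^+ 2 * (z - w')).
  by rewrite !expr1; field; apply/andP.
have s1 : d <= cn (z - w) by apply: le_trans (ctr_sep wh1 zc); lra.
have s2 : d <= cn (z - w') by apply: le_trans (ctr_sep wh1' zc); lra.
rewrite cnf !(cnM, cnX); apply: ler_pM;
  rewrite ?mulr_ge0 ?invr_ge0 ?mulr_ge0 ?exprn_ge0 ?cn_ge0//.
  by rewrite ler_wpM2r ?exprn_ge0 ?cn_ge0 ?phiM.
rewrite lef_pV2 ?posrE ?exprn_gt0 ?mulr_gt0 ?exprn_gt0 ?cn_gt0//.
by rewrite exprSr ler_pM ?exprn_ge0 ?lerXn2r ?nnegrE ?cn_ge0 ?(ltW d0).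
Qed.

Lemma CT2_taylor w w' d : 0 < d -> cn (w - a) <= h - d -> cn (w' - a) <= h - d ->
  cn (cauchy_transform 2 w' - cauchy_transform 2 w - 2 * cauchy_transform 3 w * (w' - w)) <=
    16 * h * (M * (3 / d ^+ 4)) * cn (w' - w) ^+ 2.
Proof.
move=> d0 wh wh'; have wh1 : cn (w - a) < h by lra.
have wh1' : cn (w' - a) < h by lra.
have -> : 2 * cauchy_transform 3 w * (w' - w) = 2 * (w' - w) * cauchy_transform 3 w by ring.
have E : 2 * (w' - w) * cauchy_transform 3 w = contour_int a h (fun z => 2 * (w' - w) * (phi z * (z - w) ^- 3)).
  exact: (esym (cIZ (2 * (w' - w)) (fun z zc => cont_kernel (n := 3) wh1 zc))).
rewrite E -cIB; [|by move=> z; exact: cont_kernel|by move=> z; exact: cont_kernel].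
rewrite -cIB; last 2 first.
- by move=> z zc; exact: contB (cont_kernel (n := 2) wh1' zc) (cont_kernel (n := 2) wh1 zc).
- move=> z zc.
  exact: contM (cont_cst (c := 2 * (w' - w)) (z := z)) (cont_kernel (n := 3) wh1 zc).
rewrite -mulrA; apply: cn_cI => [z zc|z zc].
  apply: contB; last
    exact: contM (cont_cst (c := 2 * (w' - w)) (z := z)) (cont_kernel (n := 3) wh1 zc).
  exact: contB (cont_kernel (n := 2) wh1' zc) (cont_kernel (n := 2) wh1 zc).
have n1 := ctr_neq wh1 zc; have n2 := ctr_neq wh1' zc.
have s1 : d <= cn (z - w) by apply: le_trans (ctr_sep wh1 zc); lra.
have s2 : d <= cn (z - w') by apply: le_trans (ctr_sep wh1' zc); lra.
pose u := (z - w)^-1; pose v := (z - w')^-1.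
have -> : phi z * (z - w') ^- 2 - phi z * (z - w) ^- 2 -
    2 * (w' - w) * (phi z * (z - w) ^- 3) =
    phi z * (u ^+ 2 * v * (v + 2 * u)) * (w' - w) ^+ 2.
  by rewrite /u /v; field; apply/andP.
have u1 : cn u <= d^-1 by rewrite cnV lef_pV2 ?posrE ?cn_gt0.
have v1 : cn v <= d^-1 by rewrite cnV lef_pV2 ?posrE ?cn_gt0.
rewrite cnM cnX ler_wpM2r ?exprn_ge0 ?cn_ge0// cnM.
apply: ler_pM; rewrite ?cn_ge0 ?phiM//.
have -> : 3 / d ^+ 4 = d^-1 ^+ 2 * d^-1 * (d^-1 + 2 * d^-1) by field; rewrite gt_eqF.
rewrite (cnM (u ^+ 2 * v)) (cnM (u ^+ 2)) cnX; apply: ler_pM; rewrite ?mulr_ge0 ?exprn_ge0 ?cn_ge0//.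
  apply: ler_pM; rewrite ?exprn_ge0 ?cn_ge0//.
  by rewrite lerXn2r ?nnegrE ?cn_ge0 ?invr_ge0 ?(ltW d0).
apply: le_trans (cnD _ _) _; rewrite lerD// cnM.
by have := cn_nat R 2 => /= ->; rewrite ler_wpM2l.
Qed.

Lemma quad_hasd (g : C -> C) (z d : C) (s K : R) : 0 < s ->
  (forall w, cn (w - z) < s -> cn (g w - g z - d * (w - z)) <= K * cn (w - z) ^+ 2) ->
  hasd g z d.
Proof.
move=> s0 H e e0; have K0 : 0 < `|K| + 1 by rewrite ltr_wpDl.
exists (Num.min s (e / (`|K| + 1))) => [|w]; first by rewrite lt_min s0 divr_gt0.
rewrite lt_min => /andP[ws]; rewrite ltr_pdivlMr// => we.
apply: le_trans (H w ws) _; rewrite expr2 mulrA ler_wpM2r ?cn_ge0//.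
apply: le_trans (ltW we); rewrite mulrC ler_wpM2l ?cn_ge0//.
by apply: le_trans (ler_norm K) _; rewrite lerDl.
Qed.

Let half w : cn (w - a) < h -> exists2 d, 0 < d & cn (w - a) <= h - d /\
  forall w', cn (w' - w) < d -> cn (w' - a) <= h - d.
Proof.
move=> wh; exists ((h - cn (w - a)) / 2); first by rewrite divr_gt0// subr_gt0.
split=> [|w' w'w]; first lra.
by have := cn_tri w w' a; lra.
Qed.

Lemma hasd_CT1 w : cn (w - a) < h -> hasd (cauchy_transform 1) w (cauchy_transform 2 w).
Proof.
move=> /half[d d0 [wd hd]].
apply: (@quad_hasd _ _ _ d (16 * h * M / d ^+ 3)) => // w' /hd w'd.
exact: CT1_taylor.
Qed.

Lemma hasd_CT2 w : cn (w - a) < h -> hasd (cauchy_transform 2) w (2 * cauchy_transform 3 w).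
Proof.
move=> /half[d d0 [wd hd]].
apply: (@quad_hasd _ _ _ d (16 * h * (M * (3 / d ^+ 4)))) => // w' /hd w'd.
exact: CT2_taylor.
Qed.

End Transform.

Lemma ctr_bounded f : (forall z, cn (z - a) <= 2 * h -> {for z, continuous f}) ->
  exists M, forall z, contour a h z -> cn (f z) <= M.
Proof.
move=> cf; have H0 := h0.
have [|||M hM] := @rect_bounded (re a - h) (im a - h) (2 * h) (2 * h) f.
- lra.
- lra.
- have -> : re a - h + 2 * h = re a + h by ring.
  have -> : im a - h + 2 * h = im a + h by ring.
  by move=> z /rect_center /cf.
exists M => z [zR _]; apply: hM.
have -> : re a - h + 2 * h = re a + h by ring.
by have -> : im a - h + 2 * h = im a + h by ring.
Qed.

End Fixed.
End Contour.

(** * Local properties of holomorphic functions *)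

Section Holomorphic.
Variable R : realType.
Local Notation C := R[i].
Implicit Types (x y r s M : R) (f g q : C -> C) (z w a : C).
Local Notation hol := (@holomorphic R).

(** The square of half side [r / 4] lies in the closed disc of radius [r / 2]. Once [derive1 f] is a
    Cauchy transform of order 2 it is differentiable again, which opens the way to derivatives of
    all orders. *)
Lemma disc_repr f a r : 0 < r -> hol (disc a r) f -> forall w, cn (w - a) < r / 4 ->
  f w = cauchy_transform a (r / 4) f 1 w /\ derive1 f w = cauchy_transform a (r / 4) f 2 w /\
  derivable (derive1 f) w 1.
Proof.
move=> r0 hf; have h0 : 0 < r / 4 by rewrite divr_gt0.
have df z : cn (z - a) <= 2 * (r / 4) -> derivable f z 1.
  by move=> za; apply: hf; rewrite /disc /=; lra.
have cf z : cn (z - a) <= 2 * (r / 4) -> {for z, continuous f}.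
  by move=> /df /derivable_cont.
have [M hM] := ctr_bounded h0 cf.
have cc z : contour a (r / 4) z -> {for z, continuous f}.
  by move=> /(ctr_dist h0)/andP[_ /cf].
have E w : cn (w - a) < r / 4 -> f w = cauchy_transform a (r / 4) f 1 w.
  by move=> wa; rewrite (cauchy_formula df wa).
have near_in w : cn (w - a) < r / 4 -> \forall t \near w, cn (t - a) < r / 4.
  by move=> wa; apply: (@disc_nbhs _ a).
have D w : cn (w - a) < r / 4 -> derive1 f w = cauchy_transform a (r / 4) f 2 w.
  move=> wa; apply: hasdE; apply: (hasd_near (f := cauchy_transform a (r / 4) f 1)).
    by apply: filterS (near_in w wa) => t /E ->.
  exact (hasd_CT1 h0 cc hM wa).
move=> w wa; split; [exact: E|split; [exact: D|]].
apply: hasd_derivable; apply: (hasd_near (f := cauchy_transform a (r / 4) f 2)).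
  by apply: filterS (near_in w wa) => t /D ->.
exact (hasd_CT2 h0 cc hM wa).
Qed.

Lemma hol_sub (U V : set C) f : U `<=` V -> hol V f -> hol U f.
Proof. by move=> UV hf z /UV /hf. Qed.

Lemma dv_hol (U : set C) f : open U -> hol U f -> hol U (derive1 f).
Proof.
move=> oU hf a Ua; have /near_discE[r r0 rU] : \forall z \near a, U z by apply: oU.
have [|_ [_ //]] := @disc_repr f a r r0 (hol_sub rU hf) a.
by rewrite subrr cn0 divr_gt0.
Qed.

Lemma dvn_hol (U : set C) f i : open U -> hol U f -> hol U (derive1n i f).
Proof.
move=> oU hf; elim: i => [|i IH]; first exact: hf.
exact (dv_hol oU IH).
Qed.

Section Estimates.
Variables (f : C -> C) (a : C) (r M : R).
Hypotheses (r0 : 0 < r) (hf : hol (disc a r) f).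
Hypothesis fM : forall z, disc a r z -> cn (f z) <= M.

Let h0 : 0 < r / 4. Proof. by rewrite divr_gt0. Qed.
Let cc z : contour a (r / 4) z -> {for z, continuous f}.
Proof.
move=> /(ctr_dist h0)/andP[_ za]; apply/derivable_cont/hf.
have H := r0; rewrite /disc /=; lra.
Qed.
Let hM z : contour a (r / 4) z -> cn (f z) <= M.
Proof.
move=> /(ctr_dist h0)/andP[_ za]; apply/fM.
have H := r0; rewrite /disc /=; lra.
Qed.

(** The constants here and in the next two bounds come from a square of half side [r / 4] and points
    at distance at least [r / 4], respectively [r / 8], from it. *)
Lemma cauchy_est : cn (derive1 f a) <= 64 * M / r.
Proof.
have [|_ [-> _]] := @disc_repr f a r r0 hf a; first by rewrite subrr cn0.
apply: le_trans (cn_CT h0 cc hM 2 h0 _) _; first by rewrite subrr cn0 subrr.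
by rewrite le_eqVlt; apply/orP; left; apply/eqP; field; rewrite gt_eqF.
Qed.

Lemma hol_lip z w : cn (z - a) <= r / 8 -> cn (w - a) <= r / 8 ->
  cn (f z - f w) <= 256 * M / r * cn (z - w).
Proof.
move=> za wa; have H := r0.
have h1 u : cn (u - a) <= r / 8 -> cn (u - a) < r / 4 by move=> ?; lra.
have h2 u : cn (u - a) <= r / 8 -> cn (u - a) <= r / 4 - r / 8 by move=> ?; lra.
have [-> _] := disc_repr r0 hf (h1 z za); have [-> _] := disc_repr r0 hf (h1 w wa).
have r8 : 0 < r / 8 by rewrite divr_gt0.
apply: le_trans (CT_lip h0 cc hM r8 (h2 w wa) (h2 z za)) _.
by rewrite le_eqVlt; apply/orP; left; apply/eqP; field; rewrite gt_eqF.
Qed.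

Lemma hol_taylor z : cn (z - a) <= r / 8 ->
  cn (f z - f a - derive1 f a * (z - a)) <= 2048 * M / r ^+ 2 * cn (z - a) ^+ 2.
Proof.
move=> za; have H := r0.
have h1 u : cn (u - a) <= r / 8 -> cn (u - a) < r / 4 by move=> ?; lra.
have h2 u : cn (u - a) <= r / 8 -> cn (u - a) <= r / 4 - r / 8 by move=> ?; lra.
have aa : cn (a - a) <= r / 8 by rewrite subrr cn0 divr_ge0// ltW.
have [-> _] := disc_repr r0 hf (h1 z za); have [-> [-> _]] := disc_repr r0 hf (h1 a aa).
have r8 : 0 < r / 8 by rewrite divr_gt0.
apply: le_trans (CT1_taylor h0 cc hM r8 (h2 a aa) (h2 z za)) _.
by rewrite le_eqVlt; apply/orP; left; apply/eqP; field; rewrite gt_eqF.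
Qed.

End Estimates.

Lemma hol_bounded f a r s : 0 < s -> 2 * s < r -> hol (disc a r) f ->
  exists2 M, 0 < M & forall z, disc a s z -> cn (f z) <= M.
Proof.
move=> s0 sr hf.
have [|||M hM] := @rect_bounded _ (re a - s) (im a - s) (2 * s) (2 * s) f.
- lra.
- lra.
- have -> : re a - s + 2 * s = re a + s by ring.
  have -> : im a - s + 2 * s = im a + s by ring.
  move=> z /rect_center za; apply/derivable_cont/hf; rewrite /disc /=; lra.
exists (Num.max 1 M) => [|z zs]; first by rewrite lt_max ltr01.
rewrite le_max hM ?orbT//.
have := le_lt_trans (cn_Re (z - a)) zs; have := le_lt_trans (cn_Im (z - a)) zs.
rewrite !raddfB /= !ltr_norml => /andP[h1 h2] /andP[h3 h4].
by split; apply/andP; split; lra.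
Qed.

(* Bernoulli: a constant factor in front of all powers is harmless. *)
Lemma power_trick x y (K : R) : 0 <= x -> 0 <= y ->
  (forall n, x ^+ n <= K * y ^+ n) -> x <= y.
Proof.
move=> x0 y0 h; rewrite leNgt; apply/negP => yx.
have [y1|y1] := eqVneq y 0.
  by have := h 1%N; rewrite !expr1 y1 mulr0; move: yx; rewrite y1; lra.
have yp : 0 < y by rewrite lt_def y1.
pose t := x / y - 1; have t0 : 0 < t by rewrite subr_gt0 ltr_pdivlMr// mul1r.
have ht n : 1 + n%:R * t <= K.
  have : (x / y) ^+ n <= K by rewrite expr_div_n ler_pdivrMr ?exprn_gt0.
  apply: le_trans; have -> : x / y = 1 + t by rewrite /t subrKC.
  elim: n => [|n IH]; first by rewrite mul0r addr0 expr0.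
  rewrite exprS; apply: le_trans (_ : (1 + t) * (1 + n%:R * t) <= _); last first.
    by rewrite ler_wpM2l// addr_ge0 ?ltW.
  have -> : (1 + t) * (1 + n%:R * t) = 1 + n.+1%:R * t + n%:R * t ^+ 2.
    by rewrite -natr1; ring.
  by rewrite lerDl mulr_ge0// sqr_ge0.
have := archi_boundP (normr_ge0 (K / t)); rewrite ltNge => /negP; apply.
apply: le_trans (ler_norm _); rewrite ler_pdivlMr//.
by apply: (le_trans _ (ht (Num.bound `|K / t|))); rewrite lerDr ler01.
Qed.

(** Cauchy's formula for [f ^+ n] on the square of half side [3 s / 2] gives [|f w|^n <= 48 M^n] for
    every [n], hence [|f w| <= M]. A square does not fit on a circle, so the bound is assumed on an
    annulus containing it. *)
Lemma max_principle f a s M : 0 < s -> hol (disc a (4 * s)) f ->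
  (forall z, s <= cn (z - a) -> cn (z - a) < 4 * s -> cn (f z) <= M) ->
  forall w, cn (w - a) < s -> cn (f w) <= M.
Proof.
move=> s0 hf fM w ws.
have h0 : 0 < 3 / 2 * s by rewrite mulr_gt0.
have cb z : contour a (3 / 2 * s) z -> cn (f z) <= M.
  by move=> /(ctr_dist h0)/andP[z1 z2]; apply: fM; lra.
have M0 : 0 <= M.
  apply: le_trans (cn_ge0 (f (a + rC (2 * s)))) (fM _ _ _);
    by rewrite addrC addKr cnr ger0_norm; lra.
apply: (@power_trick _ _ 48) => // [|n]; first exact: cn_ge0.
pose g z := f z ^+ n.
have dg z : cn (z - a) <= 2 * (3 / 2 * s) -> derivable g z 1.
  move=> za; apply: hasd_derivable (hasdX n (hasd_dv (hf z _))).
  rewrite /disc /=; lra.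
have wh : cn (w - a) < 3 / 2 * s by lra.
rewrite -cnX -[_ ^+ n]/(g w) (cauchy_formula dg wh).
have -> : 48 * M ^+ n = 16 * (3 / 2 * s) * M ^+ n / (s / 2) ^+ 1.
  by rewrite expr1; field; rewrite gt_eqF.
apply: (@cn_CT _ a (3 / 2 * s) h0 g (M ^+ n) _ _ 1 w (s / 2)); rewrite ?divr_gt0//.
- by move=> z /(ctr_dist h0)/andP[_ /dg /derivable_cont].
- by move=> z /cb zM; rewrite cnX lerXn2r ?nnegrE ?cn_ge0.
- lra.
Qed.

(** Removable singularity: near [a] the quotient is the Cauchy transform of [f / (z - a)], by the
    partial fractions of [1 / ((z - a) (z - w))] and [f a = 0]. A Cauchy transform is holomorphic at
    [a] as well. *)
Lemma hol_factor f a r : 0 < r -> hol (disc a r) f -> f a = 0 ->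
  exists q, [/\ hol (disc a r) q, q a = derive1 f a &
    forall z, f z = (z - a) * q z].
Proof.
move=> r0 hf fa0.
pose q z := if z == a then derive1 f a else f z / (z - a).
have qE z : f z = (z - a) * q z.
  rewrite /q; have [->|za] := eqVneq z a; first by rewrite subrr mul0r.
  by rewrite mulrC divfK// subr_eq0.
exists q; split; [|by rewrite /q eqxx|exact: qE].
have h0 : 0 < r / 4 by rewrite divr_gt0.
have df z : cn (z - a) <= 2 * (r / 4) -> derivable f z 1.
  by move=> za; apply: hf; rewrite /disc /=; lra.
have cf z : cn (z - a) <= 2 * (r / 4) -> {for z, continuous f}.
  by move=> /df /derivable_cont.
have cc z : contour a (r / 4) z -> {for z, continuous f}.
  by move=> /(ctr_dist h0)/andP[_ /cf].
have aa : cn (a - a) < r / 4 by rewrite subrr cn0.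
pose phi z := f z * (z - a) ^- 1.
have cphi z : contour a (r / 4) z -> {for z, continuous phi}.
  by move=> zc; exact: contM (cc z zc) (cont_inv (n := 1) (ctr_neq h0 aa zc)).
have [M hM] := ctr_bounded h0 cf.
have phiM z : contour a (r / 4) z -> cn (phi z) <= M / (r / 4).
  move=> zc; have za := ctr_sep h0 aa zc; have z0 := ctr_neq h0 aa zc.
  rewrite subrr cn0 subr0 in za.
  rewrite /phi expr1 cnf; apply: ler_pM; rewrite ?invr_ge0 ?cn_ge0 ?hM//.
  by rewrite lef_pV2 ?posrE ?cn_gt0.
have Cf w : cn (w - a) < r / 4 -> f w = cauchy_transform a (r / 4) f 1 w /\ derive1 f w = cauchy_transform a (r / 4) f 2 w.
  by move=> wa; have [? [? _]] := disc_repr r0 hf wa.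
have qCT w : cn (w - a) < r / 4 -> cauchy_transform a (r / 4) phi 1 w = q w.
  move=> wa; rewrite /q; have [->|wna] := eqVneq w a.
    rewrite (Cf a aa).2; apply: (eq_cI h0) => z zc; rewrite /phi.
    by rewrite -mulrA -invfM -exprD.
  have wa0 : w - a != 0 by rewrite subr_eq0.
  apply: (mulIf wa0); rewrite divfK// mulrC -(cIZ h0); last first.
    by move=> z zc; exact: contM (cphi z zc) (cont_inv (n := 1) (ctr_neq h0 wa zc)).
  have -> : f w = cauchy_transform a (r / 4) f 1 w - cauchy_transform a (r / 4) f 1 a.
    by rewrite -(Cf w wa).1 -(Cf a aa).1 fa0 subr0.
  rewrite -(cIB h0).
  - apply: (eq_cI h0) => z zc; have n1 := ctr_neq h0 aa zc; have n2 := ctr_neq h0 wa zc.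
    by rewrite /phi !expr1; field; apply/andP.
  - by move=> z zc; exact: contM (cc z zc) (cont_inv (n := 1) (ctr_neq h0 wa zc)).
  - by move=> z zc; exact: contM (cc z zc) (cont_inv (n := 1) (ctr_neq h0 aa zc)).
move=> z zr; have [->|za] := eqVneq z a.
  apply: hasd_derivable; apply: (hasd_near (f := cauchy_transform a (r / 4) phi 1)).
    by apply: (near_discI h0) => w /qCT.
  exact (hasd_CT1 h0 cphi phiM aa).
have za0 : z - a != 0 by rewrite subr_eq0.
have hq := hasdM (hasd_dv (hf z zr))
  (@hasdV _ (fun z => z - a) z _ za0 (hasdB (hasd_id z) (hasd_cst a z))).
apply: hasd_derivable; apply: hasd_near hq.
have c0 : 0 < cn (z - a) by rewrite cn_gt0.
apply: (near_discI c0) => w wz; rewrite /q; case: eqP => // wa.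
by rewrite wa cnC ltxx in wz.
Qed.

(** If division by [z - a] never stops, then [f = (z - a)^j q_j] with [|q_j| <= M / s^j] by the
    maximum principle, so [|f| <= M / 2^j] for all [j] on the disc of radius [s / 2]. This replaces
    power series. *)
Lemma hol_order f a r : 0 < r -> hol (disc a r) f ->
  (exists2 s, 0 < s & forall z, disc a s z -> f z = 0) \/
  exists j q, [/\ hol (disc a r) q, q a != 0 & forall z, f z = (z - a) ^+ j * q z].
Proof.
move=> r0 hf; have [h|nh] := pselect (exists j q, [/\ hol (disc a r) q, q a != 0 &
  forall z, f z = (z - a) ^+ j * q z]); [by right|left].
have hq j : exists q, hol (disc a r) q /\ forall z, f z = (z - a) ^+ j * q z.
  elim: j => [|j [q [qh qE]]]; first by exists f; split; [exact: hf|move=> z; rewrite expr0 mul1r].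
  have [qa|qa] := eqVneq (q a) 0; last by case: nh; exists j, q.
  have [p [ph _ pE]] := hol_factor r0 qh qa.
  by exists p; split; [exact: ph|move=> z; rewrite qE pE mulrA -exprSr].
pose s := r / 12; have s0 : 0 < s by rewrite divr_gt0.
have [||M M0 hM] := @hol_bounded f a r (4 * s) _ _ hf.
- by rewrite mulr_gt0.
- by rewrite /s; lra.
exists (s / 2) => [|z zs]; first by rewrite divr_gt0.
apply/eqP; rewrite -cn_eq0 eq_le cn_ge0 andbT.
apply: (@pow2_le0 _ M) => j; have [q [qh qE]] := hq j.
have qM w : cn (w - a) < s -> cn (q w) <= M / s ^+ j.
  apply: (max_principle s0).
    by apply: hol_sub qh; apply: disc_sub; rewrite /s; lra.
  move=> v v1 v2; have := hM v v2; rewrite qE cnM cnX => H.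
  rewrite ler_pdivlMr ?exprn_gt0// mulrC; apply: le_trans H.
  by rewrite ler_wpM2r ?cn_ge0// lerXn2r ?nnegrE ?cn_ge0// ltW.
rewrite qE cnM cnX; apply: le_trans (_ : (s / 2) ^+ j * (M / s ^+ j) <= _).
  apply: ler_pM; rewrite ?exprn_ge0 ?cn_ge0//.
    by rewrite lerXn2r ?nnegrE ?cn_ge0 ?divr_ge0 ?ltW.
  by apply: qM; apply: lt_le_trans zs _; lra.
rewrite expr_div_n le_eqVlt; apply/orP; left; apply/eqP; field.
by rewrite !expf_neq0 ?gt_eqF.
Qed.

End Holomorphic.

(** * Orders of zeros and poles under differentiation *)

Section Multiplicity.
Variable R : realType.
Local Notation C := R[i].
Implicit Types (r s : R) (f g q h : C -> C) (z w a : C).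
Local Notation hol := (@holomorphic R).

Lemma dv_pow a r f q c : hol (disc a r) q ->
  (forall z, disc a r z -> f z = (z - a) ^+ c.+1 * q z) ->
  forall z, disc a r z ->
    derive1 f z = (z - a) ^+ c * (c.+1%:R * q z + (z - a) * derive1 q z).
Proof.
move=> qh fE z zr; apply: hasdE.
have E : \forall w \near z, (w - a) ^+ c.+1 * q w = f w.
  by apply: filterS (disc_nbhs zr) => w /fE ->.
have H := hasdM (hasdX c.+1 (hasdB (hasd_id z) (hasd_cst a z))) (hasd_dv (qh z zr)).
have := hasd_near E H; rewrite exprS /= subr0 mulr1.
by congr hasd; ring.
Qed.

Lemma hol_near_ext a r f g : hol (disc a r) f -> (forall z, disc a r z -> f z = g z) ->
  hol (disc a r) g.
Proof.
move=> fh fg z zr; apply: derivable_near (fh z zr).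
by apply: filterS (disc_nbhs zr).
Qed.

Lemma hol_cst (U : set C) (c : C) : hol U (fun=> c).
Proof. by move=> z _; exact: hasd_derivable (hasd_cst c z). Qed.

Lemma hol_lin1 (U : set C) a : hol U (fun z => z - a).
Proof. by move=> z _; exact: hasd_derivable (hasdB (hasd_id z) (hasd_cst a z)). Qed.

Lemma holM (U : set C) f g : hol U f -> hol U g -> hol U (fun z => f z * g z).
Proof.
move=> fh gh z zU; exact: hasd_derivable (hasdM (hasd_dv (fh z zU)) (hasd_dv (gh z zU))).
Qed.

Lemma holD (U : set C) f g : hol U f -> hol U g -> hol U (fun z => f z + g z).
Proof.
move=> fh gh z zU; exact: hasd_derivable (hasdD (hasd_dv (fh z zU)) (hasd_dv (gh z zU))).
Qed.

Lemma holB (U : set C) f g : hol U f -> hol U g -> hol U (fun z => f z - g z).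
Proof.
move=> fh gh z zU; exact: hasd_derivable (hasdB (hasd_dv (fh z zU)) (hasd_dv (gh z zU))).
Qed.

Lemma holX (U : set C) f n : hol U f -> hol U (fun z => f z ^+ n).
Proof. by move=> fh z zU; exact: hasd_derivable (hasdX n (hasd_dv (fh z zU))). Qed.

Lemma holV (U : set C) f : hol U f -> (forall z, U z -> f z != 0) ->
  hol U (fun z => (f z)^-1).
Proof.
by move=> fh f0 z zU; exact: hasd_derivable (hasdV (f0 z zU) (hasd_dv (fh z zU))).
Qed.

Lemma dvn_pow a r f q c i : hol (disc a r) q ->
  (forall z, disc a r z -> f z = (z - a) ^+ (c + i) * q z) ->
  exists p, [/\ hol (disc a r) p, q a != 0 -> p a != 0 &
    forall z, disc a r z -> derive1n i f z = (z - a) ^+ c * p z].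
Proof.
elim: i f q => [|i IH] f q qh fE.
  by exists q; split; [exact: qh|by []|move=> z /fE; rewrite addn0].
have [||p [ph pa pE]] := IH (derive1 f)
  (fun z => (c + i).+1%:R * q z + (z - a) * derive1 q z).
- apply: holD; first exact: holM (hol_cst (c := (c + i).+1%:R)) qh.
  exact: holM (hol_lin1 (a := a)) (dv_hol (disc_open (a := a) (r := r)) qh).
- move=> z zr; have fE' w : disc a r w -> f w = (w - a) ^+ (c + i).+1 * q w.
    by move=> /fE; rewrite addnS.
  exact: dv_pow qh fE' z zr.
exists p; split; [exact: ph| |by move=> z zr; rewrite derive1Sn pE].
by move=> qa; apply: pa; rewrite subrr mul0r addr0 mulf_neq0// pnatr_eq0.
Qed.

Lemma dvn_zero a r f q j i : 0 < r -> hol (disc a r) q ->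
  (forall z, disc a r z -> f z = (z - a) ^+ j * q z) -> (i < j)%N -> derive1n i f a = 0.
Proof.
move=> r0 qh fE ij.
have [|p [_ _ pE]] := @dvn_pow a r f q (j - i) i qh; first by rewrite subnK// ltnW.
rewrite pE; last exact: disc_center.
by rewrite subrr expr0n subn_eq0 leqNgt ij mul0r.
Qed.

Lemma pole_dv a r f h e : hol (disc a r) h ->
  (forall z, disc a r z -> z != a -> f z = h z / (z - a) ^+ e) ->
  forall z, disc a r z -> z != a ->
    derive1 f z = ((z - a) * derive1 h z - e%:R * h z) / (z - a) ^+ e.+1.
Proof.
move=> hh fE z zr za; apply: hasdE.
have za0 : z - a != 0 by rewrite subr_eq0.
have c0 : 0 < cn (z - a) by rewrite cn_gt0.
have E : \forall w \near z, h w / (w - a) ^+ e = f w.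
  have N : \forall w \near z, w != a.
    apply: (near_discI c0) => w wz; apply/eqP => wa.
    by rewrite wa cnC ltxx in wz.
  by apply: filterS2 (disc_nbhs zr) N => w wr wa; rewrite fE.
have HX := hasdX e (hasdB (hasd_id z) (hasd_cst a z)).
have zan : (fun z => (z - a) ^+ e) z != 0 by rewrite expf_neq0.
have H := hasdM (hasd_dv (hh z zr)) (@hasdV _ (fun z => (z - a) ^+ e) z _ zan HX).
have := hasd_near E H.
suff -> : derive1 h z / (z - a) ^+ e +
    h z * (- (e%:R * (z - a) ^+ e.-1 * (1 - 0)) / ((z - a) ^+ e) ^+ 2) =
    ((z - a) * derive1 h z - e%:R * h z) / (z - a) ^+ e.+1 by [].
case: e {fE E HX zan H} => [|e] /=.
  by rewrite !expr0 expr1; field.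
rewrite !exprS; move: (e.+1%:R : C) => k.
by field; rewrite za0 expf_neq0.
Qed.

(** Each derivative raises the order of the pole by exactly one: the leading coefficient is
    multiplied by minus the order, which is not zero. *)
Lemma pole_dvn a r f h e i : (0 < e)%N -> hol (disc a r) h -> h a != 0 ->
  (forall z, disc a r z -> z != a -> f z = h z / (z - a) ^+ e) ->
  exists p, [/\ hol (disc a r) p, p a != 0 &
    forall z, disc a r z -> z != a -> derive1n i f z = p z / (z - a) ^+ (e + i)].
Proof.
elim: i f h e => [|i IH] f h e e0 hh ha fE.
  by exists h; split; [exact: hh|exact: ha|move=> z zr za; rewrite addn0; exact: fE].
have [||||p [ph pa pE]] := IH (derive1 f)
  (fun z => (z - a) * derive1 h z - e%:R * h z) e.+1.
- by [].
- apply: holB; first exact: holM (hol_lin1 (a := a)) (dv_hol (disc_open (a := a) (r := r)) hh).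
  exact: holM (hol_cst (c := e%:R)) hh.
- by rewrite subrr mul0r sub0r oppr_eq0 mulf_neq0// pnatr_eq0 -lt0n.
- by move=> z zr za; rewrite (pole_dv hh fE).
exists p; split; [exact: ph|exact: pa|].
by move=> z zr za; rewrite derive1Sn pE// addSnnS.
Qed.

Lemma dvn_0 i z : derive1n i (fun=> 0 : C) z = 0.
Proof.
have E0 : derive1 (fun=> 0 : C) = (fun=> 0 : C).
  by apply/funext => w; exact: hasdE (hasd_cst 0 w).
by elim: i => [//|i IH]; rewrite derive1Sn E0.
Qed.

(** Otherwise [f - f a] vanishes at [a] to an exact order [e.+1], and its derivative of that order
    is nonzero at [a], although the first derivative vanishes identically nearby. *)
Lemma dv0_cst a r f : 0 < r -> hol (disc a r) f ->
  (forall z, disc a r z -> derive1 f z = 0) ->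
  exists2 s, 0 < s & forall z, disc a s z -> f z = f a.
Proof.
move=> r0 fh f0; pose g z := f z - f a.
have gh : hol (disc a r) g by apply: holB; [exact: fh|exact: hol_cst].
have [[s s0 gs]|[[|e] [q [qh qa qE]]]] := hol_order r0 gh.
- by exists s => // z /gs /eqP; rewrite subr_eq0 => /eqP.
- by have := qE a; rewrite /g subrr expr0 mul1r => q0; rewrite -q0 eqxx in qa.
have [|p [ph pa pE]] := @dvn_pow a r g q 0 e.+1 qh; first by move=> z _; rewrite add0n qE.
suff g0 z i : disc a r z -> derive1n i.+1 g z = 0.
  have ar := disc_center a r0.
  by have := pa qa; rewrite -[p a]mul1r -(expr0 (a - a)) -pE// g0// eqxx.
have D w : disc a r w -> derive1 g w = 0.
  move=> wr; rewrite -(f0 w wr); apply: hasdE.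
  by have := hasdB (hasd_dv (fh w wr)) (hasd_cst (f a) w); rewrite subr0.
move=> zr; rewrite derive1Sn.
rewrite (@derive1n_near _ (derive1 g) (fun=> 0)); last first.
  by apply: filterS (disc_nbhs zr) => w /D.
exact: dvn_0.
Qed.

End Multiplicity.

Section Connected.
Variable R : realType.
Local Notation C := R[i].

(** The set where [P] holds is open and closed relative to [D]. This yields the identity theorems
    below, with or without poles. *)
Lemma clopen_domain (D P : set C) : open D -> connected D ->
  (forall a, D a -> P a -> \forall z \near a, P z) ->
  (forall a, D a -> (forall r, 0 < r -> exists2 z, disc a r z & P z) -> P a) ->
  (exists2 a, D a & P a) -> forall a, D a -> P a.
Proof.
move=> oD cD Po Pc [a0 Da0 Pa0] a Da.
suff E : P `&` D = D by move: Da; rewrite -{1}E => -[].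
apply: cD; first by exists a0.
- exists (P `&` D); last by rewrite [RHS]setICA setIid.
  rewrite openE => z [Pz Dz]; apply: filterI; first exact: Po.
  exact: oD.
- exists (closure (P `&` D)); first exact: closed_closure.
  apply/seteqP; split=> [z [Pz Dz]|z [Dz cz]].
    by split=> //; exact: subset_closure.
  split=> //; apply: Pc => // r r0; have [w [[Pw Dw] zw]] := cz _ (disc_nbhs (disc_center z r0)).
  by exists w.
Qed.

Lemma connected_plane : connected [set: C].
Proof.
have -> : [set: C] = \bigcup_(w in [set: C]) ((fun t : R => rC t * w : C) @` `[0, 1]).
  apply/seteqP; split=> // w _; exists w => //; exists 1; last by rewrite mul1r.
  by rewrite /= in_itv /= ler01 lexx.
apply: bigcup_connected.
  exists 0 => w _; exists 0; last by rewrite mul0r.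
  by rewrite /= in_itv /= ler01 lexx.
move=> w _; apply: connected_continuous_connected; first exact: segment_connected.
apply: continuous_subspaceT => t.
have P := cvg_discP (nbhs_filter t) (fun t : R => rC t * w : C) (rC t * w); apply/P => e e0.
have K0 : 0 < cn w + 1 by rewrite ltr_wpDl ?cn_ge0.
near=> s; rewrite -mulrBl -rmorphB cnM cnr.
apply: (@le_lt_trans _ _ (`|s - t| * (cn w + 1))); first by rewrite ler_wpM2l// lerDl.
rewrite -ltr_pdivlMr// distrC; near: s; apply/nbhs_ballP; exists (e / (cn w + 1)) => //=.
by rewrite divr_gt0.
Unshelve. all: by end_near. Qed.

End Connected.

(** * Point picking and limits along ultrafilters *)

Section Doubling.
Variable R : realType.
Local Notation C := R[i].

(* Point picking in the spirit of Gromov and Brody: otherwise one could iterate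
   and reach a point near which arbitrarily small scales are bad. *)
Lemma doubling (bad : C -> R -> Prop) (z0 : C) (r0 A : R) : 0 < r0 -> 0 < A -> bad z0 r0 ->
  (forall z, cn (z - z0) <= 4 * A * r0 -> exists2 d, 0 < d &
     forall w r, cn (w - z) < d -> 0 < r < d -> ~ bad w r) ->
  exists z r, [/\ 0 < r <= r0, cn (z - z0) <= 2 * A * r0, bad z r &
    forall w r', cn (w - z) < A * r -> 0 < r' <= r / 2 -> ~ bad w r'].
Proof.
move=> r0_gt0 A0 bad0 loc; apply: contrapT => no.
pose P n (t : C * R) := [/\ 0 < t.2 <= r0 / 2 ^+ n,
  cn (t.1 - z0) <= 2 * A * r0 * (1 - (2 ^+ n)^-1) & bad t.1 t.2].
pose Q n (t t' : C * R) := cn (t'.1 - t.1) <= A * r0 / 2 ^+ n.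
have [||s [s0 sP sQ]] := @dep_choice _ P Q (z0, r0).
- by split; rewrite /= ?expr0 ?divr1 ?r0_gt0 ?lexx// subrr cn0 invr1 subrr mulr0.
- move=> n [z r] [/= /andP[rp rn] zz0 zb].
  have pn := pow2_gt0 R n.
  have i0 : 0 < (2 ^+ n)^-1 :> R by rewrite invr_gt0.
  have i1 : (2 ^+ n)^-1 <= 1 :> R by rewrite invf_le1// exprn_ege1// ler1n.
  have Ar0 : 0 < A * r0 by rewrite mulr_gt0.
  have rr0 : r <= r0 by rewrite (le_trans rn)// ler_piMr// ltW.
  have : exists w r', [/\ cn (w - z) < A * r, 0 < r' <= r / 2 & bad w r'].
    apply: contrapT => nw; apply: no; exists z, r; split => //; first by rewrite rp.
      by apply: le_trans zz0 _; rewrite ler_piMr ?mulr_ge0 ?ltW//; lra.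
    by move=> w r' wz r'r bw; apply: nw; exists w, r'.
  move=> [w [r' [wz /andP[r'0 r'r] bw]]].
  have Arn : A * r <= A * r0 / 2 ^+ n by rewrite -mulrA ler_wpM2l// ltW.
  exists (w, r'); last by rewrite /Q /=; lra.
  split => //=.
    rewrite r'0 /=; apply: le_trans r'r _; rewrite exprS invfM mulrA ler_pdivrMr//.
    by rewrite mulrAC mulfVK// mulrC in rn *; lra.
  have -> : (2 ^+ n.+1)^-1 = (2 ^+ n)^-1 / 2 :> R by rewrite exprS invfM mulrC.
  apply: le_trans (cn_tri z _ _) _.
  move: wz zz0 Arn; move: (2 ^+ n)^-1 (cn _) (cn _) => t u v; nra.
have Ar0 : 0 <= A * r0 by rewrite mulr_ge0 ?ltW.
have [l hl] := geo_cvg Ar0 sQ.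
have [|d d0 hd] := loc l.
  by have := hl 0%N; rewrite s0 /= expr0 divr1 cnC; lra.
have [n1 hn1] := pow2_small (4 * (A * r0)) d0.
have [n2 hn2] := pow2_small r0 d0.
pose n := (n1 + n2)%N.
have [/andP[rp rn] _ bn] := sP n.
have mono (K : R) n0 : 0 <= K -> (n0 <= n)%N -> K / 2 ^+ n <= K / 2 ^+ n0.
  move=> K0 nn; rewrite ler_wpM2l// lef_pV2 ?posrE ?pow2_gt0//.
  by rewrite ler_weXn2l// ler1n.
apply: (hd (s n).1 (s n).2) bn.
  apply: le_lt_trans (hl n) (le_lt_trans (mono _ n1 _ _) hn1); last exact: leq_addr.
  by rewrite mulr_ge0.
rewrite rp /=; apply: le_lt_trans rn (le_lt_trans (mono _ n2 _ _) hn2); last exact: leq_addl.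
exact: ltW.
Qed.

End Doubling.

Section UltraLimit.
Variable R : realType.
Local Notation C := R[i].
Variable U : set_system nat.
Hypothesis UU : UltraFilter U.
Implicit Types (a b : nat -> C) (x y : C).

(* Limits along an ultrafilter replace the extraction of subsequences. *)
Definition ulim a x := forall e : R, 0 < e -> \forall j \near U, cn (a j - x) < e.

Lemma ulimP a x : ulim a x <-> a @ U --> x.
Proof. by rewrite (cvg_discP _). Qed.

Lemma ultra_or (P : nat -> Prop) : (\forall j \near U, P j) \/ (\forall j \near U, ~ P j).
Proof. exact: (in_ultra_setVsetC [set j | P j] UU). Qed.

Lemma ultra_orW (P Q : nat -> Prop) : (\forall j \near U, P j \/ Q j) ->
  (\forall j \near U, P j) \/ (\forall j \near U, Q j).
Proof.
move=> PQ; have [|nP] := ultra_or P; [by left|right].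
by apply: filterS2 PQ nP => j [].
Qed.

Lemma ultra_ex (P : nat -> Prop) : (\forall j \near U, P j) -> exists j, P j.
Proof. exact: filter_ex. Qed.

(** The limit is the supremum of those [t] that lie below [b j] for [U]-almost all [j]. *)
Lemma ulim_exR (b : nat -> R) M : (\forall j \near U, `|b j| <= M) ->
  exists x : R, forall e : R, 0 < e -> \forall j \near U, `|b j - x| < e.
Proof.
move=> bM; pose S := [set t : R | \forall j \near U, t <= b j].
have hS : has_sup S.
  split; first by exists (- M); apply: filterS bM => j; rewrite ler_norml => /andP[].
  exists M => t St; have [j [h1 h2]] := ultra_ex (filterI bM St).
  by apply: le_trans h2 _; apply: le_trans (ler_norm _) h1.
exists (sup S) => e e0.
have [t St te] := sup_adherent e0 hS.
have [h|h] := ultra_or (fun j => sup S + e / 2 <= b j).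
  have := sup_ubound hS.2 h; lra.
apply: filterS2 St h => j tb /negP; rewrite -ltNge => be.
by rewrite ltr_norml; apply/andP; split; lra.
Qed.

Lemma ulim_ex a M : (\forall j \near U, cn (a j) <= M) -> exists x, ulim a x.
Proof.
move=> aM.
have [|x hx] := @ulim_exR (fun j => re (a j)) M.
  by apply: filterS aM => j; apply: le_trans (cn_Re _).
have [|y hy] := @ulim_exR (fun j => im (a j)) M.
  by apply: filterS aM => j; apply: le_trans (cn_Im _).
exists (Complex x y) => e e0; have e2 : 0 < e / 2 by rewrite divr_gt0.
apply: filterS2 (hx _ e2) (hy _ e2) => j h1 h2.
by apply: le_lt_trans (cn_ReIm _) _; rewrite !raddfB /=; lra.
Qed.

Lemma ulim_cst x : ulim (fun=> x) x.
Proof. by move=> e e0; apply: nearW => j; rewrite subrr cn0. Qed.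

Lemma ulimD a b x y : ulim a x -> ulim b y -> ulim (fun j => a j + b j) (x + y).
Proof. by move=> /ulimP ha /ulimP hb; apply/ulimP; exact: (cvgD ha hb). Qed.

Lemma ulimB a b x y : ulim a x -> ulim b y -> ulim (fun j => a j - b j) (x - y).
Proof. by move=> /ulimP ha /ulimP hb; apply/ulimP; exact: (cvgB ha hb). Qed.

Lemma ulimM a b x y : ulim a x -> ulim b y -> ulim (fun j => a j * b j) (x * y).
Proof.
by move=> /ulimP ha /ulimP hb; apply/ulimP; have H := cvgM ha hb; exact: H.
Qed.

Lemma ulimX a x n : ulim a x -> ulim (fun j => a j ^+ n) (x ^+ n).
Proof.
move=> ha; elim: n => [|n IH]; first exact: ulim_cst.
have -> : (fun j => a j ^+ n.+1) = (fun j => a j * a j ^+ n).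
  by apply/funext => j; rewrite exprS.
by rewrite exprS; exact: ulimM.
Qed.

Lemma ulim_near a b x : (\forall j \near U, a j = b j) -> ulim a x -> ulim b x.
Proof. by move=> ab ha e /ha; apply: filterS2 ab => j ->. Qed.

Lemma ulim_le a x M : ulim a x -> (\forall j \near U, cn (a j) <= M) -> cn x <= M.
Proof.
move=> ha aM; apply/ler_addgt0Pl => e /ha he.
have [j [h1 h2]] := ultra_ex (filterI he aM).
by have := cn_lb x (x - a j); rewrite subKr cnC in h1 *; lra.
Qed.

Lemma ulim_ge a x M : ulim a x -> (\forall j \near U, M <= cn (a j)) -> M <= cn x.
Proof.
move=> ha aM; apply/ler_addgt0Pl => e /ha he.
have [j [h1 h2]] := ultra_ex (filterI he aM).
by have := cn_lb (a j) x; lra.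
Qed.

Lemma ulim_uniq a x y : ulim a x -> ulim a y -> x = y.
Proof.
move=> hx hy; apply/eqP; rewrite -subr_eq0 -cn_eq0 eq_le cn_ge0 andbT.
apply/ler_addgt0Pl => e e0; rewrite addr0; have e2 : 0 < e / 2 by rewrite divr_gt0.
have [j [h1 h2]] := ultra_ex (filterI (hx _ e2) (hy _ e2)).
by apply: le_trans (cn_tri (a j) _ _) _; rewrite cnC; lra.
Qed.

Lemma ulim0 a (d : nat -> R) : (\forall j \near U, cn (a j) <= d j) ->
  (forall e : R, 0 < e -> \forall j \near U, d j < e) -> ulim a 0.
Proof.
by move=> ad d0 e /d0; apply: filterS2 ad => j h1 h2; rewrite subr0 (le_lt_trans h1).
Qed.

End UltraLimit.

(** * Affine changes of variable *)

Section Scaling.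
Variable R : realType.
Local Notation C := R[i].
Local Notation hol := (@holomorphic R).
Implicit Types (f : C -> C) (z w c : C).

Lemma scale_near (V : set C) (c r : C) xi : open V -> V (c + r * xi) ->
  \forall w \near xi, V (c + r * w).
Proof.
move=> oV Vx.
have H := hasd_cont (hasd_affine (f := fun z => z) (hasd_id (c + r * xi))).
exact: (H V (oV _ Vx)).
Qed.

Lemma scale_hasd f (c r s : C) xi d : hasd f (c + r * xi) d ->
  hasd (fun w => s * f (c + r * w)) xi (s * (d * r)).
Proof. by move=> /hasd_affine /(hasdZ s). Qed.

Lemma scale_dvn (V : set C) f (c r s : C) i : open V -> hol V f -> forall xi, V (c + r * xi) ->
  derive1n i (fun w => s * f (c + r * w)) xi = s * r ^+ i * derive1n i f (c + r * xi).
Proof.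
move=> oV fV; elim: i => [|i IH] xi Vx; first by rewrite expr0 mulr1.
have E : \forall w \near xi, derive1n i (fun w => s * f (c + r * w)) w =
    (s * r ^+ i) * derive1n i f (c + r * w).
  by apply: filterS (scale_near oV Vx) => w /IH.
rewrite derive1nS (derive1_near E).
rewrite (hasdE (scale_hasd _ (hasd_dv (dvn_hol (i := i) oV fV Vx)))) exprSr derive1nS.
ring.
Qed.

Lemma scale_hol (V : set C) f (c r s : C) (D : set C) : hol V f ->
  (forall xi, D xi -> V (c + r * xi)) -> hol D (fun w => s * f (c + r * w)).
Proof.
by move=> fV DV xi /DV /fV /hasd_dv h; exact: hasd_derivable (scale_hasd s h).
Qed.

End Scaling.

Section LogDerivative.
Variable R : realType.
Local Notation C := R[i].
Local Notation hol := (@holomorphic R).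

(* If f'/f is bounded on a large disc then it is nearly constant there, so that
   the higher derivatives of f are nearly those of an exponential. *)
Lemma log_derivative i : exists2 K : R, 0 <= K & forall (a : C) (A k : R) (f : C -> C),
  1 <= A -> 0 <= k <= 2 -> hol (disc a A) f -> (forall z, disc a A z -> f z != 0) ->
  (forall z, disc a A z -> cn (derive1 f z / f z) <= k) ->
  forall z, disc a (A / 2 ^+ i) z ->
    cn (derive1n i f z / f z - (derive1 f z / f z) ^+ i) <= K * k / A.
Proof.
elim: i => [|i [K K0 IH]].
  exists 0 => // a A k f A1 _ fh f0 _ z; rewrite expr0 divr1 => zA.
  by rewrite -[derive1n 0 f z]/(f z) divff ?f0// expr0 subrr cn0 !mul0r.
exists (128 * 2 ^+ i * K + 128 * 4 ^+ i + 2 * K).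
  by rewrite !addr_ge0 ?mulr_ge0 ?exprn_ge0.
move=> a A k f A1 /[dup] kk /andP[k0 k2] fh f0 uk z zA.
have A0 : 0 < A by lra.
pose u w := derive1 f w / f w.
pose dl w := derive1n i f w / f w - u w ^+ i.
have oA := disc_open (a := a) (r := A).
have uh : hol (disc a A) u by exact: holM (dv_hol oA fh) (holV fh f0).
have dlh : hol (disc a A) dl.
  exact (holB (holM (dvn_hol (i := i) oA fh) (holV fh f0)) (holX (n := i) uh)).
have le1 n : A / 2 ^+ n <= A.
  by rewrite ler_piMr ?(ltW A0)// invf_le1 ?pow2_gt0// exprn_ege1// ler1n.
have zA' : disc a A z := disc_sub (le1 i.+1) zA.
pose s := A / 2 ^+ i.+1; have s0 : 0 < s by rewrite divr_gt0 ?pow2_gt0.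
have sub w : disc z s w -> disc a (A / 2 ^+ i) w.
  rewrite /disc /= [A / 2 ^+ i]half_pow -/s => ws; have := cn_tri z w a.
  by move: zA; rewrite /disc /= -/s; lra.
have subA w : disc z s w -> disc a A w by move=> /sub /(disc_sub (le1 i)).
have dlK w : disc z s w -> cn (dl w) <= K * k / A.
  by move=> /sub wA; exact (IH a A k f A1 kk fh f0 uk w wA).
have uK w : disc z s w -> cn (u w) <= k by move=> /subA; exact: uk.
(* With [h = derive1n i f / f] one has [derive1n i.+1 f / f = h' + h u]. Substituting [h = dl + u^i]
   leaves [dl u] and derivatives of functions bounded on a disc of radius comparable to [A], each of
   which gains a factor [1 / A]. *)
have E : derive1n i.+1 f z / f z - u z ^+ i.+1 =
    derive1 dl z + derive1 (fun w => u w ^+ i) z + dl z * u z.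
  have fz := f0 z zA'.
  have H1 := hasdM (hasd_dv (dvn_hol (i := i) oA fh zA')) (hasdV fz (hasd_dv (fh z zA'))).
  have H2 := hasdX i (hasd_dv (uh z zA')).
  have D2 := hasdE H2.
  have D1 : derive1 dl z = derive1 (derive1n i f) z / f z +
    derive1n i f z * (- derive1 f z / f z ^+ 2) - i%:R * u z ^+ i.-1 * derive1 u z.
    exact: hasdE (hasdB H1 H2).
  rewrite D1 D2 exprS /dl derive1nS.
  have -> : - derive1 f z / f z ^+ 2 = - u z / f z by rewrite /u; field.
  move: (u z) (u z ^+ i) (derive1 u z) (u z ^+ i.-1) (derive1 _ z) (derive1n _ _ z).
  by move=> x xi y v p q; field.
have B1 : cn (derive1 dl z) <= 128 * 2 ^+ i * K * k / A.
  have := cauchy_est s0 (hol_sub subA dlh) dlK.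
  have -> : 64 * (K * k / A) / s = 128 * 2 ^+ i * K * k / A / A.
    by rewrite /s exprS; field; rewrite ?(gt_eqF A0) ?expf_neq0 ?gt_eqF.
  move=> /le_trans; apply; rewrite ler_piMr ?invf_le1//.
  by rewrite !mulr_ge0 ?invr_ge0 ?exprn_ge0 ?(ltW A0).
have B2 : cn (derive1 (fun w => u w ^+ i) z) <= 128 * 4 ^+ i * k / A.
  have nn : 0 <= 128 * 4 ^+ i * k / A by rewrite !mulr_ge0 ?invr_ge0 ?exprn_ge0 ?(ltW A0).
  have [i0|i0] := posnP i.
    rewrite i0 in nn *; rewrite (hasdE (hasd_cst (1 : C) z) : derive1 (fun w => u w ^+ 0) z = 0).
    by rewrite cn0.
  (* One factor [u] is estimated by [k], the others by 2, so that the bound stays proportional to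
     [k]; this matters when [k] tends to 0. For [i = 0] the power is constant and its derivative is
     0. *)
  have uKi w : disc z s w -> cn (u w ^+ i) <= 2 ^+ i * k.
    move=> /uK uw; rewrite cnX -(prednK i0) exprSr; apply: ler_pM; rewrite ?exprn_ge0 ?cn_ge0//.
    apply: (@le_trans _ _ (2 ^+ i.-1)).
      by rewrite lerXn2r ?nnegrE ?cn_ge0// (le_trans uw).
    by rewrite ler_weXn2l ?ler1n// leqnSn.
  have := cauchy_est s0 (hol_sub subA (holX (n := i) uh)) uKi.
  have -> : 64 * (2 ^+ i * k) / s = 128 * 4 ^+ i * k / A.
    have -> : 4 = 2 * 2 :> R by ring.
    by rewrite /s exprS exprMn; field; rewrite ?(gt_eqF A0) ?expf_neq0 ?gt_eqF.
  by [].
have B3 : cn (dl z * u z) <= 2 * K * k / A.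
  rewrite cnM; have := dlK z (disc_center z s0); have := uK z (disc_center z s0).
  move=> h1 h2; apply: le_trans (ler_pM (cn_ge0 _) (cn_ge0 _) h2 (le_trans h1 k2)) _.
  by rewrite le_eqVlt; apply/orP; left; apply/eqP; ring.
rewrite (E : derive1n i.+1 f z / f z - (derive1 f z / f z) ^+ i.+1 = _).
apply: le_trans (cnD _ _) _; apply: le_trans (lerD (cnD _ _) B3) _.
apply: le_trans (lerD (lerD B1 B2) (lexx _)) _.
by rewrite le_eqVlt; apply/orP; left; apply/eqP; ring.
Qed.

End LogDerivative.

(** * Systems with a nearly constant factor *)

Section LogCalculus.
Variable R : realType.
Local Notation C := R[i].
Local Notation hol := (@holomorphic R).
Implicit Types (f g : C -> C) (z a b : C).

(** Logarithmic derivative in product form: products and powers turn into sums and multiples, and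
    only the uniqueness of [a] asks for [f z] to be nonzero. *)
Definition logd f z a := hasd f z (f z * a).

Lemma logd_dv f z : f z != 0 -> derivable f z 1 -> logd f z (derive1 f z / f z).
Proof. by move=> fz /hasd_dv; rewrite /logd mulrC divfK. Qed.

Lemma logdM f g z a b : logd f z a -> logd g z b -> logd (fun w => f w * g w) z (a + b).
Proof.
move=> fa gb; have := hasdM fa gb; rewrite /logd.
by congr hasd; ring.
Qed.

Lemma logdX f z a n : logd f z a -> logd (fun w => f w ^+ n) z (n%:R * a).
Proof.
move=> fa; have := hasdX n fa; rewrite /logd; congr hasd.
case: n => [|n]; first by rewrite mulr0n; ring.
by rewrite exprS /=; ring.
Qed.

Lemma logd_uniq f z a b : f z != 0 -> logd f z a -> logd f z b -> a = b.
Proof. by move=> fz fa fb; apply: (mulfI fz); exact: hasd_uniq fa fb. Qed.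

Lemma dvnD (V : set C) f g i : open V -> hol V f -> hol V g -> forall z, V z ->
  derive1n i (fun w => f w + g w) z = derive1n i f z + derive1n i g z.
Proof.
move=> oV fV gV; elim: i => [//|i IH] z Vz.
have E : \forall w \near z, derive1n i (fun w => f w + g w) w = derive1n i f w + derive1n i g w.
  by apply: filterS (oV _ Vz) => w /IH.
rewrite derive1nS (derive1_near E).
exact (hasdE (hasdD (hasd_dv (dvn_hol (i := i) oV fV Vz))
  (hasd_dv (dvn_hol (i := i) oV gV Vz)))).
Qed.

Lemma dvn_monomial0 (c b : C) l : derive1n l.+1 (fun z => c * (z + b) ^+ l) = (fun=> 0).
Proof.
elim: l c => [|l IH] c.
  apply/funext => z; exact (etrans (hasdE (hasdZ c (hasd_cst (1 : C) z))) (mulr0 c)).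
rewrite derive1Sn.
have -> : derive1 (fun z => c * (z + b) ^+ l.+1) = (fun z => (c * l.+1%:R) * (z + b) ^+ l).
  apply/funext => z.
  apply: (etrans (hasdE (hasdZ c (hasdX l.+1 (hasdD (hasd_id z) (hasd_cst b z)))))).
  by rewrite /= addr0 mulr1 mulrA.
exact: IH.
Qed.

Lemma hol_monomial (V : set C) (c b : C) l : hol V (fun z => c * (z + b) ^+ l).
Proof.
move=> z _; apply: hasd_derivable.
exact (hasdZ c (hasdX l (hasdD (hasd_id z) (hasd_cst b z)))).
Qed.

End LogCalculus.

Section PowerSystem.
Variable R : realType.
Local Notation C := R[i].
Local Notation hol := (@holomorphic R).
Variables (N b c k l : nat) (c0 : C).
Hypotheses (bN : (b < N)%N) (cN : (c < N)%N) (Nbc : (N < b + c)%N) (c00 : c0 != 0).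
Let q := (k + l).+1.

(** Here [f], [g], [phi] are rescalings of F, F^(k) - c z^l and Phi. The relation between the [k]-th
    derivative of [f] and [g] is kept apart, as the second rescaling would change the coefficient of
    its monomial. *)
Definition power_system (A : R) (f g phi : C -> C) :=
  [/\ hol (disc 0 A) f, hol (disc 0 A) g, hol (disc 0 A) phi,
      (forall z, disc 0 A z -> [/\ f z != 0, g z != 0 & phi z != 0]) &
      (forall z, disc 0 A z -> derive1n q f z = derive1n l.+1 g z /\
         derive1n q f z ^+ N = phi z * f z ^+ b * g z ^+ c)].

(** The [N]-th power of the derivative is a product of nonvanishing functions, so the derivative has
    no zeros and the power relation can be differentiated logarithmically. *)
Lemma system_logd A f g phi z : power_system A f g phi -> disc 0 A z ->
  [/\ derive1n q f z != 0, derive1n q f z = derive1n l.+1 g z,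
   N%:R * derive1n q.+1 f z = derive1n q f z *
    (derive1 phi z / phi z + b%:R * (derive1 f z / f z) + c%:R * (derive1 g z / g z)) &
   derive1n q.+1 f z = derive1n l.+2 g z].
Proof.
move=> [fh gh ph n0 rel] zA; have [fz gz pz] := n0 z zA.
have oA := disc_open (a := 0 : C) (r := A).
have N0 : (0 < N)%N by apply: leq_ltn_trans bN.
have Wz : derive1n q f z != 0.
  have := (rel z zA).2; apply: contra_eqN => /eqP ->.
  by rewrite expr0n eqn0Ngt N0 eq_sym !mulf_neq0 ?expf_neq0.
split; [exact: Wz|exact: (rel z zA).1| |].
  have Wd : derivable (derive1n q f) z 1 by exact (dvn_hol (i := q) oA fh zA).
  have L1 := logdX N (logd_dv Wz Wd).
  have L2 := logdM (logdM (logd_dv pz (ph z zA)) (logdX b (logd_dv fz (fh z zA))))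
    (logdX c (logd_dv gz (gh z zA))).
  have E : \forall w \near z, phi w * f w ^+ b * g w ^+ c = derive1n q f w ^+ N.
    by apply: filterS (disc_nbhs zA) => w wA; rewrite (rel w wA).2.
  have L3 : logd (fun w => derive1n q f w ^+ N) z (derive1 phi z / phi z +
      b%:R * (derive1 f z / f z) + c%:R * (derive1 g z / g z)).
    have := hasd_near E L2; rewrite /logd; congr hasd; congr (_ * _).
    exact (nbhs_singleton E).
  have WN : (fun w => derive1n q f w ^+ N) z != 0 by rewrite expf_neq0.
  have EE := @logd_uniq _ (fun w => derive1n q f w ^+ N) z _ _ WN L1 L3.
  apply: (etrans _ (congr1 (fun t => derive1n q f z * t) EE)).
  rewrite derive1nS; move: (derive1n q f z) (derive1 (derive1n q f) z) Wz => u v u0.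
  by field.
rewrite !derive1nS; apply: derive1_near.
by apply: filterS (disc_nbhs zA) => w wA; exact: (rel w wA).1.
Qed.

Lemma comb_bound (x y : C) : cn x <= 2 -> cn y <= 2 ->
  cn (b%:R * x + c%:R * y) <= 4 * N%:R.
Proof.
move=> x2 y2; apply: le_trans (cnD _ _) _; rewrite !cnM !cn_nat.
have -> : 4 * N%:R = N%:R * 2 + N%:R * 2 :> R by ring.
by apply: lerD; apply: ler_pM; rewrite ?cn_ge0// ler_nat ltnW.
Qed.

(** Here [x] is h'/h, and [a1], [a2] are h^(i)/h and h^(i+1)/h. Replacing them by [x^i] and
    [x^(i+1)] in [N a2 = a1 (s + t)] and dropping [s] costs errors of order [1 / A] only. *)
Lemma log_limit_num (A K1 K2 : R) (x a1 a2 s t : C) i : 1 <= A -> 0 <= K1 -> 0 <= K2 ->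
  cn (a1 - x ^+ i) <= K1 * 2 / A -> cn (a2 - x ^+ i.+1) <= K2 * 2 / A -> cn x <= 2 ->
  N%:R * a2 = a1 * (s + t) -> cn s <= A^-1 -> cn t <= 4 * N%:R ->
  cn (x ^+ i * (N%:R * x - t)) <=
    (2 * N%:R * K2 + 2 * K1 * (1 + 4 * N%:R) + 2 ^+ i) / A.
Proof.
move=> A1 K10 K20 B1 B2 xb E' sA tN; have A0 : 0 < A by lra.
have -> : x ^+ i * (N%:R * x - t) =
    - (N%:R * (a2 - x ^+ i.+1)) + (a1 - x ^+ i) * (s + t) + x ^+ i * s.
  by rewrite [N%:R * (a2 - _)]mulrBr E' exprS; ring.
have i1 : A^-1 <= 1 by rewrite invf_le1.
have st : cn (s + t) <= 1 + 4 * N%:R.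
  by apply: le_trans (cnD _ _) _; apply: lerD => //; apply: le_trans i1.
apply: le_trans (cnD _ _) _; apply: le_trans (lerD (cnD _ _) (lexx _)) _.
rewrite cnN !cnM cn_nat mulrDl mulrDl.
have nA : 0 <= A^-1 by rewrite invr_ge0 ltW.
apply: lerD; first apply: lerD.
- have -> : 2 * N%:R * K2 / A = N%:R * (K2 * 2 / A) by ring.
  by rewrite ler_wpM2l.
- have -> : 2 * K1 * (1 + 4 * N%:R) / A = K1 * 2 / A * (1 + 4 * N%:R) by ring.
  by apply: ler_pM; rewrite ?cn_ge0.
- by apply: ler_pM; rewrite ?cn_ge0// cnX lerXn2r ?nnegrE ?cn_ge0.
Qed.

Lemma log_limit i : exists2 K : R, 0 <= K & forall A h s t,
  1 <= A -> hol (disc 0 A) h -> (forall z, disc 0 A z -> h z != 0) ->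
  (forall z, disc 0 A z -> cn (derive1 h z / h z) <= 2) ->
  N%:R * derive1n i.+1 h 0 = derive1n i h 0 * (s + t) -> cn s <= A^-1 ->
  cn t <= 4 * N%:R ->
  cn ((derive1 h 0 / h 0) ^+ i * (N%:R * (derive1 h 0 / h 0) - t)) <= K / A.
Proof.
have [K1 K10 H1] := log_derivative R i; have [K2 K20 H2] := log_derivative R i.+1.
exists (2 * N%:R * K2 + 2 * K1 * (1 + 4 * N%:R) + 2 ^+ i).
  by rewrite !addr_ge0 ?mulr_ge0 ?addr_ge0 ?exprn_ge0.
move=> A h s t A1 hh h0 h2 E sA tN.
have A0 : 0 < A by lra.
have in0 j : disc 0 (A / 2 ^+ j) (0 : C) by apply: disc_center; rewrite divr_gt0 ?pow2_gt0.
have k2 : 0 <= (2 : R) <= 2 by rewrite lexx ler0n.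
have B1 := H1 0 A 2 h A1 k2 hh h0 h2 0 (in0 i).
have B2 := H2 0 A 2 h A1 k2 hh h0 h2 0 (in0 i.+1).
have hz : h 0 != 0 by apply: h0; exact: disc_center.
have xb := h2 0 (disc_center _ A0).
have E' : N%:R * (derive1n i.+1 h 0 / h 0) = derive1n i h 0 / h 0 * (s + t).
  by rewrite mulrA E mulrAC.
exact (log_limit_num A1 K10 K20 B1 B2 xb E' sA tN).
Qed.

(* The limits x of f'/f and y of g'/g are constants, not both 0, with
   x^q (N x - b x - c y) = 0 and y^(l+1) (N y - b x - c y) = 0; no such x, y exist
   as b, c < N < b + c. *)
Lemma no_exponential_limit : (forall j : nat, exists f g phi, [/\ power_system j.+1%:R f g phi,
    forall z, disc 0 j.+1%:R z -> cn (derive1 f z / f z) <= 2 /\ cn (derive1 g z / g z) <= 2,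
    1 <= cn (derive1 f 0 / f 0) \/ 1 <= cn (derive1 g 0 / g 0) &
    cn (derive1 phi 0 / phi 0) <= j.+1%:R^-1]) -> False.
Proof.
move=> H; have [K1 K10 H1] := log_limit q; have [K2 K20 H2] := log_limit l.+1.
pose K := Num.max K1 K2.
have /choice[xy hxy] : forall j : nat, exists xy : C * C,
    [/\ cn xy.1 <= 2, cn xy.2 <= 2, 1 <= cn xy.1 \/ 1 <= cn xy.2,
     cn (xy.1 ^+ q * (N%:R * xy.1 - (b%:R * xy.1 + c%:R * xy.2))) <= K / j.+1%:R &
     cn (xy.2 ^+ l.+1 * (N%:R * xy.2 - (b%:R * xy.1 + c%:R * xy.2))) <= K / j.+1%:R].
  move=> j; have [f [g [phi [sys le2 ge1 ph]]]] := H j.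
  have A0 : 0 < j.+1%:R :> R by rewrite ltr0n.
  have A1 : 1 <= j.+1%:R :> R by rewrite ler1n.
  have KK1 : K1 / j.+1%:R <= K / j.+1%:R.
    by rewrite ler_wpM2r ?invr_ge0 ?ler0n// /K le_max lexx.
  have KK2 : K2 / j.+1%:R <= K / j.+1%:R.
    by rewrite ler_wpM2r ?invr_ge0 ?ler0n// /K le_max lexx orbT.
  have in0 := disc_center (0 : C) A0.
  have [fl gl] := le2 0 in0.
  have [Wz WE L1 E1] := system_logd sys in0.
  have [fh gh _ n0 _] := sys.
  exists (derive1 f 0 / f 0, derive1 g 0 / g 0) => /=.
  have tN := comb_bound fl gl.
  have fn z : disc 0 j.+1%:R z -> f z != 0 by move=> /n0[].
  have gn z : disc 0 j.+1%:R z -> g z != 0 by move=> /n0[].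
  split; [exact: fl|exact: gl|exact: ge1| |].
    apply: (fun h => le_trans h KK1).
    apply: (H1 _ f (derive1 phi 0 / phi 0) _ A1 fh fn _ _ ph tN).
      by move=> z /le2[].
    exact (etrans L1 (congr1 (fun t => derive1n q f 0 * t) (esym (addrA _ _ _)))).
  apply: (fun h => le_trans h KK2).
  apply: (H2 _ g (derive1 phi 0 / phi 0) _ A1 gh gn _ _ ph tN).
    by move=> z /le2[].
  apply: (etrans (congr1 (fun t => N%:R * t) (esym E1))); apply: (etrans L1).
  exact (etrans (congr1 (fun t => derive1n q f 0 * t) (esym (addrA _ _ _)))
    (congr1 (fun t => t * _) WE)).
have [U [UU Uoo]] := ultraFilterLemma (@eventually_filter).
have small (e : R) : 0 < e -> \forall j \near U, K / j.+1%:R < e.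
  move=> e0; apply: Uoo; exists (Num.bound `|K / e|) => // j /= jb.
  rewrite ltr_pdivrMr ?ltr0n// mulrC -ltr_pdivrMr//.
  apply: le_lt_trans (ler_norm _) _; apply: lt_trans (archi_boundP (normr_ge0 _)) _.
  by rewrite ltr_nat ltnS.
have [x hx] : exists x, ulim U (fun j => (xy j).1) x.
  by apply: (@ulim_ex _ U UU _ 2); apply: nearW => j; case: (hxy j).
have [y hy] : exists y, ulim U (fun j => (xy j).2) y.
  by apply: (@ulim_ex _ U UU _ 2); apply: nearW => j; case: (hxy j).
have hN := ulim_cst UU (N%:R : C).
have ht := ulimD UU (ulimM UU (ulim_cst UU (b%:R : C)) hx) (ulimM UU (ulim_cst UU (c%:R : C)) hy).
have z1 : x ^+ q * (N%:R * x - (b%:R * x + c%:R * y)) = 0.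
  apply: (ulim_uniq UU (ulimM UU (ulimX UU q hx) (ulimB UU (ulimM UU hN hx) ht))).
  by apply: (@ulim0 _ U UU _ (fun j => K / j.+1%:R)) => //; apply: nearW => j; case: (hxy j).
have z2 : y ^+ l.+1 * (N%:R * y - (b%:R * x + c%:R * y)) = 0.
  apply: (ulim_uniq UU (ulimM UU (ulimX UU l.+1 hy) (ulimB UU (ulimM UU hN hy) ht))).
  by apply: (@ulim0 _ U UU _ (fun j => K / j.+1%:R)) => //; apply: nearW => j; case: (hxy j).
have xy1 : 1 <= cn x \/ 1 <= cn y.
  have /(ultra_orW UU)[h|h] : \forall j \near U, 1 <= cn (xy j).1 \/ 1 <= cn (xy j).2.
  - by apply: nearW => j; case: (hxy j).
  - by left; exact: (ulim_ge UU hx h).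
  - by right; exact: (ulim_ge UU hy h).
have natI (m n : nat) : (m%:R : C) = n%:R -> m = n by move=> /eqP; rewrite eqr_nat => /eqP.
(* If one limit is 0, the equation of the other gives [N = c] or [N = b]. If neither is, both equal
   [(b x + c y) / N], so [x = y] and [N = b + c]. *)
have [x0|x0] := eqVneq x 0.
  have y0 : y != 0 by rewrite -cn_gt0; case: xy1; rewrite ?x0 ?cn0; lra.
  move/eqP: z2; rewrite x0 mulr0 add0r -mulrBl !mulf_eq0 (negbTE (expf_neq0 _ y0)) /=.
  by rewrite (negbTE y0) orbF subr_eq0 => /eqP/natI E; move: cN; rewrite E ltnn.
have [y0|y0] := eqVneq y 0.
  move/eqP: z1; rewrite y0 mulr0 addr0 -mulrBl !mulf_eq0 (negbTE (expf_neq0 _ x0)) /=.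
  by rewrite (negbTE x0) orbF subr_eq0 => /eqP/natI E; move: bN; rewrite E ltnn.
move/eqP: z1; rewrite mulf_eq0 (negbTE (expf_neq0 _ x0)) /= subr_eq0 => /eqP e1.
move/eqP: z2; rewrite mulf_eq0 (negbTE (expf_neq0 _ y0)) /= subr_eq0 -e1 => /eqP e2.
have N0 : N%:R != 0 :> C by rewrite pnatr_eq0 -lt0n (leq_ltn_trans _ bN).
have xE : x = y by apply: (mulfI N0).
move: e1; rewrite xE -mulrDl -natrD => /(mulIf y0)/natI E.
by move: Nbc; rewrite E ltnn.
Qed.

End PowerSystem.

Section ConstantLimit.
Variable R : realType.
Local Notation C := R[i].
Local Notation hol := (@holomorphic R).
Variables (N b c k l : nat) (c0 : C).
Hypotheses (bN : (b < N)%N) (cN : (c < N)%N) (Nbc : (N < b + c)%N) (c00 : c0 != 0).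
Let q := (k + l).+1.
Let e := (b + c - N)%N.

(** Since [b = e + (N - c)], the power relation gives [(W / f)^(N - c) (W / g)^c = phi f^e], and
    symmetrically for [g]. The exponent [e = b + c - N] is positive, so [f] and [g] are small
    together with [W / f] and [W / g]. *)
Lemma system_small (W f g phi : C) (d : R) : f != 0 -> g != 0 ->
  W ^+ N = phi * f ^+ b * g ^+ c -> cn (W / f) <= d -> cn (W / g) <= d -> d <= 1 ->
  1 / 2 <= cn phi -> cn f ^+ e <= 2 * d /\ cn g ^+ e <= 2 * d.
Proof.
move=> f0 g0 WE fd gd d1 ph.
have d0 : 0 <= d by apply: le_trans (cn_ge0 _) fd.
have bE : b = (e + (N - c))%N by rewrite /e; have := ltnW cN; have := Nbc; lia.
have cE : c = (e + (N - b))%N by rewrite /e; have := ltnW bN; have := Nbc; lia.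
have Nc : N = ((N - c) + c)%N by rewrite subnK// ltnW.
have Nb : N = (b + (N - b))%N by rewrite subnKC// ltnW.
have dN m m' : N = (m + m')%N -> cn (W / f) ^+ m * cn (W / g) ^+ m' <= d.
  move=> Nm; apply: (@le_trans _ _ (d ^+ N)).
    by rewrite Nm exprD; apply: ler_pM; rewrite ?exprn_ge0 ?cn_ge0// lerXn2r ?nnegrE ?cn_ge0.
  rewrite -{2}[d]expr1; apply: ler_wiXn2l => //.
  by apply: leq_ltn_trans bN.
have half (x y : R) : 0 <= x -> cn phi * x <= y -> x <= 2 * y.
  by move=> x0; move: ph x0; move: (cn phi) => p; nra.
have fb : f ^+ (N - c) != 0 by rewrite expf_neq0.
have fc : g ^+ c != 0 by rewrite expf_neq0.
have gb : f ^+ b != 0 by rewrite expf_neq0.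
have gc : g ^+ (N - b) != 0 by rewrite expf_neq0.
split; (apply: half; first by rewrite exprn_ge0 ?cn_ge0).
  apply: le_trans (dN _ _ Nc); rewrite -!cnX -!cnM.
  suff -> : (W / f) ^+ (N - c) * (W / g) ^+ c = phi * f ^+ e by [].
  have -> : (W / f) ^+ (N - c) * (W / g) ^+ c = W ^+ N / (f ^+ (N - c) * g ^+ c).
    by rewrite !expr_div_n {3}Nc exprD; field; apply/andP.
  by rewrite WE {1}bE exprD; field; apply/andP.
apply: le_trans (dN _ _ Nb); rewrite -!cnX -!cnM.
suff -> : (W / f) ^+ b * (W / g) ^+ (N - b) = phi * g ^+ e by [].
have -> : (W / f) ^+ b * (W / g) ^+ (N - b) = W ^+ N / (f ^+ b * g ^+ (N - b)).
  by rewrite !expr_div_n {3}Nb exprD; field; apply/andP.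
by rewrite WE {1}cE exprD; field; apply/andP.
Qed.

(* When f'/f and g'/g tend to 0, so do f and g themselves because N < b + c, and
   then c0 (z + b0)^l would tend to 0 as well. *)
Lemma no_constant_limit : (forall d : R, 0 < d -> exists f g phi b0,
    [/\ power_system N b c k l 1 f g phi,
     forall z, disc 0 1 z -> cn (derive1 f z / f z) <= d /\ cn (derive1 g z / g z) <= d,
     forall z, disc 0 1 z -> 1 / 2 <= cn (phi z) &
     forall z, disc 0 1 z -> derive1n k f z = g z + c0 * (z + b0) ^+ l]) -> False.
Proof.
move=> H.
have [Kq Kq0 Hq] := log_derivative R q; have [Kl Kl0 Hl] := log_derivative R l.+1.
have [Kk Kk0 Hk] := log_derivative R k.
(* All logarithmic estimates hold on the disc of radius [4 t]. It contains 0 and a point [x] with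
   [|x| = 3 t], which cannot both be closer than [t] to [- b0]. *)
pose t : R := 1 / 2 ^+ q / 4.
have t0 : 0 < t by rewrite !divr_gt0 ?pow2_gt0.
have cc0 : 0 < cn c0 by rewrite cn_gt0.
(* Bounds [|f|, |g| <= eta] give [|f^(k) - g| <= (2 + Kk) eta], which is half of [|c0| t^l]. The
   number [d] below makes [2 (1 + Kq + Kl) d] smaller than [eta^e]. *)
pose eta := cn c0 * t ^+ l / (2 * (2 + Kk)).
have L0 : 0 < 2 + Kk by rewrite ltr_pwDl.
have eta0 : 0 < eta by rewrite divr_gt0 ?mulr_gt0 ?exprn_gt0.
have S0 : 0 < 1 + Kq + Kl by rewrite !ltr_wpDr// ltr01.
pose d := Num.min (1 / (1 + Kq + Kl)) (eta ^+ e / (4 * (1 + Kq + Kl))).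
have d0 : 0 < d.
  by rewrite lt_min; apply/andP; split; apply: divr_gt0 => //;
    [exact: exprn_gt0|exact: mulr_gt0].
have d1 : (1 + Kq + Kl) * d <= 1.
  by rewrite mulrC -ler_pdivlMr// ge_min lexx.
have d2 : (1 + Kq + Kl) * d <= eta ^+ e / 4.
  rewrite mulrC -ler_pdivlMr//.
  have -> : eta ^+ e / 4 / (1 + Kq + Kl) = eta ^+ e / (4 * (1 + Kq + Kl)).
    by field; rewrite gt_eqF.
  by rewrite ge_min lexx orbT.
have d11 : d <= 1.
  by apply: le_trans d1; rewrite ler_peMl// ?(ltW d0)//; lra.
have dd : 0 <= d <= 2 by apply/andP; split; lra.
have [f [g [phi [b0 [sys uv ph psi]]]]] := H d d0.
have [fh gh _ n0 rel] := sys.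
have fn z : disc 0 1 z -> f z != 0 by move=> /n0[].
have gn z : disc 0 1 z -> g z != 0 by move=> /n0[].
have u1 z : disc 0 1 z -> cn (derive1 f z / f z) <= d by move=> /uv[].
have v1 z : disc 0 1 z -> cn (derive1 g z / g z) <= d by move=> /uv[].
have shrink i (z : C) : (i <= q)%N -> disc 0 (1 / 2 ^+ q) z -> disc 0 (1 / 2 ^+ i) z.
  move=> iq; apply: disc_sub; rewrite !div1r lef_pV2 ?posrE ?pow2_gt0//.
  by rewrite ler_weXn2l ?ler1n.
have powle (x : C) i : cn x <= d -> cn (x ^+ i.+1) <= d.
  move=> xd; rewrite cnX exprS -[d]mulr1; apply: ler_pM; rewrite ?exprn_ge0 ?cn_ge0//.
  by apply: exprn_ile1; rewrite ?cn_ge0// (le_trans xd).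
have near_pow (a x : C) (K : R) i : cn x <= d -> cn (a - x ^+ i.+1) <= K * d / 1 ->
    cn a <= (1 + K) * d.
  move=> xd ad; rewrite -[a](subrK (x ^+ i.+1)); apply: le_trans (cnD _ _) _.
  by rewrite divr1 in ad; rewrite mulrDl mul1r addrC lerD// powle.
have key (z : C) : disc 0 (1 / 2 ^+ q) z -> cn (z + b0) < t.
  move=> zq.
  have z1 : disc 0 1 z by have := shrink 0%N z isT zq; rewrite expr0 divr1.
  have B1 := Hq 0 1 d f (lexx _) dd fh fn u1 z zq.
  have lq : (l.+1 <= q)%N by rewrite /q ltnS leq_addl.
  have kq : (k <= q)%N by rewrite /q (leq_trans (leq_addr l k)).
  have B2 := Hl 0 1 d g (lexx _) dd gh gn v1 z (shrink _ _ lq zq).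
  have B3 := Hk 0 1 d f (lexx _) dd fh fn u1 z (shrink _ _ kq zq).
  have [WE WN] := rel z z1.
  have a1 := near_pow _ _ _ _ (u1 z z1) B1.
  have a2 : cn (derive1n q f z / g z) <= (1 + Kl) * d.
    rewrite (WE : derive1n q f z = _); exact: near_pow _ _ _ _ (v1 z z1) B2.
  have le1 : (1 + Kq) * d <= (1 + Kq + Kl) * d by rewrite ler_wpM2r ?(ltW d0)// lerDl.
  have le2 : (1 + Kl) * d <= (1 + Kq + Kl) * d.
    by rewrite ler_wpM2r ?(ltW d0)// addrAC lerDl.
  have [fe ge] := system_small (fn z z1) (gn z z1) WN (le_trans a1 le1) (le_trans a2 le2)
    d1 (ph z z1).
  have small (x : R) : 0 <= x -> x ^+ e <= 2 * ((1 + Kq + Kl) * d) -> x <= eta.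
    move=> x0 xe; rewrite leNgt; apply/negP => ex.
    have : eta ^+ e <= x ^+ e by rewrite lerXn2r ?nnegrE// ltW.
    by have := exprn_gt0 e eta0; lra.
  have fs := small _ (cn_ge0 _) fe; have gs := small _ (cn_ge0 _) ge.
  have B4 : cn (derive1n k f z) <= (1 + Kk) * eta.
    rewrite -[derive1n k f z](divfK (fn z z1)) cnM; apply: ler_pM; rewrite ?cn_ge0//.
    rewrite -[derive1n k f z / f z](subrK ((derive1 f z / f z) ^+ k)).
    apply: le_trans (cnD _ _) _; rewrite addrC; apply: lerD.
      by rewrite cnX; apply: exprn_ile1; rewrite ?cn_ge0// (le_trans (u1 z z1)).
    by apply: le_trans B3 _; rewrite divr1 ler_piMr.
  have B5 : cn (c0 * (z + b0) ^+ l) <= (2 + Kk) * eta.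
    have -> : c0 * (z + b0) ^+ l = derive1n k f z - g z by rewrite psi// addrAC subrr add0r.
    apply: le_trans (cnB _ _) _; have -> : (2 + Kk) * eta = (1 + Kk) * eta + eta by ring.
    exact: lerD.
  rewrite ltNge; apply/negP => tz.
  have : cn c0 * t ^+ l <= cn (c0 * (z + b0) ^+ l).
    by rewrite cnM cnX ler_wpM2l ?cn_ge0// lerXn2r ?nnegrE ?cn_ge0// ltW.
  have -> : cn c0 * t ^+ l = 2 * ((2 + Kk) * eta) by rewrite /eta; field; rewrite gt_eqF.
  by have := mulr_gt0 L0 eta0; lra.
have t4 : 1 / 2 ^+ q = 4 * t by rewrite /t; field; rewrite expf_neq0.
have [x xE] : exists x : C, cn x = 3 * t.
  by exists (rC (3 * t)); rewrite cnr ger0_norm// mulr_ge0// ltW.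
have k1 : cn (0 + b0) < t by apply: key; apply: disc_center; rewrite t4 mulr_gt0.
have k2 : cn (x + b0) < t by apply: key; rewrite /disc /= subr0 t4 xE; lra.
by have := cnB (x + b0) (0 + b0); rewrite add0r addrK xE; rewrite add0r in k1; lra.
Qed.

End ConstantLimit.

Section LargeSystems.
Variable R : realType.
Local Notation C := R[i].
Local Notation hol := (@holomorphic R).
Variables (N b c k l : nat) (c0 : C).
Hypotheses (bN : (b < N)%N) (cN : (c < N)%N) (Nbc : (N < b + c)%N) (c00 : c0 != 0).
Let q := (k + l).+1.

Lemma cn_rC_pos (r : R) : 0 < r -> cn (rC r : C) = r.
Proof. by move=> r0; rewrite cnr ger0_norm// ltW. Qed.

Lemma scale_disc (A r : R) (z xi : C) : 0 < r -> disc 0 A xi ->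
  cn (z + rC r * xi - z) < r * A.
Proof.
move=> r0; rewrite /disc /= subr0 addrC addKr cnM cn_rC_pos// => xA.
by rewrite ltr_pM2l.
Qed.

Lemma power_system_sub (A A' : R) f g phi : A <= A' ->
  power_system N b c k l A' f g phi -> power_system N b c k l A f g phi.
Proof.
move=> AA [fh gh ph n0 rel]; have S := @disc_sub _ (0 : C) _ _ AA.
split; [exact: hol_sub fh|exact: hol_sub gh|exact: hol_sub ph| |].
  by move=> z /S /n0.
by move=> z /S /rel.
Qed.

Lemma scale_log (V : set C) f (z s xi : C) (r : C) : hol V f -> V (z + r * xi) -> s != 0 ->
  derive1 (fun w => s * f (z + r * w)) xi / (s * f (z + r * xi)) =
  r * (derive1 f (z + r * xi) / f (z + r * xi)).
Proof.
move=> fV /fV /hasd_dv /(scale_hasd s) /hasdE ->.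
move: (derive1 f _) (f _) => d v s0; rewrite invfM.
by rewrite mulrACA divff// mul1r; ring.
Qed.

Lemma scale_dv_log (V : set C) f (z s xi : C) (r : R) : 0 < r -> hol V f ->
  V (z + rC r * xi) -> s != 0 ->
  cn (derive1 (fun w => s * f (z + rC r * w)) xi / (s * f (z + rC r * xi))) =
  r * cn (derive1 f (z + rC r * xi) / f (z + rC r * xi)).
Proof.
move=> r0 fV Vx s0; apply: (etrans (congr1 cn (scale_log fV Vx s0))).
exact (etrans (cnM _ _) (congr1 (fun t => t * _) (cn_rC_pos r0))).
Qed.

Lemma power_system_scale (A A' : R) f g phi (z : C) (r : R) : 0 < r ->
  (forall xi, disc 0 A xi -> disc 0 A' (z + rC r * xi)) ->
  power_system N b c k l A' f g phi ->
  power_system N b c k l A (fun xi => (rC r : C) ^- k * f (z + rC r * xi))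
    (fun xi => 1 * g (z + rC r * xi))
    (fun xi => (rC r : C) ^+ (l.+1 * N + k * b) * phi (z + rC r * xi)).
Proof.
move=> r0 sub [fh gh ph n0 rel].
have rn0 : rC r != 0 :> C by rewrite -cn_gt0 cn_rC_pos.
split; [exact: scale_hol fh sub|exact: scale_hol gh sub|exact: scale_hol ph sub| |].
  move=> xi /sub /n0[f0 g0 p0]; rewrite !mulf_neq0 ?invr_eq0 ?expf_neq0 ?oner_eq0//.
have oA' := disc_open (a := 0 : C) (r := A').
move=> xi /sub xA; have [WE WN] := rel _ xA.
rewrite (scale_dvn ((rC r : C) ^- k) q oA' fh xA).
rewrite (scale_dvn 1 l.+1 oA' gh xA) -WE.
have E : (rC r : C) ^- k * (rC r) ^+ q = (rC r) ^+ l.+1.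
  have -> : q = (k + l.+1)%N by rewrite /q addnS.
  by rewrite exprD mulKf// expf_neq0.
split; first by rewrite mul1r E.
rewrite E exprMn WN -!exprM exprD mulnC [(N * _)%N]mulnC.
rewrite mul1r [((rC r) ^- k * _) ^+ b]exprMn exprVn -exprM.
move: (phi _) (f _ ^+ b) (g _ ^+ c) => x y w.
by field; rewrite expf_neq0.
Qed.

(** Either both logarithmic derivatives can be made arbitrarily small on the unit disc, which
    [no_constant_limit] excludes, or for some [d] one of them exceeds [d] in the unit disc of every
    large system. Point picking then gives rescalings in which both are at most 2 and one is at
    least 1 at the centre, against [no_exponential_limit]. *)
Lemma power_system_impossible : (forall A : R, 1 <= A -> exists f g phi b0,
    [/\ power_system N b c k l A f g phi,
     forall z, disc 0 A z -> cn (derive1 phi z / phi z) <= A^-1,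
     forall z, disc 0 A z -> 1 / 2 <= cn (phi z) &
     forall z, disc 0 A z -> derive1n k f z = g z + c0 * (z + b0) ^+ l]) -> False.
Proof.
move=> H; have [h2|] := pselect (forall d : R, 0 < d -> exists f g phi b0,
    [/\ power_system N b c k l 1 f g phi,
     forall z, disc 0 1 z -> cn (derive1 f z / f z) <= d /\ cn (derive1 g z / g z) <= d,
     forall z, disc 0 1 z -> 1 / 2 <= cn (phi z) &
     forall z, disc 0 1 z -> derive1n k f z = g z + c0 * (z + b0) ^+ l]).
  exact: no_constant_limit h2.
move=> /existsNP[d /not_implyP[d0 nd]]; apply: (no_exponential_limit bN cN Nbc) => j.
have j0 : 0 < j.+1%:R :> R by rewrite ltr0n.
pose r0 := 1 / d; have r00 : 0 < r0 by rewrite divr_gt0.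
(* Room for a starting point in the unit disc, for the search up to distance [4 (j + 1) r0], and for
   the final disc of radius [(j + 1) r] with [r <= r0]. Moreover [r / A <= 1 / (j + 1)], the bound
   required of [phi]. *)
pose A : R := 2 + 4 * j.+1%:R * r0.
have jr0 : 0 < j.+1%:R * r0 by rewrite mulr_gt0.
have A1 : 1 <= A by rewrite /A -mulrA; lra.
have [f [g [phi [b0 [sys phd phh rel]]]]] := H A A1.
have [fh gh ph n0 _] := sys.
have S1 := @disc_sub _ (0 : C) _ _ A1.
pose u z := derive1 f z / f z; pose v z := derive1 g z / g z.
have [z0 [z01 bad0]] : exists z0, disc 0 1 z0 /\ (d < cn (u z0) \/ d < cn (v z0)).
  apply: contrapT => nz; apply: nd; exists f, g, phi, b0; split.
  - exact: power_system_sub sys.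
  - move=> z z1; split; rewrite leNgt; apply/negP => hz; apply: nz; exists z;
      (split; first exact: z1); first [exact: (or_introl hz)|exact: (or_intror hz)].
  - by move=> z /S1 /phh.
  - by move=> z /S1 /rel.
pose bad (z : C) (r : R) := 1 <= r * cn (u z) \/ 1 <= r * cn (v z).
have oA := disc_open (a := 0 : C) (r := A).
have uh : hol (disc 0 A) u by apply: holM (dv_hol oA fh) (holV fh _) => z /n0[].
have vh : hol (disc 0 A) v by apply: holM (dv_hol oA gh) (holV gh _) => z /n0[].
have dr (t : R) : d < t -> 1 <= r0 * t.
  by move=> dt; rewrite /r0 mulrC mulrA mulr1 ler_pdivlMr// mul1r ltW.
have [||z [r [/andP[rp rr] zz0 zb zgood]]] := @doubling R bad z0 r0 j.+1%:R r00 j0.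
- by case: bad0 => /dr; [left|right].
- move=> z zz0; have zA : disc 0 A z.
    have := cn_tri z0 z 0; move: z01; rewrite /disc /= /A !subr0 -!mulrA.
    by move: zz0; rewrite -!mulrA; lra.
  have /cont_discP/(_ 1 ltr01)[d1 d10 hd1] := derivable_cont (uh z zA).
  have /cont_discP/(_ 1 ltr01)[d2 d20 hd2] := derivable_cont (vh z zA).
  pose M := cn (u z) + cn (v z) + 1.
  have M0 : 0 < M by rewrite ltr_wpDl ?addr_ge0 ?cn_ge0.
  exists (Num.min (1 / M) (Num.min d1 d2)); first by rewrite !lt_min divr_gt0// d10.
  move=> w r; rewrite !lt_min => /and3P[_ w1 w2] /andP[rp /and3P[rM _ _]].
  have uM : cn (u w) < M.
    have := cn_lb (u w) (u z); have := hd1 w w1; have := cn_ge0 (v z); rewrite /M; lra.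
  have vM : cn (v w) < M.
    have := cn_lb (v w) (v z); have := hd2 w w2; have := cn_ge0 (u z); rewrite /M; lra.
  rewrite ltr_pdivlMr// in rM.
  have lt1 (t : R) : t < M -> 1 <= r * t -> False.
    move=> tM; rewrite leNgt => /negP; apply; apply: lt_trans rM.
    by rewrite ltr_pM2l.
  by case; exact: lt1.
have sub xi : disc 0 j.+1%:R xi -> disc 0 A (z + rC r * xi).
  move=> /(scale_disc z rp) xr.
  have rj : r * j.+1%:R <= j.+1%:R * r0 by rewrite mulrC ler_wpM2l// ltW.
  have := cn_tri z (z + rC r * xi) 0; have := cn_tri z0 z 0.
  move: z01 zz0; rewrite /disc /= /A !subr0 -!mulrA; lra.
have rn0 : rC r != 0 :> C by rewrite -cn_gt0 cn_rC_pos.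
have s1 : (rC r : C) ^- k != 0 by rewrite invr_eq0 expf_neq0.
have s2 : (1 : C) != 0 by rewrite oner_eq0.
have s3 : (rC r : C) ^+ (l.+1 * N + k * b) != 0 by rewrite expf_neq0.
exists (fun xi => (rC r : C) ^- k * f (z + rC r * xi)), (fun xi => 1 * g (z + rC r * xi)),
  (fun xi => (rC r : C) ^+ (l.+1 * N + k * b) * phi (z + rC r * xi)).
have in0 : disc 0 j.+1%:R (0 : C) by exact: disc_center.
have zE : z + rC r * 0 = z by rewrite mulr0 addr0.
split.
- exact: power_system_scale sys.
- move=> xi xj; have xA := sub xi xj.
  rewrite (scale_dv_log rp fh xA s1) (scale_dv_log rp gh xA s2).
  have wz : cn (z + rC r * xi - z) < j.+1%:R * r by rewrite [X in _ < X]mulrC; exact (scale_disc z rp xj).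
  have r2 : 0 < r / 2 <= r / 2 by rewrite lexx divr_gt0.
  have nb := zgood _ (r / 2) wz r2.
  have le2 (t : R) : ~ (1 <= r / 2 * t) -> r * t <= 2.
    by move=> /negP; rewrite -ltNge => h; lra.
  by split; apply: le2 => h; apply: nb; [left|right].
- rewrite (scale_dv_log rp fh (sub 0 in0) s1) (scale_dv_log rp gh (sub 0 in0) s2) zE.
  exact: zb.
- rewrite (scale_dv_log rp ph (sub 0 in0) s3) zE.
  have zA : disc 0 A z by have := sub 0 in0; rewrite zE.
  apply: le_trans (ler_wpM2l (ltW rp) (phd z zA)) _.
  apply: le_trans (ler_wpM2r _ rr) _; first by rewrite invr_ge0; lra.
  have A0 : 0 < A by lra.
  rewrite ler_pdivrMr// mulrC ler_pdivlMr// mulrC.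
  by rewrite /A -mulrA; lra.
Qed.

End LargeSystems.

(** * Entire functions with a vanishing derivative *)

Section Entire.
Variable R : realType.
Local Notation C := R[i].
Local Notation hol := (@holomorphic R).
Implicit Types (f : C -> C) (a z w : C).

Lemma plane_disc f a (r : R) : hol setT f -> hol (disc a r) f.
Proof. exact: hol_sub. Qed.

Lemma const_plane f : hol setT f -> (forall z, derive1 f z = 0) -> forall a z, f z = f a.
Proof.
move=> fh f0 a z.
have H := @clopen_domain R setT (fun z => f z = f a) openT (@connected_plane R).
apply: H => //.
- move=> w _ wa; have [s s0 hs] := @dv0_cst R w 1 f ltr01 (plane_disc fh) (fun z _ => f0 z).
  by apply: (near_discI s0) => v /hs ->.
- move=> w _ hw; apply/eqP; rewrite -subr_eq0 -cn_eq0 eq_le cn_ge0 andbT.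
  apply/ler_addgt0Pl => e e0; rewrite addr0.
  have /cont_discP/(_ e e0)[d d0 hd] := derivable_cont (fh w I).
  by have [v /hd /ltW + va] := hw d d0; rewrite va cnC.
- by exists a.
Qed.

Lemma vanish_plane f a i : hol setT f -> (forall z, derive1n i f z = 0) ->
  (forall j, (j < i)%N -> derive1n j f a = 0) -> forall z, f z = 0.
Proof.
move=> fh; elim: i => [|i IH] f0 fa; first exact: f0.
apply: IH => [z|j ji]; last by apply: fa; exact: ltnW.
rewrite (const_plane (dvn_hol (i := i) openT fh) f0 a z).
exact: fa.
Qed.

(* A zero-free entire function that is not constant has, after rescaling, a nearly
   constant logarithmic derivative x with |x| >= 1, so its i-th derivative cannot
   vanish identically. *)
Lemma zero_free_const f i : hol setT f -> (forall z, f z != 0) ->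
  (forall z, derive1n i f z = 0) -> forall a z, f z = f a.
Proof.
move=> fh fn fi; apply: const_plane => // z0; apply: contrapT => /eqP d0.
pose u z := derive1 f z / f z.
have uh : hol setT u by exact: holM (dv_hol openT fh) (holV fh (fun z _ => fn z)).
have u0 : 0 < cn (u z0) by rewrite cn_gt0 mulf_neq0 ?invr_eq0.
pose bad (z : C) (r : R) := 1 <= r * cn (u z).
have [K K0 HK] := log_derivative R i.
(* Makes the error [K * 2 / A] less than 1, while the logarithmic derivative at the centre has
   modulus at least 1. *)
pose A := 2 * K + 1 + 1.
have A1 : 1 <= A by rewrite /A; lra.
have A0 : 0 < A by lra.
have r00 : 0 < 1 / cn (u z0) by rewrite divr_gt0.
have [||z [r [/andP[rp _] _ zb zgood]]] := @doubling R bad z0 (1 / cn (u z0)) A r00 A0.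
- by rewrite /bad divfK// gt_eqF.
- move=> z _; have /cont_discP/(_ 1 ltr01)[d d0' hd] := derivable_cont (uh z I).
  have M0 : 0 < cn (u z) + 1 by rewrite ltr_wpDl ?cn_ge0.
  exists (Num.min d (1 / (cn (u z) + 1))); first by rewrite lt_min d0' divr_gt0.
  move=> w r; rewrite !lt_min => /andP[wd _] /andP[rp /andP[_ rM]].
  rewrite /bad; apply/negP; rewrite -ltNge; rewrite ltr_pdivlMr// in rM.
  apply: lt_trans rM; rewrite ltr_pM2l//.
  by have := cn_lb (u w) (u z); have := hd w wd; lra.
pose g xi := 1 * f (z + rC r * xi).
have gh : hol (disc 0 A) g by exact: scale_hol fh (fun _ _ => I).
have g0 xi : disc 0 A xi -> g xi != 0 by rewrite mulf_neq0 ?oner_eq0.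
have gu xi : cn (derive1 g xi / g xi) = r * cn (u (z + rC r * xi)).
  exact: (scale_dv_log rp fh I (oner_neq0 _)).
have g2 xi : disc 0 A xi -> cn (derive1 g xi / g xi) <= 2.
  move=> /(scale_disc z rp) xr; rewrite gu.
  have r2 : 0 < r / 2 <= r / 2 by rewrite lexx divr_gt0.
  rewrite [X in _ < X]mulrC in xr; have /negP := zgood _ (r / 2) xr r2.
  by rewrite -ltNge => h; lra.
have k2 : 0 <= (2 : R) <= 2 by rewrite lexx ler0n.
have in0 : disc 0 (A / 2 ^+ i) (0 : C) by apply: disc_center; rewrite divr_gt0 ?pow2_gt0.
have := HK 0 A 2 g A1 k2 gh g0 g2 0 in0.
rewrite (scale_dvn 1 i openT fh (I : setT (z + rC r * 0))) fi mulr0 mul0r sub0r cnN cnX gu.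
rewrite mulr0 addr0 => h.
have : 1 <= (r * cn (u z)) ^+ i by apply: exprn_ege1.
move=> /le_trans/(_ h); rewrite ler_pdivlMr// /A; lra.
Qed.

End Entire.

(** * Rigidity in the plane *)

(** The inequality holds at [e = n], and each further unit of [e] adds [N] on the left and [b + c]
    on the right. It makes Phi vanish at a pole of order [e], where the numerator has a pole of
    order [N (e + q)] and the denominator one of order [b e + c (e + k)]. *)
Lemma pole_arith N b c n k q e : (N * (n + q) < b * n + c * (n + k))%N -> (N < b + c)%N ->
  (n <= e)%N -> (N * (e + q) < b * e + c * (e + k))%N.
Proof.
move=> h1 h2 /subnKC <-; move: (e - n)%N => d.
have : (N * d <= (b + c) * d)%N by rewrite leq_mul2r ltnW ?orbT.
lia.
Qed.

(** The same linear extrapolation, now with slopes [b <= N]. It serves zeros of F as it stands, and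
    zeros of R with [c], [m], [l + 1] in place of [b], [n], [q]. *)
Lemma zero_arith N b n q e : (N * q + b * n < N * n)%N -> (b <= N)%N ->
  (n <= e)%N -> (b * e < N * (e - q))%N.
Proof.
move=> h1 h2 /subnKC <-; move: (e - n)%N => d.
have : (b * d <= N * d)%N by rewrite leq_mul2r h2 orbT.
by rewrite mulnBr ltn_subRL; lia.
Qed.

Lemma low_bound (R : realType) (x y d e : R) :
  1 <= x -> x - y <= d -> d <= e -> e <= 1 / 8 -> 7 / 8 <= y.
Proof. by move=> *; lra. Qed.

Section PlaneTheorem.
Variable R : realType.
Local Notation C := R[i].
Local Notation hol := (@holomorphic R).
Implicit Types (z w a : C) (r s : R).

Lemma nonzero_disc (h : C -> C) a r : 0 < r -> hol (disc a r) h -> h a != 0 ->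
  exists2 s, 0 < s <= r & forall z, disc a s z -> h z != 0.
Proof.
move=> r0 hh ha; have ca := derivable_cont (hh a (disc_center a r0)).
have h0 : 0 < cn (h a) by rewrite cn_gt0.
have /cont_discP/(_ _ h0)[d d0 hd] := ca.
exists (Num.min d r) => [|z]; first by rewrite lt_min d0 r0 ge_min lexx orbT.
rewrite /disc /= lt_min => /andP[/hd zd _]; apply/eqP => hz.
by rewrite hz sub0r cnN ltxx in zd.
Qed.

Lemma disc_punctured a r : 0 < r -> exists2 z : C, disc a r z & z != a.
Proof.
move=> r0; exists (a + rC (r / 2)).
  by rewrite /disc /= addrC addKr cn_rC_pos ?divr_gt0//; lra.
by rewrite -subr_eq0 addrC addKr -cn_gt0 cn_rC_pos divr_gt0.
Qed.

Variables (n m k l N b c : nat) (c0 : C) (F : C -> sphere R).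
Let q := (k + l).+1.
(** The value 0 at poles is a mere default; [Rr] and [W] are meaningful only where [F] is finite. *)
Let G z : C := odflt 0 (F z).
Let Rr z : C := derive1n k G z - c0 * z ^+ l.
Let W z : C := derive1n q G z.

Hypotheses (c00 : c0 != 0) (k0 : (0 < k)%N) (qn : (q <= n)%N) (lm : (l < m)%N).
Hypotheses (bN : (b < N)%N) (cN : (c < N)%N) (Nbc : (N < b + c)%N).
Hypotheses (H1 : (N * q + b * n < N * n)%N) (H2 : (N * l.+1 + c * m < N * m)%N)
  (H3 : (N * (n + q) < b * n + c * (n + k))%N).
Hypothesis mF : meromorphic setT F.
Hypothesis zF : forall a, F a = Some 0 -> forall i, (i < n)%N -> derive1n i G a = 0.
Hypothesis pF : forall a j, pole_of_order F a j -> (n <= j)%N.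
Hypothesis zR : forall a, F a <> None -> Rr a = 0 ->
  forall i, (i < m)%N -> derive1n i Rr a = 0.
(** This separates the zeros of [F] from those of [Rr]: at a zero of [F] the [k]-th derivative
    vanishes, so [Rr] equals [- c0 z^l] there, which is zero only at the origin and for [0 < l]. *)
Hypothesis F0 : (0 < l)%N -> F 0 <> Some 0.

Let reg a : F a <> None -> exists r, [/\ 0 < r, forall z, disc a r z -> F z = Some (G z) &
  hol (disc a r) G].
Proof.
move=> Fa; have [[g gh Fg]|[j [FN _ _]]] := mF (I : setT a); last by rewrite FN in Fa.
have [r r0 hr] := near_discE Fg; have [s s0 hs] := near_discE gh.
exists (Num.min r s); split; first by rewrite lt_min r0.
  by move=> z; rewrite /disc /= lt_min => /andP[/hr E _]; rewrite /G E.
have mr : Num.min r s <= r by rewrite ge_min lexx.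
have ms : Num.min r s <= s by rewrite ge_min lexx orbT.
apply: (hol_near_ext (f := g)); first by move=> z /(disc_sub ms) /hs.
by move=> z /(disc_sub mr) /hr E; rewrite /G E.
Qed.

Let pol a : F a = None -> exists r e h, [/\ 0 < r, (n <= e)%N, hol (disc a r) h, h a != 0 &
  forall z, disc a r z -> z != a -> F z = Some (h z / (z - a) ^+ e)].
Proof.
move=> Fa; have [[g _ /nbhs_singleton]|[e pe]] := mF (I : setT a); first by rewrite Fa.
have ne := pF pe; have [_ _ [h [hh ha Fh]]] := pe.
have [r r0 hr] := near_discE hh.
have /near_discE[s s0 hs] : \forall z \near a, z != a -> F z = Some (h z / (z - a) ^+ e).
  exact: Fh.
exists (Num.min r s), e, h; split; [by rewrite lt_min r0|exact: ne| |exact: ha|].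
  by move=> z; rewrite /disc /= lt_min => /andP[/hr].
by move=> z; rewrite /disc /= lt_min => /andP[_ /hs].
Qed.

Let mono_hol (V : set C) : hol V (fun z => c0 * z ^+ l).
Proof.
by move=> z _; exact: hasd_derivable (hasdZ c0 (hasdX l (hasd_id z))).
Qed.

Let Rr_hol (V : set C) : open V -> hol V G -> hol V Rr.
Proof. by move=> oV GV; exact: holB (dvn_hol (i := k) oV GV) (mono_hol (V := V)). Qed.

Let dv_Rr (V : set C) : open V -> hol V G -> forall z, V z -> derive1n l.+1 Rr z = W z.
Proof.
move=> oV GV z Vz.
have mh : hol V (fun z => - c0 * (z + 0) ^+ l) by exact: hol_monomial.
have E : Rr = (fun z => derive1n k G z + - c0 * (z + 0) ^+ l).
  by apply/funext => w; rewrite /Rr addr0 mulNr.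
rewrite E (dvnD l.+1 oV (dvn_hol (i := k) oV GV) mh Vz) dvn_monomial0 addr0.
by rewrite /W /q addnC -addSn /derive1n iterD.
Qed.

Let W_hol (V : set C) : open V -> hol V G -> hol V W.
Proof. by move=> oV GV; exact: dvn_hol. Qed.

(** At a pole of order [e], [W] is [p / (z - a)^(e + q)] with [p a] nonzero; at a regular point a
    [W] that does not vanish nearby has an isolated zero at most. So discs of zeros can accumulate
    only at points that have such a disc themselves. *)
Let W_ident : (exists a, exists2 r, 0 < r & forall z, disc a r z -> F z <> None /\ W z = 0) ->
  forall a, F a <> None /\ W a = 0.
Proof.
move=> [a0 ha0].
pose P a := exists2 r, 0 < r & forall z, disc a r z -> F z <> None /\ W z = 0.
suff PT a : setT a -> P a by move=> a; have [r r0 hr] := PT a I; exact/hr/disc_center.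
apply: (@clopen_domain R setT P openT (@connected_plane R)) => {a}.
- move=> a _ [r r0 hr]; apply: (near_discI r0) => z zr; exists (r - cn (z - a)).
    by rewrite subr_gt0.
  by move=> w wz; apply: hr; apply: (disc_in _ wz); rewrite subrKC.
- move=> a _ acc.
  have punct s : 0 < s -> exists z, [/\ disc a s z, z != a, F z <> None & W z = 0].
    move=> s0; have [z zs [r r0 hr]] := acc s s0.
    have [w wr wa] : exists2 w, disc z (Num.min r (s - cn (z - a))) w & w != a.
      have m0 : 0 < Num.min r (s - cn (z - a)) by rewrite lt_min r0 subr_gt0.
      have [za|za] := eqVneq z a; last by exists z => //; exact: disc_center.
      by have [w ? wz] := disc_punctured z m0; exists w; rewrite // -za.
    have mr : Num.min r (s - cn (z - a)) <= r by rewrite ge_min lexx.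
    have [Fw Ww] := hr w (disc_sub mr wr); exists w; split => //.
    apply: (disc_in _ wr); rewrite -lerBrDl ge_min lexx orbT //.
  have [Fa|/eqP Fa] := eqVneq (F a) None.
    have [r [e [h [r0 ne hh ha hF]]]] := pol Fa.
    have e0 : (0 < e)%N by apply: leq_trans ne; apply: leq_trans qn.
    have hG z : disc a r z -> z != a -> G z = h z / (z - a) ^+ e.
      by move=> zr za; rewrite /G hF.
    have [p [ph pa pE]] := pole_dvn q e0 hh ha hG.
    have [s /andP[s0 sr] ps] := nonzero_disc r0 ph pa.
    have [z [zs za _]] := punct s s0; rewrite /W pE//; last exact: disc_sub zs.
    move=> /eqP; rewrite mulf_eq0 (negbTE (ps z zs)) /= invr_eq0.
    by rewrite expf_eq0 subr_eq0 (negbTE za) andbF.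
  have [r [r0 hF GV]] := reg Fa.
  have [[s s0 hs]|[j [p [ph pa pE]]]] := hol_order r0 (W_hol (disc_open (a := a) (r := r)) GV).
    exists (Num.min r s); first by rewrite lt_min r0.
    by move=> z; rewrite /disc /= lt_min => /andP[/hF -> /hs].
  have [s /andP[s0 sr] ps] := nonzero_disc r0 ph pa.
  have [z [zs za _ /eqP]] := punct s s0.
  rewrite pE mulf_eq0 (negbTE (ps z zs)) orbF expf_eq0 subr_eq0.
  by rewrite (negbTE za) andbF.
- by exists a0.
Qed.

(** Now [F] is entire with vanishing [q]-th derivative. At a zero its order is at least [n >= q], so
    [F] is 0; without zeros it is constant by [zero_free_const]. Then [Rr] is [- c0 z^l], and for
    [0 < l] its zero of order [l < m] at the origin contradicts [zR]. *)
Let W_zero_case : (forall a, F a <> None /\ W a = 0) ->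
  l = 0%N /\ exists v, forall z, F z = Some v.
Proof.
move=> WF.
have FG z : F z = Some (G z) by rewrite /G; case: (F z) (WF z).1.
have GV : hol setT G.
  by move=> z _; have [r [r0 _ Gr]] := reg (WF z).1; exact/Gr/disc_center.
have Gc : forall z, G z = G 0.
  have [[a Ga]|nz] := pselect (exists a, G a = 0).
    have Z := vanish_plane (a := a) (i := q) GV (fun z => (WF z).2).
    have Gz : forall z, G z = 0.
      by apply: Z => j jq; apply: zF; [rewrite FG Ga|exact: leq_trans qn].
    by move=> z; rewrite !Gz.
  have gn z : G z != 0 by apply/eqP => Gz; apply: nz; exists z.
  exact: zero_free_const GV gn (fun z => (WF z).2) 0.
split; last by exists (G 0) => z; rewrite FG Gc.
apply/eqP; rewrite -leqn0 leqNgt; apply/negP => l0.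
have dk z : derive1n k G z = 0.
  case: (k) k0 => // k' _; rewrite derive1Sn.
  rewrite (@derive1n_near _ (derive1 G) (fun=> 0)) ?dvn_0//.
  apply: (near_discI ltr01) => w _.
  have GE : G = (fun=> G 0) by apply/funext => v; exact: Gc.
  by rewrite GE; exact: hasdE (hasd_cst _ _).
have RE : Rr = (fun z => (z - 0) ^+ (0 + l) * - c0).
  by apply/funext => z; rewrite /Rr dk sub0r add0n subr0 mulrN mulrC.
have R0 : Rr 0 = 0 by rewrite RE subr0 expr0n add0n eqn0Ngt l0 mul0r.
have := zR (WF 0).1 R0 lm.
have [|p [_ pa pE]] := @dvn_pow R 0 1 Rr (fun=> - c0) 0 l (hol_cst (c := - c0)).
  by move=> z _; rewrite RE.
rewrite pE ?subr0 ?expr0 ?mul1r; last exact: disc_center.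
by move=> p0; have := pa _; rewrite p0 eqxx oppr_eq0 => /(_ c00).
Qed.

Definition good z := [/\ F z <> None, G z != 0 & Rr z != 0].
(* W = F^(q) = Rr^(l+1), so zeros of F and of Rr force zeros of W of order lower
   by q and by l + 1 only. *)
Let Psi z : C := W z ^+ N / (G z ^+ b * Rr z ^+ c).
Let Phi z : C := if pselect (good z) then Psi z else 0.

(* Near every point Phi is (z - a)^sigma times a unit times a power of a
   holomorphic function, with sigma > 0 unless F and Rr are finite and nonzero. *)
Let Phi_local a : ~ (exists2 r, 0 < r & forall z, disc a r z -> F z <> None /\ W z = 0) ->
  exists s g, [/\ 0 < s, hol (disc a s) g, forall z, disc a s z -> z != a -> good z &
    forall z, disc a s z -> Phi z = g z].
Proof.
move=> nW.
have finish s (sg : nat) (w h p : C -> C) : 0 < s -> hol (disc a s) w -> hol (disc a s) h ->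
    hol (disc a s) p -> (forall z, disc a s z -> h z != 0) ->
    (forall z, disc a s z -> p z != 0) ->
    (forall z, disc a s z -> z != a -> good z) ->
    (forall z, disc a s z -> good z -> Psi z = (z - a) ^+ sg * (w z ^+ N / (h z ^+ b * p z ^+ c))) ->
    (~ good a -> (0 < sg)%N) ->
    exists s g, [/\ 0 < s, hol (disc a s) g, forall z, disc a s z -> z != a -> good z &
      forall z, disc a s z -> Phi z = g z].
  move=> s0 wh hh ph h0 p0 gd PsiE sg0.
  exists s, (fun z => (z - a) ^+ sg * (w z ^+ N / (h z ^+ b * p z ^+ c))).
  split; [exact: s0| |exact: gd|].
    apply: holM; first exact: holX (hol_lin1 (a := a)).
    apply: holM; first exact: holX wh.
    apply: holV; first exact: holM (holX (n := b) hh) (holX (n := c) ph).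
    by move=> z zs; rewrite mulf_neq0 ?expf_neq0 ?h0 ?p0.
  move=> z zs; rewrite /Phi; case: pselect => gz; first exact: PsiE.
  have [za|za] := eqVneq z a; last by case: gz; exact: gd.
  by rewrite za in gz *; rewrite subrr expr0n eqn0Ngt sg0 // mul0r.
have [Fa|/eqP Fa] := eqVneq (F a) None.
  have [r [e [h [r0 ne hh ha hF]]]] := pol Fa.
  have e0 : (0 < e)%N by apply: leq_trans ne; apply: leq_trans qn.
  have hG z : disc a r z -> z != a -> G z = h z / (z - a) ^+ e.
    by move=> zr za; rewrite /G hF.
  have [w [wh wa wE]] := pole_dvn q e0 hh ha hG.
  have [p [ph pa pE]] := pole_dvn k e0 hh ha hG.
  (* Numerator of [Rr] at the pole: the monomial acquires a factor vanishing at [a], so [p1 a = p a]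
     and [Rr] has a pole of exact order [e + k]. *)
  pose p1 z := p z - c0 * z ^+ l * (z - a) ^+ (e + k).
  have p1h : hol (disc a r) p1.
    exact: holB ph (holM (mono_hol (V := _)) (holX (n := e + k) (hol_lin1 (a := a)))).
  have p1a : p1 a != 0.
    by rewrite /p1 subrr expr0n addn_eq0 eqn0Ngt e0 mulr0 subr0.
  have [s1 /andP[s10 s1r] hn] := nonzero_disc r0 hh ha.
  have [s2 /andP[s20 s2r] pn] := nonzero_disc r0 p1h p1a.
  pose s := Num.min s1 s2; have s0 : 0 < s by rewrite lt_min s10.
  have ss1 : s <= s1 by rewrite ge_min lexx.
  have ss2 : s <= s2 by rewrite ge_min lexx orbT.
  have S1 := disc_sub (a := a) ss1; have S2 := disc_sub (a := a) ss2.
  have Sr := disc_sub (a := a) (le_trans ss1 s1r).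
  have RE z : disc a s z -> z != a -> Rr z = p1 z / (z - a) ^+ (e + k).
    move=> zs za; have za0 : z - a != 0 by rewrite subr_eq0.
    by rewrite /Rr /p1 (pE z (Sr z zs) za) mulrBl mulfK// expf_neq0.
  have gd z : disc a s z -> z != a -> good z.
    move=> zs za; have za0 : z - a != 0 by rewrite subr_eq0.
    have hz := hn z (S1 z zs); have pz := pn z (S2 z zs).
    split; first by rewrite (hF z (Sr z zs) za).
      by rewrite (hG z (Sr z zs) za) mulf_neq0 ?invr_eq0 ?expf_neq0.
    by rewrite (RE z zs za) mulf_neq0 ?invr_eq0 ?expf_neq0.
  pose sg := (b * e + c * (e + k) - N * (e + q))%N.
  have ar := pole_arith H3 Nbc ne.
  have sgE : (b * e + c * (e + k) = sg + N * (e + q))%N by rewrite /sg subnK// ltnW.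
  have sg0 : (0 < sg)%N by rewrite /sg subn_gt0.
  apply: (finish s sg w h p1 s0 (hol_sub Sr wh) (hol_sub Sr hh) (hol_sub Sr p1h) _ _ gd) => //.
  - by move=> z /S1 /hn.
  - by move=> z /S2 /pn.
  - move=> z zs [Fz _ _]; have za : z != a by apply/eqP => za; rewrite za in Fz.
    have za0 : z - a != 0 by rewrite subr_eq0.
    rewrite /Psi /W (wE z (Sr z zs) za) (hG z (Sr z zs) za) (RE z zs za).
    rewrite !expr_div_n -!exprM.
    have -> : (z - a) ^+ sg = (z - a) ^+ (e * b) * (z - a) ^+ ((e + k) * c) / (z - a) ^+ ((e + q) * N).
      apply: (mulIf (expf_neq0 ((e + q) * N) za0)); rewrite divfK ?expf_neq0// -!exprD.
      by congr (_ ^+ _); rewrite [(e * b)%N]mulnC [((e + k) * c)%N]mulnC [(_ * N)%N]mulnC.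
    have hz := hn z (S1 z zs); have pz := pn z (S2 z zs).
    by field; rewrite !expf_neq0.
have [r [r0 hF GV]] := reg Fa.
have or := disc_open (a := a) (r := r).
have Wnz : ~ exists2 s, 0 < s & forall z, disc a s z -> W z = 0.
  move=> [s s0 hs]; apply: nW; exists (Num.min r s); first by rewrite lt_min r0.
  by move=> z; rewrite /disc /= lt_min => /andP[/hF -> /hs].
have near0 (f : C -> C) i s : 0 < s -> (forall z, disc a s z -> f z = 0) ->
    forall z, disc a s z -> derive1n i f z = 0.
  move=> s0 fs z zs; rewrite (@derive1n_near _ f (fun=> 0)) ?dvn_0//.
  by apply: filterS (disc_nbhs zs).
have [[s s0 Gs]|[e [h [hh ha hE]]]] := hol_order r0 GV.
  by case: Wnz; exists s => //; exact: near0.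
have [[s s0 Rs]|[mu [p [ph pa pE]]]] := hol_order r0 (Rr_hol or GV).
  case: Wnz; exists (Num.min r s); first by rewrite lt_min r0.
  move=> z zs; have zr : disc a r z.
    by move: zs; rewrite /disc /= lt_min => /andP[].
  have zs' : disc a s z by move: zs; rewrite /disc /= lt_min => /andP[].
  by rewrite -(dv_Rr or GV zr) (near0 _ _ s).
have en : (0 < e)%N -> (n <= e)%N.
  move=> e0; rewrite leqNgt; apply/negP => en.
  have Ga : G a = 0 by rewrite hE subrr expr0n eqn0Ngt e0 mul0r.
  have Fa0 : F a = Some 0 by rewrite hF ?Ga//; exact: disc_center.
  have [|u [_ ua uE]] := @dvn_pow R a r G h 0 e hh; first by move=> z _; rewrite hE.
  have := zF Fa0 en; rewrite uE; last exact: disc_center.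
  by rewrite expr0 mul1r => u0; have := ua ha; rewrite u0 eqxx.
have mun : (0 < mu)%N -> (m <= mu)%N.
  move=> mu0; rewrite leqNgt; apply/negP => mum.
  have Ra : Rr a = 0 by rewrite pE subrr expr0n eqn0Ngt mu0 mul0r.
  have [|u [_ ua uE]] := @dvn_pow R a r Rr p 0 mu ph; first by move=> z _; rewrite pE.
  have := zR Fa Ra mum; rewrite uE; last exact: disc_center.
  by rewrite expr0 mul1r => u0; have := ua pa; rewrite u0 eqxx.
(* At a common zero the [k]-th derivative of [G] vanishes because [k < n], so [c0 a^l = 0]; this
   forces [a = 0] and [0 < l], against [F0]. *)
have emu : e = 0%N \/ mu = 0%N.
  have [->|e0] := posnP e; [by left|right].
  apply/eqP; rewrite -leqn0 leqNgt; apply/negP => mu0.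
  have Ga : G a = 0 by rewrite hE subrr expr0n eqn0Ngt e0 mul0r.
  have Fa0 : F a = Some 0 by rewrite hF ?Ga//; exact: disc_center.
  have Ra : Rr a = 0 by rewrite pE subrr expr0n eqn0Ngt mu0 mul0r.
  have kn : (k < n)%N by apply: leq_trans qn; rewrite /q ltnS leq_addr.
  move: Ra; rewrite /Rr (zF Fa0 kn) sub0r => /eqP; rewrite oppr_eq0 mulf_eq0 (negbTE c00) /=.
  by rewrite expf_eq0 => /andP[l0 /eqP a0]; rewrite a0 in Fa0; exact: F0 l0 Fa0.
(* Only a lower bound [t] for the order of [W] is claimed: [w] may vanish at [a], which is harmless
   since [W] stands in the numerator of [Psi]. *)
have [t [w [wh wE sgp]]] : exists (t : nat) (w : C -> C), [/\ hol (disc a r) w,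
    forall z, disc a r z -> W z = (z - a) ^+ t * w z &
    (b * e + c * mu <= N * t)%N /\ ((0 < e)%N \/ (0 < mu)%N -> (b * e + c * mu < N * t)%N)].
  have [e0|e0] := posnP e.
    have [mu0|mu0] := posnP mu.
      exists 0%N, W; split; first exact: W_hol.
        by move=> z _; rewrite expr0 mul1r.
      by rewrite e0 mu0 !muln0; split => // -[].
    have mm := mun mu0; have lmu : (l.+1 <= mu)%N by apply: leq_trans mm.
    have [|u [uh _ uE]] := @dvn_pow R a r Rr p (mu - l.+1) l.+1 ph.
      by move=> z _; rewrite pE subnK.
    exists (mu - l.+1)%N, u; split; first exact: uh.
      by move=> z zr; rewrite -(dv_Rr or GV zr) uE.
    have X : (b * e + c * mu < N * (mu - l.+1))%N.
      by rewrite e0 muln0; exact: zero_arith H2 (ltnW cN) mm.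
    by split => [|_]; [exact: ltnW|exact: X].
  have mu0 : mu = 0%N by case: emu => // e00; rewrite e00 in e0.
  have nn := en e0; have qe : (q <= e)%N by apply: leq_trans nn.
  have [|u [uh _ uE]] := @dvn_pow R a r G h (e - q) q hh.
    by move=> z _; rewrite hE subnK.
  exists (e - q)%N, u; split; [exact: uh|exact: uE|].
  have X : (b * e + c * mu < N * (e - q))%N.
    by rewrite mu0 muln0 addn0; exact: zero_arith H1 (ltnW bN) nn.
  by split => [|_]; [exact: ltnW|exact: X].
have [s1 /andP[s10 s1r] hn] := nonzero_disc r0 hh ha.
have [s2 /andP[s20 s2r] pn] := nonzero_disc r0 ph pa.
pose s := Num.min s1 s2; have s0 : 0 < s by rewrite lt_min s10.
have ss1 : s <= s1 by rewrite ge_min lexx.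
have ss2 : s <= s2 by rewrite ge_min lexx orbT.
have S1 := disc_sub (a := a) ss1; have S2 := disc_sub (a := a) ss2.
have Sr := disc_sub (a := a) (le_trans ss1 s1r).
have gd z : disc a s z -> z != a -> good z.
  move=> zs za; have za0 : z - a != 0 by rewrite subr_eq0.
  have hz := hn z (S1 z zs); have pz := pn z (S2 z zs).
  split; first by rewrite (hF z (Sr z zs)).
    by rewrite hE mulf_neq0 ?expf_neq0.
  by rewrite pE mulf_neq0 ?expf_neq0.
pose sg := (N * t - (b * e + c * mu))%N.
have sgE : (N * t = sg + (b * e + c * mu))%N by rewrite /sg subnK// sgp.1.
apply: (finish s sg w h p s0 (hol_sub Sr wh) (hol_sub Sr hh) (hol_sub Sr ph) _ _ gd).
- by move=> z /S1 /hn.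
- by move=> z /S2 /pn.
- move=> z zs [_ Gz Rz]; rewrite /Psi (wE z (Sr z zs)).
  have hz := hn z (S1 z zs); have pz := pn z (S2 z zs).
  have Ge : (z - a) ^+ (e * b) != 0.
    by move: Gz; rewrite hE mulf_eq0 negb_or => /andP[u _]; rewrite exprM expf_neq0.
  have Rmu : (z - a) ^+ (mu * c) != 0.
    by move: Rz; rewrite pE mulf_eq0 negb_or => /andP[u _]; rewrite exprM expf_neq0.
  rewrite hE pE !exprMn -!exprM.
  have -> : (z - a) ^+ (t * N) = (z - a) ^+ sg * ((z - a) ^+ (e * b) * (z - a) ^+ (mu * c)).
    by rewrite -!exprD; congr (_ ^+ _); rewrite mulnC sgE [(e * b)%N]mulnC [(mu * c)%N]mulnC.
  have hb : h z ^+ b != 0 by rewrite expf_neq0.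
  have pc : p z ^+ c != 0 by rewrite expf_neq0.
  move: Ge Rmu hb pc; move: (_ ^+ (e * b)) (_ ^+ (mu * c)) (h z ^+ b) (p z ^+ c).
  by move=> x1 x2 x3 x4 n1 n2 n3 n4; field; rewrite n1 n2 n3 n4.
- move=> ng; rewrite /sg subn_gt0; apply: sgp.2.
  have [e0|] := posnP e; last by left.
  have [mu0|] := posnP mu; last by right.
  case: ng; split => //.
    by rewrite hE e0 expr0 mul1r.
  by rewrite pE mu0 expr0 mul1r.
Qed.

Theorem plane_rigidity : l = 0%N /\ exists v, forall z, F z = Some v.
Proof.
have [hW|nW] := pselect (exists a, exists2 r, 0 < r &
  forall z, disc a r z -> F z <> None /\ W z = 0); first exact/W_zero_case/W_ident.
have PL a := Phi_local (fun h => nW (ex_intro _ a h)).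
have Phol : hol setT Phi.
  move=> a _; have [s [g [s0 gh _ Pg]]] := PL a.
  apply: (derivable_near (f := g)); last exact/gh/disc_center.
  by apply: (near_discI s0) => z /Pg.
have goodP z : Phi z != 0 -> good z.
  by rewrite /Phi; case: pselect => [gz _|_ /eqP].
have [z0 Pz0] : exists z0, Phi z0 != 0.
  apply: contrapT => nz; have [s [g [s0 gh gd Pg]]] := PL 0.
  have [z1 z1s z10] := disc_punctured (0 : C) s0.
  have m0 : 0 < Num.min (s - cn (z1 - 0)) (cn z1).
    by rewrite lt_min subr_gt0 cn_gt0 z10 andbT.
  apply: nW; exists z1, (Num.min (s - cn (z1 - 0)) (cn z1)) => // z zm.
  have zs : disc 0 s z.
    by apply: (disc_in _ zm); rewrite -lerBrDl ge_min lexx.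
  have zn : z != 0.
    apply/eqP => zE; move: zm; rewrite zE /disc /= sub0r cnN lt_min ltxx andbF //.
  have gz := gd z zs zn; have [Fz Gz Rz] := gz; split=> //.
  have : Phi z = 0 by apply: contrapT => /eqP h; apply: nz; exists z.
  rewrite /Phi; case: pselect => // _ /eqP.
  rewrite mulf_eq0 invr_eq0 mulf_eq0 !expf_eq0 (negbTE Gz) (negbTE Rz) !andbF !orbF.
  by move=> /andP[_ /eqP].
pose V : set C := [set z | Phi z != 0].
have oV : open V.
  rewrite openE => z Vz; have p0 : 0 < cn (Phi z) by rewrite cn_gt0.
  have /cont_discP/(_ _ p0)[d d0 hd] := derivable_cont (Phol z I).
  apply: (near_discI d0) => w /hd h; apply/eqP => Pw.
  by rewrite Pw sub0r cnN ltxx in h.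
have GV : hol V G.
  move=> z /goodP[Fz _ _]; have [r [r0 _ Gr]] := reg Fz.
  exact/Gr/disc_center.
have RV := Rr_hol oV GV.
(* The weight of [Phi]: [F] is scaled by [r^-(l + k)] and [Rr] by [r^-l], so that the monomial keeps
   the coefficient [c0]. Both derivatives in the system then become [r W], and the power relation
   holds with [r^om Phi]. *)
pose om := (N + ((l + k) * b + l * c))%N.
have om1 : (0 < om)%N by rewrite /om ltn_addr// (leq_ltn_trans _ bN).
exfalso; apply: (power_system_impossible (k := k) (l := l) bN cN Nbc c00) => A A1.
have [K KE K1] : exists2 K : R, 2 ^+ om = K & 1 <= K.
  by exists (2 ^+ om) => //; rewrite exprn_ege1// ler1n.
have A0 : 0 < A by lra.
have K0 : 0 < K by lra.
(* On the disc of radius [B] one has [|phi| <= K]. By [hol_lip], [phi] varies by at most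
   [256 K A / B = 1 / 8] on the disc of radius [A], and by [cauchy_est] its derivative is at most
   [1 / (16 A)] there. *)
pose B := 2048 * K * A.
have KA : A <= K * A by rewrite ler_peMl// ltW.
have B0 : 0 < B by rewrite /B -mulrA; lra.
have AB : 2048 * A <= B by rewrite /B -mulrA; lra.
pose bad (z : C) (r : R) := 1 <= r ^+ om * cn (Phi z).
pose r0 := Num.max 1 (1 / cn (Phi z0)).
have r01 : 1 <= r0 by rewrite le_max lexx.
have r00 : 0 < r0 by lra.
have P0 : 0 < cn (Phi z0) by rewrite cn_gt0.
have [||z [r [/andP[rp _] _ zb zgood]]] := @doubling R bad z0 r0 B r00 B0.
- rewrite /bad -ler_pdivrMr//; apply: (@le_trans _ _ r0); first by rewrite le_max lexx orbT.
  by rewrite -{1}[r0]expr1; apply: ler_weXn2l.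
- move=> z _; have /cont_discP/(_ 1 ltr01)[d d0 hd] := derivable_cont (Phol z I).
  have M0 : 0 < cn (Phi z) + 1 by rewrite ltr_wpDl ?cn_ge0.
  exists (Num.min d (Num.min 1 (1 / (cn (Phi z) + 1)))).
    by rewrite !lt_min d0 ltr01 divr_gt0.
  move=> w r; rewrite !lt_min => /andP[wd _] /andP[rp /and3P[_ r1 rM]].
  rewrite /bad; apply/negP; rewrite -ltNge; rewrite ltr_pdivlMr// in rM.
  apply: le_lt_trans rM; apply: ler_pM; rewrite ?exprn_ge0 ?cn_ge0 ?(ltW rp)//.
    by rewrite -{2}[r]expr1; apply: ler_wiXn2l => //; exact: ltW.
  by rewrite -lerBlDl; exact: le_trans (cn_lb _ _) (ltW (hd w wd)).
have rn0 : rC r != 0 :> C by rewrite -cn_gt0 cn_rC_pos.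
pose phi xi := (rC r : C) ^+ om * Phi (z + rC r * xi).
have cphi xi : cn (phi xi) = r ^+ om * cn (Phi (z + rC r * xi)).
  by rewrite /phi cnM cnX cn_rC_pos.
have phih : hol (disc 0 B) phi by exact: scale_hol Phol (fun _ _ => I).
have phiK xi : disc 0 B xi -> cn (phi xi) <= K.
  move=> /(scale_disc z rp); rewrite [X in _ < X]mulrC => xr.
  have r2 : 0 < r / 2 <= r / 2 by rewrite lexx divr_gt0.
  have /negP := zgood _ (r / 2) xr r2.
  rewrite -ltNge expr_div_n KE mulrAC ltr_pdivrMr// mul1r cphi; exact: ltW.
have phi1 : 1 <= cn (phi 0) by rewrite cphi mulr0 addr0.
have phih2 xi : disc 0 A xi -> 7 / 8 <= cn (phi xi).
  rewrite /disc /= subr0 => xA.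
  have B8 : cn (xi - 0) <= B / 8 by rewrite subr0; lra.
  have B80 : cn ((0 : C) - 0) <= B / 8 by rewrite subr0 cn0; lra.
  have := hol_lip B0 phih phiK B80 B8; rewrite sub0r cnN.
  have h : 256 * K / B * cn xi <= 1 / 8.
    rewrite mulrAC ler_pdivrMr// /B.
    by have : K * cn xi <= K * A; [rewrite ler_wpM2l ?ltW|lra].
  by move=> h1; exact: low_bound phi1 (cn_lb _ _) h1 h.
(* As [Phi] is nonzero only at [good] points, the lower bound on [phi] keeps the rescaled disc away
   from the poles of [F] and from the zeros of [F] and [Rr]. *)
have inV xi : disc 0 A xi -> V (z + rC r * xi).
  move=> /phih2 h; apply/eqP => P00.
  by move: h; rewrite cphi P00 cn0 mulr0; lra.
pose s1 : C := (rC r) ^- (l + k); pose s2 : C := (rC r) ^- l.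
have s10 : s1 != 0 by rewrite invr_eq0 expf_neq0.
have s20 : s2 != 0 by rewrite invr_eq0 expf_neq0.
have PsiE w : V w -> W w ^+ N = Phi w * (G w ^+ b * Rr w ^+ c).
  move=> Vw; have gw := goodP w Vw; have [_ Gw Rw] := gw.
  by rewrite /Phi; case: pselect => [g1|/(_ gw)[]]; rewrite /Psi divfK// mulf_neq0 ?expf_neq0.
exists (fun xi => s1 * G (z + rC r * xi)), (fun xi => s2 * Rr (z + rC r * xi)), phi,
  (z / rC r).
split.
- split.
  + exact (scale_hol GV inV).
  + exact (scale_hol RV inV).
  + by apply: hol_sub phih; apply: disc_sub; lra.
  + move=> xi xA; have Vx := inV xi xA; have [_ Gx Rx] := goodP _ Vx.
    by split; rewrite mulf_neq0 ?expf_neq0.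
  move=> xi xA; have Vx := inV xi xA.
  rewrite (scale_dvn s1 q oV GV Vx) (scale_dvn s2 l.+1 oV RV Vx) (dv_Rr oV GV Vx).
  have e1 : s1 * rC r ^+ q = rC r.
    by rewrite /s1 /q addnC exprSr mulKf// expf_neq0.
  have e2 : s2 * rC r ^+ l.+1 = rC r by rewrite /s2 exprSr mulKf// expf_neq0.
  rewrite e1 e2; split=> //.
  rewrite exprMn PsiE// /phi /om 2!exprD !(mulnC _ b) !(mulnC _ c) 2!exprM.
  rewrite !(exprMn _ s1) !(exprMn _ s2) /s1 /s2 !exprVn -!exprM.
  move: (Phi _) (G _ ^+ b) (Rr _ ^+ c) => x y w.
  by rewrite !(mulnC _ b) !(mulnC _ c); field; rewrite !expf_neq0.
- move=> xi xA; have := phih2 xi xA => h2; rewrite cnf.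
  have sub : disc xi (B / 2) `<=` disc 0 B.
    by apply: disc_in; move: xA; rewrite /disc /= subr0; lra.
  have B20 : 0 < B / 2 by rewrite divr_gt0.
  have := cauchy_est B20 (hol_sub sub phih) (fun w ws => phiK w (sub w ws)).
  have -> : 64 * K / (B / 2) = A^-1 / 16 by rewrite /B; field; rewrite ?gt_eqF.
  have Ai : 0 < A^-1 by rewrite invr_gt0.
  move=> h; rewrite ler_pdivrMr; last lra.
  apply: le_trans h _; apply: le_trans (ler_wpM2l (ltW Ai) h2); lra.
- by move=> xi /phih2; lra.
- move=> xi xA; have Vx := inV xi xA.
  rewrite (scale_dvn s1 k oV GV Vx).
  have -> : s1 * rC r ^+ k = s2 by rewrite /s1 /s2 exprD invfM -mulrA mulVf ?mulr1// expf_neq0.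
  have -> : derive1n k G (z + rC r * xi) = Rr (z + rC r * xi) + c0 * (z + rC r * xi) ^+ l.
    by rewrite /Rr subrK.
  rewrite mulrDr; congr (_ + _).
  have -> : z + rC r * xi = rC r * (xi + z / rC r) by field.
  by rewrite exprMn /s2; field; rewrite expf_neq0.
Qed.

End PlaneTheorem.

(** * Sequences of holomorphic functions *)

Section LocalLimits.
Variable R : realType.
Local Notation C := R[i].
Local Notation hol := (@holomorphic R).
Variable U : set_system nat.
Hypothesis UU : UltraFilter U.
Implicit Types (V : set C) (a z w d : C) (r s M e K : R) (h : nat -> C -> C) (f g : C -> C).

Definition bddhol V f M := hol V f /\ forall z, V z -> cn (f z) <= M.

Definition loc_bounded V h := forall a, V a -> exists r M, [/\ 0 < r, disc a r `<=` V &
  \forall j \near U, bddhol (disc a r) (h j) M].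

(** Locally uniform convergence in disguise: by the Lipschitz estimate a locally bounded sequence is
    equicontinuous, so pointwise limits suffice; see [flim_tight]. *)
Definition flim V h g := loc_bounded V h /\ forall z, V z -> ulim U (h^~ z) (g z).

Lemma bddhol_sub V W f M : V `<=` W -> bddhol W f M -> bddhol V f M.
Proof.
by move=> VW [fh fM]; split; [exact: hol_sub fh|move=> z /VW/fM].
Qed.

Lemma loc_bounded_disc a r M h : (\forall j \near U, bddhol (disc a r) (h j) M) -> loc_bounded (disc a r) h.
Proof.
move=> H z zr; have s0 : 0 < r - cn (z - a) by rewrite subr_gt0.
have sub : disc z (r - cn (z - a)) `<=` disc a r by apply: disc_in; rewrite addrC subrK.
exists (r - cn (z - a)), M; split; [exact: s0|exact: sub|].
by apply: filterS H => j; exact: bddhol_sub.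
Qed.

Lemma loc_bounded_lim V h z : loc_bounded V h -> V z -> exists x, ulim U (h^~ z) x.
Proof.
move=> H /H[r [M [r0 _ hM]]]; apply: (ulim_ex UU (M := M)).
by apply: filterS hM => j [_ jM]; apply/jM/disc_center.
Qed.

Lemma flim_tight V h g a e : flim V h g -> V a -> 0 < e ->
  exists2 d : R, 0 < d & \forall j \near U, forall w, cn (w - a) < d -> cn (h j w - g a) < e.
Proof.
move=> [H L] Va e0; have [r [M [r0 _ hM]]] := H a Va.
pose K := `|256 * M / r| + 1; have K0 : 0 < K by rewrite ltr_wpDl.
have e2 : 0 < e / 2 by rewrite divr_gt0.
exists (Num.min (r / 8) (e / 2 / K)); first by rewrite lt_min !divr_gt0.
apply: filterS2 hM (L a Va _ e2) => j [jh jM] ja w; rewrite lt_min => /andP[wr].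
rewrite ltr_pdivlMr// => wK; have aa : cn (a - a) <= r / 8 by rewrite subrr cn0 divr_ge0// ltW.
have l1 := hol_lip r0 jh jM (ltW wr) aa.
have l2 : 256 * M / r * cn (w - a) <= cn (w - a) * K.
  rewrite mulrC ler_wpM2l ?cn_ge0//; apply: le_trans (ler_norm _) _.
  by rewrite lerDl.
have l3 := le_lt_trans (le_trans l1 l2) wK.
apply: le_lt_trans (cn_tri (h j a) _ _) _.
by rewrite [ltRHS]splitr ltrD.
Qed.

Lemma flim_seq V h g a (zs : nat -> C) : flim V h g -> V a -> ulim U zs a ->
  ulim U (fun j => h j (zs j)) (g a).
Proof.
move=> H Va za e e0; have [d d0 hd] := flim_tight H Va e0.
by apply: filterS2 hd (za d d0) => j hj /hj.
Qed.

Lemma loc_bounded_dv V h : loc_bounded V h -> loc_bounded V (fun j => derive1 (h j)).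
Proof.
move=> H a /H[r [M [r0 rV hM]]]; have r20 : 0 < r / 2 by rewrite divr_gt0.
exists (r / 2), (64 * M / (r / 2)); split; [exact: r20|by apply: subset_trans rV; apply: disc_sub; lra|].
apply: filterS hM => j [jh jM]; split.
  apply: hol_sub (dv_hol (@disc_open _ a r) jh); apply: disc_sub; lra.
move=> z zr; have sub : disc z (r / 2) `<=` disc a r.
  by apply: disc_in; move: zr; rewrite /disc /=; lra.
exact: cauchy_est r20 (hol_sub sub jh) (fun w ws => jM w (sub w ws)).
Qed.

(** The inequality of [hol_taylor] has constants independent of [j], so it passes to the limit, with
    the limit of the derivatives as derivative. *)
Lemma flim_hasd V h g a : flim V h g -> V a ->
  exists2 d, hasd g a d & ulim U (fun j => derive1 (h j) a) d.
Proof.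
move=> [H L] Va; have [d hd] := loc_bounded_lim (loc_bounded_dv H) Va.
exists d => //; have [r [M [r0 rV hM]]] := H a Va.
apply: (@quad_hasd R g a d (r / 8) (2048 * M / r ^+ 2)) => [|w wr]; first by rewrite divr_gt0.
have wV : V w by apply: rV; rewrite /disc /=; lra.
have l1 := ulimB UU (ulimB UU (L w wV) (L a Va)) (ulimM UU hd (ulim_cst UU (w - a))).
apply: (ulim_le UU l1); apply: filterS hM => j [jh jM].
exact (hol_taylor r0 jh jM (ltW wr)).
Qed.

Lemma flim_hol V h g : flim V h g -> hol V g.
Proof. by move=> H a /(flim_hasd H)[d /hasd_derivable]. Qed.

Lemma flim_dv V h g : flim V h g -> flim V (fun j => derive1 (h j)) (derive1 g).
Proof.
move=> H; split; first exact: loc_bounded_dv H.1.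
by move=> z /(flim_hasd H)[d /hasdE gd hd]; rewrite gd.
Qed.

Lemma flim_dvn V h g i : flim V h g -> flim V (fun j => derive1n i (h j)) (derive1n i g).
Proof.
move=> H; elim: i => [//|i IH]; rewrite derive1nS.
have -> : (fun j => derive1n i.+1 (h j)) = (fun j => derive1 (derive1n i (h j))).
  by apply/funext => j; rewrite derive1nS.
exact: flim_dv.
Qed.

(** Zeros are isolated, which gives a lower bound on an annulus; its radii [s] and [4 s] are those
    required by [max_principle]. *)
Lemma annulus_lower f a r : 0 < r -> hol (disc a r) f ->
  (exists2 s, 0 < s & forall z, disc a s z -> f z = 0) \/
  exists s e, [/\ 0 < s, 0 < e, 4 * s < r & forall z, s <= cn (z - a) -> cn (z - a) <= 4 * s ->
    e <= cn (f z)].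
Proof.
move=> r0 fh; have [|[j [q [qh qa fE]]]] := hol_order r0 fh; [by left|right].
have ca := derivable_cont (qh a (disc_center a r0)).
have e0 : 0 < cn (q a) / 2 by rewrite divr_gt0 ?cn_gt0.
have /cont_discP/(_ _ e0)[d d0 hd] := ca.
pose s := Num.min (d / 8) (r / 8).
have [s0 sd sr] : [/\ 0 < s, s <= d / 8 & s <= r / 8].
  by rewrite /s lt_min !ge_min !lexx orbT !divr_gt0.
exists s, (s ^+ j * (cn (q a) / 2)); split; [exact: s0|by rewrite mulr_gt0 ?exprn_gt0|lra|].
move=> z z1 z2; rewrite fE cnM cnX; apply: ler_pM; rewrite ?exprn_ge0 ?(ltW e0) ?(ltW s0)//.
  by rewrite lerXn2r ?nnegrE ?(ltW s0) ?cn_ge0.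
have zd : cn (z - a) < d by lra.
by have := hd z zd; have := cn_lb (q a) (q z); rewrite cnC; lra.
Qed.

(** Compactness in contrapositive form: if points with property [Q j] existed for [U]-almost all
    [j], a choice of them would be bounded and have a limit along [U]. *)
Lemma bdd_seq_near (Q : nat -> C -> Prop) M : (\forall j \near U, forall z, Q j z -> cn z <= M) ->
  (forall a zs, ulim U zs a -> (\forall j \near U, Q j (zs j)) -> False) ->
  \forall j \near U, forall z, ~ Q j z.
Proof.
move=> QM H; have [//|nQ] := ultra_or UU (fun j => forall z, ~ Q j z).
have nQ' : \forall j \near U, exists z, Q j z.
  by apply: filterS nQ => j /existsNP[z /contrapT]; exists z.
have [zs hzs] : exists zs : nat -> C, forall j, (exists z, Q j z) -> Q j (zs j).
  have h j : exists z, (exists z, Q j z) -> Q j z.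
    have [[z Qz]|n] := pselect (exists z, Q j z); first by exists z.
    by exists 0 => /n.
  exists (fun j => sval (cid (h j))) => j; exact: (svalP (cid (h j))).
have zQ : \forall j \near U, Q j (zs j) by apply: filterS nQ' => j /hzs.
have [a za] : exists a, ulim U zs a.
  by apply: (ulim_ex UU (M := M)); apply: filterS2 QM zQ => j qm /qm.
by case: (H a zs za zQ).
Qed.

Lemma flim_annulus V h g a s e : flim V h g -> 0 < e ->
  (forall z, cn (z - a) <= 4 * s -> V z) ->
  (forall z, s <= cn (z - a) -> cn (z - a) <= 4 * s -> e <= cn (g z)) ->
  \forall j \near U, forall z, s <= cn (z - a) -> cn (z - a) <= 4 * s -> e / 2 <= cn (h j z).
Proof.
move=> H e0 sV gl.
have := @bdd_seq_near
  (fun j z => [/\ s <= cn (z - a), cn (z - a) <= 4 * s & cn (h j z) < e / 2]) (4 * s + cn a).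
move=> /(_ _ _) bn; suff hj : \forall j \near U, forall z,
    ~ [/\ s <= cn (z - a), cn (z - a) <= 4 * s & cn (h j z) < e / 2].
  by apply: filterS hj => j hj z z1 z2; rewrite leNgt; apply/negP => z3; exact: (hj z).
apply: bn.
- apply: nearW => j z [_ h1 _]; have := cn_lb z (-a).
  by rewrite opprK cnN => h2; have := cnD (z - a) a; rewrite subrK; lra.
- move=> b zs zb Q.
  have l1 := ulimB UU zb (ulim_cst UU a).
  have b1 : s <= cn (b - a) by apply: (ulim_ge UU l1); apply: filterS Q => j [].
  have b2 : cn (b - a) <= 4 * s by apply: (ulim_le UU l1); apply: filterS Q => j [].
  have l2 := flim_seq H (sV b b2) zb.
  have : cn (g b) <= e / 2 by apply: (ulim_le UU l2); apply: filterS Q => j [_ _ /ltW].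
  by have := gl b b1 b2; lra.
Qed.

(** If the [h j] had no zeros near [a], the maximum principle for [1 / h j] would carry their lower
    bound on an annulus to the centre, and [g a] could not be 0. *)
Lemma hurwitz_zero V h g a r : flim V h g -> 0 < r -> disc a r `<=` V ->
  (\forall j \near U, hol (disc a r) (h j)) -> g a = 0 ->
  (exists2 s, 0 < s & forall z, disc a s z -> g z = 0) \/
  \forall j \near U, exists2 z, disc a r z & h j z = 0.
Proof.
move=> H r0 rV hh ga; have gh := hol_sub rV (flim_hol H).
have [|[s [e [s0 e0 sr gl]]]] := annulus_lower r0 gh; [by left|right].
have [//|nz] := ultra_or UU (fun j => exists2 z, disc a r z & h j z = 0).
have sV z : cn (z - a) <= 4 * s -> V z by move=> zs; apply: rV; rewrite /disc /=; lra.
have hl := flim_annulus H e0 sV gl.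
have Va : V a by apply/rV/disc_center.
have : e / 2 <= cn (g a).
  apply: (ulim_ge UU (H.2 a Va)); apply: filterS3 hh nz hl => j jh jn jl.
  have jz z : disc a r z -> h j z != 0 by move=> zr; apply/eqP => z0; apply: jn; exists z.
  have sub : disc a (4 * s) `<=` disc a r by apply: disc_sub; exact: ltW.
  have vh : hol (disc a (4 * s)) (fun z => (h j z)^-1).
    exact: holV (hol_sub sub jh) (fun z zs => jz z (sub z zs)).
  have e20 : 0 < e / 2 by rewrite divr_gt0.
  have aa : cn (a - a) < s by rewrite subrr cn0.
  have bd z : s <= cn (z - a) -> cn (z - a) < 4 * s -> cn ((h j z)^-1) <= (e / 2)^-1.
    move=> z1 z2; rewrite cnV lef_pV2 ?posrE//; first exact: jl z1 (ltW z2).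
    by rewrite cn_gt0 jz// /disc /=; lra.
  have := max_principle s0 vh bd aa.
  by rewrite cnV lef_pV2 ?posrE// cn_gt0 jz//; exact: disc_center.
by rewrite ga cn0; lra.
Qed.

(** Zeros of [h j] tend to [a], and the [i]-th derivative vanishes at them. Were that of [g] nonzero
    at [a], those of [h j] would be nonzero on a common disc about [a]. *)
Lemma hurwitz_mult V h g a r m : flim V h g -> 0 < r -> disc a r `<=` V ->
  (\forall j \near U, hol (disc a r) (h j)) ->
  (\forall j \near U, forall z, disc a r z -> h j z = 0 ->
     forall i, (i < m)%N -> derive1n i (h j) z = 0) ->
  g a = 0 -> forall i, (i < m)%N -> derive1n i g a = 0.
Proof.
move=> H r0 rV hh hm ga i im.
have [[s s0 gs]|nz] := pselect (exists2 s : R, 0 < s & forall z, disc a s z -> g z = 0).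
  rewrite (@derive1n_near _ _ (fun=> 0)) ?dvn_0//.
  by apply: (near_discI s0) => w /gs.
apply/eqP; apply: contrapT => /negP gi; have e0 : 0 < cn (derive1n i g a) by rewrite cn_gt0.
have Va : V a by apply/rV/disc_center.
have [d d0 hd] := flim_tight (flim_dvn i H) Va e0.
have m0 : 0 < Num.min d r by rewrite lt_min d0.
have mr : disc a (Num.min d r) `<=` disc a r by apply: disc_sub; rewrite ge_min lexx orbT.
have hh' : \forall j \near U, hol (disc a (Num.min d r)) (h j).
  by apply: filterS hh => j; exact: hol_sub.
have [//|hz] := hurwitz_zero H m0 (subset_trans mr rV) hh' ga.
have [j [hdj [hmj [z zd hz0]]]] := ultra_ex UU (filterI hd (filterI hm hz)).
have /(hdj z) : cn (z - a) < d by move: zd; rewrite /disc /= lt_min => /andP[].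
by rewrite (hmj z (mr z zd) hz0 i im) sub0r cnN ltxx.
Qed.

End LocalLimits.

(** * Functions into the sphere *)

Section Sphere.
Variable R : realType.
Local Notation C := R[i].
Local Notation hol := (@holomorphic R).
Implicit Types (V : set C) (a z w : C) (r s M : R) (x y : sphere R) (u v F : C -> sphere R).

(* Since 0^-1 = 0, the junk value at infinity makes fin_sinv hold everywhere. *)
Definition fin x : C := odflt 0 x.

Definition sinv x : sphere R :=
  if x is Some z then (if z == 0 then None else Some z^-1) else Some 0.

Lemma sinvK x : sinv (sinv x) = x.
Proof.
case: x => [z|] /=; last by rewrite eqxx.
by have [->|z0] := eqVneq z 0; rewrite //= invr_eq0 (negbTE z0) invrK.
Qed.

Lemma fin_sinv x : fin (sinv x) = (fin x)^-1.
Proof.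
case: x => [z|] /=; last by rewrite invr0.
by have [->|z0] := eqVneq z 0; rewrite //= invr0.
Qed.

Lemma finE x : x <> None -> x = Some (fin x).
Proof. by case: x. Qed.

Lemma sinv_None x : sinv x = None <-> x = Some 0.
Proof.
by case: x => [z|] //=; have [->|z0] := eqVneq z 0; split=> // -[] /eqP; rewrite (negbTE z0).
Qed.

Definition finhol V v := (forall z, V z -> v z <> None) /\ hol V (fin \o v).

(* Holomorphic into the sphere, the constant infinity included. *)
Definition sphol V v := forall a, V a -> exists2 r, 0 < r &
  finhol (disc a r) v \/ finhol (disc a r) (sinv \o v).

Definition chart V v M := (forall z, V z -> v z <> None) /\ bddhol V (fin \o v) M.

Lemma sphol_sub V W v : V `<=` W -> sphol W v -> sphol V v.
Proof. by move=> VW H a /VW /H. Qed.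

Lemma sinvKf v : sinv \o (sinv \o v) = v.
Proof. by apply/funext => z /=; rewrite sinvK. Qed.

Lemma sphol_sinv V v : sphol V v -> sphol V (sinv \o v).
Proof.
move=> H a /H[r r0 h]; exists r; first exact: r0.
by rewrite sinvKf; case: h => h1; [right|left]; exact: h1.
Qed.

Lemma sphol_fin V v : sphol V v -> (forall z, V z -> v z <> None) -> finhol V v.
Proof.
move=> H vN; split; [exact: vN|move=> a Va]; have [r r0 [[_ h]|[h1 h]]] := H a Va.
  exact: h (disc_center a r0).
have hd := h a (disc_center a r0).
have E : fin \o v = (fun z => ((fin \o (sinv \o v)) z)^-1).
  by apply/funext => z /=; rewrite fin_sinv invrK.
rewrite E; have na : (fin \o (sinv \o v)) a != 0.
  rewrite /= fin_sinv invr_eq0; apply/eqP => f0.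
  by apply: (h1 a (disc_center a r0)); apply/sinv_None; rewrite (finE (vN a Va)) f0.
exact: hasd_derivable (hasdV na (hasd_dv hd)).
Qed.

Lemma sinv_mpow v n : (0 < n)%N -> sinv \o mpow v n = mpow (sinv \o v) n.
Proof.
move=> n0; apply/funext => z; rewrite /mpow /=; case: (v z) => [x|] /=.
  by rewrite expf_eq0 n0 /=; case: eqP => //= _; rewrite exprVn.
by rewrite expr0n gtn_eqF.
Qed.

Lemma sphol_mpow V v n : (0 < n)%N -> sphol V v -> sphol V (mpow v n).
Proof.
move=> n0 H a /H[r r0 h]; exists r; first exact: r0.
have E u : (forall z, disc a r z -> u z <> None) /\ hol (disc a r) (fin \o u) ->
    finhol (disc a r) (mpow u n).
  move=> [u1 uh]; split=> [z /u1|]; first by rewrite /mpow; case: (u z).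
  have -> : fin \o mpow u n = (fun z => (fin \o u) z ^+ n).
    by apply/funext => z; rewrite /mpow /=; case: (u z) => //=; rewrite expr0n gtn_eqF.
  exact: holX.
case: h => /E h1; [by left; exact: h1|right].
by rewrite sinv_mpow//; exact: h1.
Qed.

Lemma mero_sphol V v : meromorphic V v -> sphol V v.
Proof.
move=> H a /H[[g gh vg]|[j [va j0 [h [hh ha vh]]]]].
  have [r r0 hr] := near_discE (filterI gh vg); exists r; first exact: r0.
  left; split=> [z /hr[_ ->]|]; first by [].
  apply: (hol_near_ext (f := g)) => z /hr[h1 h2]; first exact: h1.
  by rewrite /= h2.
have [r r0 hr] := near_discE hh.
have [s /andP[s0 sr] hs] := @nonzero_disc R h a r r0 hr ha.
have /near_discE[t t0 ht] : \forall z \near a, z != a -> v z = Some (h z / (z - a) ^+ j).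
  exact: vh.
pose m := Num.min s t; have m0 : 0 < m by rewrite lt_min s0.
exists m; first exact: m0.
right.
have E z : disc a m z -> (sinv \o v) z = Some ((z - a) ^+ j * (h z)^-1).
  rewrite /disc /m /= lt_min => /andP[zs zt]; have [->|za] := eqVneq z a.
    by rewrite va /= subrr expr0n gtn_eqF// mul0r.
  rewrite ht//= mulf_eq0 invr_eq0 expf_eq0 subr_eq0 (negbTE za) andbF orbF.
  by rewrite (negbTE (hs z zs)) invfM invrK mulrC.
split=> [z /E ->|]; first by [].
have mh : hol (disc a m) (fun z => (z - a) ^+ j * (h z)^-1).
  apply: holM; first by apply: holX; exact: hol_lin1.
  have sub : disc a m `<=` disc a s by apply: disc_sub; rewrite ge_min lexx.
  by apply: holV; [apply: hol_sub hr; apply: subset_trans sub (disc_sub sr)|move=> z /sub/hs].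
by apply: (hol_near_ext mh) => z /E /= ->.
Qed.

(** The set of points near which [v] is identically infinite is open and closed: where it
    accumulates, [1 / v] is holomorphic with a zero that is not isolated. If it is empty, [1 / v]
    has zeros of finite order only, and these are the poles. *)
Lemma sphol_mero V v : open V -> connected V -> sphol V v ->
  meromorphic V v \/ forall z, V z -> v z = None.
Proof.
move=> oV cV H.
pose P a := \forall z \near a, v z = None.
have Pcl b : V b -> (forall r, 0 < r -> exists2 z, disc b r z & P z) -> P b.
  move=> Vb hb; have [r r0 [[h1 _]|[h1 h]]] := H b Vb.
    by have [z /h1 h2 /nbhs_singleton] := hb r r0.
  have [[s s0 hs]|[j [q [qh qb qE]]]] := hol_order r0 h.
    have m0 : 0 < Num.min s r by rewrite lt_min s0.
    apply: (near_discI m0) => z; rewrite lt_min => /andP[/hs /= fz /h1 /= vz].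
    by rewrite -[v z]sinvK (finE vz) fz /= eqxx.
  have [s /andP[s0 sr] hq] := nonzero_disc r0 qh qb.
  have [w ws /near_discE[t t0 ht]] := hb s s0.
  have [z [zt zs zb]] : exists z, [/\ disc w t z, disc b s z & z != b].
    have t'0 : 0 < Num.min t (s - cn (w - b)) by rewrite lt_min t0 subr_gt0.
    have sub : disc w (Num.min t (s - cn (w - b))) `<=` disc b s.
      by apply: disc_in; rewrite -lerBrDl ge_min lexx orbT.
    have [wb|wb] := eqVneq w b; last by exists w; split; [exact: disc_center|exact: ws|exact: wb].
    have [z zt zw] := disc_punctured w t'0; exists z; split; last by rewrite -wb.
      by move: zt; rewrite /disc /= lt_min => /andP[].
    exact: sub.
  have := qE z; rewrite /= (ht z zt) /= => /esym/eqP.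
  by rewrite mulf_eq0 expf_eq0 subr_eq0 (negbTE zb) andbF (negbTE (hq z zs)).
have [[a0 Va0 Pa0]|nP] := pselect (exists2 a, V a & P a).
  right=> a Va; suff : P a by exact: nbhs_singleton.
  apply: (@clopen_domain R V P oV cV _ Pcl _ a Va); last by exists a0.
  move=> b _ vb; have [r r0 hr] := near_discE vb; apply: (near_discI r0) => z zr.
  by apply: filterS (disc_nbhs (zr : disc b r z)) => w /hr.
left=> a Va; have [r r0 [[h1 h]|[h1 h]]] := H a Va.
  left; exists (fin \o v); first by apply: (near_discI r0) => z /h.
  by apply: (near_discI r0) => z /h1 /finE.
have [[s s0 hs]|[j [q [qh qb qE]]]] := hol_order r0 h.
  case: nP; exists a; first exact: Va.
  have m0 : 0 < Num.min s r by rewrite lt_min s0.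
  apply: (near_discI m0) => z; rewrite lt_min => /andP[/hs /= fz /h1 /= vz].
  by rewrite -[v z]sinvK (finE vz) fz /= eqxx.
have [s /andP[s0 sr] hq] := nonzero_disc r0 qh qb.
have vE z : disc a s z -> v z = sinv (Some ((z - a) ^+ j * q z)).
  move=> zs; have e := finE (h1 z (disc_sub sr zs)).
  by rewrite -qE -[v z]sinvK; congr (sinv _).
have qVh : hol (disc a s) (fun z => (q z)^-1).
  exact: holV (hol_sub (disc_sub sr) qh) hq.
case: j qE vE => [|j] qE vE.
  left; exists (fun z => (q z)^-1); first by apply: (near_discI s0) => z /qVh.
  by apply: (near_discI s0) => z zs; rewrite vE//= expr0 mul1r (negbTE (hq z zs)).
right; exists j.+1; split; [|by []|exists (fun z => (q z)^-1); split].
- by rewrite vE ?subrr ?expr0n ?mul0r /= ?eqxx//; exact: disc_center.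
- by apply: (near_discI s0) => z /qVh.
- by rewrite invr_eq0.
- suff : \forall z \near a, z != a -> v z = Some ((q z)^-1 / (z - a) ^+ j.+1) by [].
  apply: (near_discI s0) => z zs za; rewrite vE//= mulf_eq0 expf_eq0 subr_eq0 (negbTE za) andbF.
  by rewrite (negbTE (hq z zs)) /= invfM mulrC.
Qed.

(** Near the pole [1 / v] is [(z - a)^j / h], whose derivative of order [j] is nonzero at [a]; so
    the assumed vanishing stops before [j]. *)
Lemma order_pole v a r j n : 0 < r -> finhol (disc a r) (sinv \o v) -> pole_of_order v a j ->
  (forall i, (i < n)%N -> derive1n i (fin \o (sinv \o v)) a = 0) -> (n <= j)%N.
Proof.
move=> r0 [_ vh] [va j0 [h [hh ha vE]]] vn; rewrite leqNgt; apply/negP => /vn d0.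
have [t t0 ht] := near_discE hh.
have [s /andP[s0 sr] hs] := @nonzero_disc R h a t t0 ht ha.
have /near_discE[e e0 he] : \forall z \near a, z != a -> v z = Some (h z / (z - a) ^+ j).
  exact: vE.
have m0 : 0 < Num.min s e by rewrite lt_min s0.
have sub : disc a (Num.min s e) `<=` disc a s by apply: disc_sub; rewrite ge_min lexx.
have hV : hol (disc a (Num.min s e)) (fun z => (h z)^-1).
  exact: holV (hol_sub (subset_trans sub (disc_sub sr)) ht) (fun z zm => hs z (sub z zm)).
have E z : disc a (Num.min s e) z ->
    (fin \o (sinv \o v)) z = (z - a) ^+ (0 + j) * (h z)^-1.
  rewrite /disc /= lt_min => /andP[zs ze]; rewrite fin_sinv; have [->|za] := eqVneq z a.
    by rewrite va /= subrr expr0n gtn_eqF// mul0r invr0.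
  by rewrite he//= invfM invrK mulrC.
have [p [_ pa pE]] := dvn_pow (i := j) hV E.
have := pE a (disc_center a m0); rewrite d0 expr0 mul1r => /esym/eqP.
by rewrite (negbTE (pa _))// invr_eq0.
Qed.

End Sphere.

Arguments fin {R} x.
Arguments sinv {R} x.

Section SphericalDistance.
Variable R : realType.
Local Notation C := R[i].
Implicit Types (z w : C) (x y : sphere R).

Let S (c : R) := Num.sqrt (1 + c ^+ 2).

Lemma sqrt1_ge1 (c : R) : 1 <= S c.
Proof. by rewrite -{1}sqrtr1 /S ler_sqrt ?lerDl ?sqr_ge0// addr_ge0 ?sqr_ge0. Qed.

Lemma sqrt1V (c : R) : 0 < c -> S c^-1 = S c / c.
Proof.
move=> c0; have -> : S c / c = S c / Num.sqrt (c ^+ 2) by rewrite sqrtr_sqr gtr0_norm.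
rewrite /S -sqrtrV ?sqr_ge0// -sqrtrM ?addr_ge0 ?sqr_ge0//; congr Num.sqrt.
by field; rewrite gt_eqF.
Qed.

Lemma spherical_dist_le x y : x <> None -> y <> None ->
  spherical_dist x y <= cn (fin x - fin y).
Proof.
case: x y => [z|//] [w|//] _ _ /=; have h1 := sqrt1_ge1 (cn z); have h2 := sqrt1_ge1 (cn w).
rewrite -/(S _) -/(S _) ler_pdivrMr ?mulr_gt0 ?(lt_le_trans ltr01)//.
by rewrite ler_peMr ?cn_ge0// -[leLHS]mulr1 ler_pM.
Qed.

Lemma spherical_distC x y : spherical_dist x y = spherical_dist y x.
Proof.
by case: x y => [z|] [w|] //=; rewrite cnC [X in _ / X]mulrC.
Qed.

(** Inversion is an isometry of the sphere, so estimates made in the finite chart carry over to the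
    chart at infinity. The values 0 and infinity, which it exchanges, are treated apart. *)
Lemma spherical_dist_sinv x y : spherical_dist (sinv x) (sinv y) = spherical_dist x y.
Proof.
have s0 : S 0 = 1 by rewrite /S expr0n addr0 sqrtr1.
have p c : S c != 0 by rewrite gt_eqF ?(lt_le_trans ltr01)//; exact: sqrt1_ge1.
have sSN z : spherical_dist (Some z) None = (S (cn z))^-1 by [].
have sNS z : spherical_dist None (Some z) = (S (cn z))^-1 by [].
have sSS z w : spherical_dist (Some z) (Some w) = cn (z - w) / (S (cn z) * S (cn w)) by [].
have i0 : sinv (Some 0 : sphere R) = None by rewrite /sinv eqxx.
have iN : sinv (None : sphere R) = Some 0 by [].
have iS z : z != 0 -> sinv (Some z) = Some z^-1 by move=> /negbTE z0; rewrite /sinv z0.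
have key z : spherical_dist (sinv (Some z)) (sinv None) = spherical_dist (Some z) None.
  have [->|z0] := eqVneq z 0; first by rewrite i0 iN sSN sNS cn0.
  rewrite iS// iN sSS sSN subr0 cn0 s0 mulr1 cnV sqrt1V ?cn_gt0//.
  by field; rewrite p cn_eq0.
have key2 z : spherical_dist (sinv (Some z)) (sinv (Some 0)) = spherical_dist (Some z) (Some 0).
  have [->|z0] := eqVneq z 0; first by rewrite i0 sSS subrr cn0 mul0r.
  rewrite iS// i0 sSN sSS subr0 cn0 s0 mulr1 cnV sqrt1V ?cn_gt0// invfM invrK mulrC.
  by [].
case: x y => [z|] [w|]; [|exact: key|by rewrite spherical_distC key spherical_distC|].
  have [w0|w0] := eqVneq w 0; first by rewrite w0 key2.
  have [z0|z0] := eqVneq z 0; first by rewrite z0 spherical_distC key2 spherical_distC.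
  rewrite !iS// !sSS !cnV !sqrt1V ?cn_gt0//.
  have -> : z^-1 - w^-1 = (w - z) / (z * w) by field; rewrite z0 w0.
  rewrite cnf cnM cnC; have := p (cn z); have := p (cn w).
  by move=> p1 p2; field; rewrite p1 p2 !cn_eq0 z0 w0.
by rewrite iN sSS subrr cn0 mul0r.
Qed.

End SphericalDistance.

(** * Limits of sequences of maps into the sphere *)

Section Montel.
Variable R : realType.
Local Notation C := R[i].
Local Notation hol := (@holomorphic R).
Variable U : set_system nat.
Hypothesis UU : UltraFilter U.
Implicit Types (V : set C) (a z w : C) (r s M : R) (x y : C).
Implicit Types (u : nat -> C -> sphere R) (F : C -> sphere R).

(* F is the pointwise limit along U in the sphere, as long as u is locally bounded
   in one of the two charts. *)
Definition slim u F := forall z,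
  (forall x, (\forall j \near U, u j z <> None) -> ulim U (fun j => fin (u j z)) x ->
     F z = Some x) /\
  ((forall x, (\forall j \near U, u j z <> None) -> ~ ulim U (fun j => fin (u j z)) x) ->
     F z = None).

Lemma slim_ex u : exists F, slim u F.
Proof.
suff : forall z, exists x : sphere R,
  (forall y, (\forall j \near U, u j z <> None) -> ulim U (fun j => fin (u j z)) y ->
     x = Some y) /\
  ((forall y, (\forall j \near U, u j z <> None) -> ~ ulim U (fun j => fin (u j z)) y) ->
     x = None).
  by move=> /choice[F hF]; exists F => z; exact: hF.
move=> z; have [[y [h1 h2]]|n] := pselect (exists y, (\forall j \near U, u j z <> None) /\
    ulim U (fun j => fin (u j z)) y).
  exists (Some y); split=> [y' _ hy'|/(_ y h1)//]; congr Some.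
  exact (ulim_uniq UU h2 hy').
by exists None; split=> // y h1 h2; case: n; exists y.
Qed.

Definition slimit V u F := (forall z, V z -> F z <> None) /\
  flim U V (fun j => fin \o u j) (fin \o F).

Lemma chart_lim V u M z : (\forall j \near U, chart V (u j) M) -> V z ->
  (\forall j \near U, u j z <> None) /\ exists x, ulim U (fun j => fin (u j z)) x.
Proof.
move=> H Vz; split; first by apply: filterS H => j [h _]; exact: h.
by apply: (ulim_ex UU (M := M)); apply: filterS H => j [_ [_ h]]; exact: h.
Qed.

Lemma chart_loc_bounded a r u M : (\forall j \near U, chart (disc a r) (u j) M) ->
  loc_bounded U (disc a r) (fun j => fin \o u j).
Proof. by move=> H; apply: (loc_bounded_disc UU (M := M)); apply: filterS H => j []. Qed.

Lemma slim_fin a r u F M : slim u F -> (\forall j \near U, chart (disc a r) (u j) M) ->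
  slimit (disc a r) u F.
Proof.
move=> uF H; split=> [z zr|].
  by have [h1 [x hx]] := chart_lim H zr; rewrite ((uF z).1 x h1 hx).
split=> [|z zr]; first exact: (chart_loc_bounded H).
by have [h1 [x hx]] := chart_lim H zr; rewrite /= ((uF z).1 x h1 hx).
Qed.

Lemma ulimV (b : nat -> C) x : x != 0 -> ulim U b x -> ulim U (fun j => (b j)^-1) x^-1.
Proof. by move=> x0 /ulimP h; apply/ulimP; exact: cvgV x0 h. Qed.

(** As [slim] prefers finite values, the chart at infinity has to be reconciled with it: where the
    inverses tend to 0, a finite limit [x] would give [1 = x * 0]; where they tend to some nonzero
    [y], the values tend to [1 / y]. *)
Lemma slim_inv a r u F M : slim u F ->
  (\forall j \near U, chart (disc a r) (sinv \o u j) M) ->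
  slimit (disc a r) (fun j => sinv \o u j) (sinv \o F).
Proof.
move=> uF H.
have key z : disc a r z -> exists2 y, sinv (F z) = Some y &
    ulim U (fun j => fin (sinv (u j z))) y.
  move=> zr; have [h1 [y hy]] := chart_lim H zr; exists y => //.
  have un0 : \forall j \near U, u j z <> Some 0.
    by apply: filterS h1 => j h /sinv_None/h.
  have [y0|y0] := eqVneq y 0.
    suff -> : F z = None by rewrite y0.
    apply: (uF z).2 => x h2 hx.
    have l1 : ulim U (fun=> 1 : C) (x * 0).
      rewrite -[X in _ * X]y0; apply: (ulim_near UU _ (ulimM UU hx hy)).
      apply: filterS2 un0 h2 => j n0 nN /=; rewrite fin_sinv divff//.
      by apply/eqP => f0; apply: n0; rewrite (finE nN) f0.
    have := ulim_uniq UU l1 (ulim_cst UU 1); rewrite mulr0 => /esym/eqP.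
    by rewrite oner_eq0.
  have nN : \forall j \near U, u j z <> None.
    have y1 : 0 < cn y by rewrite cn_gt0.
    apply: filterS (hy _ y1) => j hj uN; have f0 : fin (sinv (u j z)) = 0 by rewrite uN.
    by move: hj; rewrite f0 sub0r cnN ltxx.
  have l1 : ulim U (fun j => fin (u j z)) y^-1.
    by apply: (ulim_near UU _ (ulimV y0 hy)); apply: nearW => j; rewrite fin_sinv invrK.
  by rewrite ((uF z).1 _ nN l1) /= invr_eq0 (negbTE y0) invrK.
split=> [z /key[y /= ->]//|]; split; first exact: (chart_loc_bounded H).
by move=> z /key[y /= -> h].
Qed.

Lemma slimit_finhol V u F : slimit V u F -> finhol V F.
Proof. by move=> [h1 h2]; split; [exact: h1|exact (flim_hol UU h2)]. Qed.

(** Local boundedness for maps into the sphere. The chart may vary with [j], but along an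
    ultrafilter one of the two prevails. *)
Definition chart_bounded V u := forall a, V a -> exists r M, [/\ 0 < r, disc a r `<=` V &
  \forall j \near U, chart (disc a r) (u j) M \/ chart (disc a r) (sinv \o u j) M].

Lemma slim_cases V u F a : chart_bounded V u -> slim u F -> V a ->
  exists r, [/\ 0 < r, disc a r `<=` V &
  (exists2 M, \forall j \near U, chart (disc a r) (u j) M & slimit (disc a r) u F) \/
  (exists2 M, \forall j \near U, chart (disc a r) (sinv \o u j) M &
     slimit (disc a r) (fun j => sinv \o u j) (sinv \o F))].
Proof.
move=> H uF /H[r [M [r0 rV h]]]; exists r; split; [exact: r0|exact: rV|].
have [h1|h1] := ultra_orW UU h; [left|right]; exists M; [exact: h1| |exact: h1|].
  exact: slim_fin uF h1.
exact: slim_inv uF h1.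
Qed.

Lemma slim_sphol V u F : chart_bounded V u -> slim u F -> sphol V F.
Proof.
move=> H uF a Va; have [r [r0 rV h]] := slim_cases H uF Va; exists r; first exact: r0.
by case: h => -[M _ h]; [left|right]; exact: slimit_finhol h.
Qed.

Lemma slimit_dist a r u F M e : 0 < r -> (\forall j \near U, chart (disc a r) (u j) M) ->
  slimit (disc a r) u F -> 0 < e ->
  exists2 d : R, 0 < d & \forall j \near U, forall w, disc a d w -> spherical_dist (u j w) (F w) < e.
Proof.
move=> r0 H [h1 h2] e0; have e2 : 0 < e / 2 by rewrite divr_gt0.
have [d d0 hd] := flim_tight UU h2 (disc_center a r0) e2.
have ca := derivable_cont (flim_hol UU h2 (disc_center a r0)).
have /cont_discP/(_ _ e2)[d' d'0 hd'] := ca.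
exists (Num.min r (Num.min d d')); first by rewrite !lt_min r0 d0.
apply: filterS2 H hd => j [jN _] jd w; rewrite /disc /= !lt_min => /and3P[wr wd wd'].
apply: le_lt_trans (spherical_dist_le (jN w wr) (h1 w wr)) _.
apply: le_lt_trans (cn_tri (fin (F a)) _ _) _; rewrite [ltRHS]splitr.
by rewrite ltrD//; [exact: jd|rewrite cnC; exact: hd'].
Qed.

Lemma slim_dist V u F a e : chart_bounded V u -> slim u F -> V a -> 0 < e ->
  exists2 d : R, 0 < d & \forall j \near U, forall w, disc a d w -> spherical_dist (u j w) (F w) < e.
Proof.
move=> H uF Va e0; have [r [r0 _ [[M hM h]|[M hM h]]]] := slim_cases H uF Va.
  exact: slimit_dist r0 hM h e0.
have [d d0 hd] := slimit_dist r0 hM h e0; exists d; first exact: d0.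
by apply: filterS hd => j hj w /hj; rewrite /= spherical_dist_sinv.
Qed.

End Montel.

(** * Limits of rescalings *)

Section Options.
Variable R : realType.
Local Notation C := R[i].
Local Notation hol := (@holomorphic R).
Implicit Types (V : set C) (a z w : C) (r s M e K : R) (v : C -> sphere R) (psi : C -> C).

Lemma fin_Some z : fin (Some z) = z. Proof. by []. Qed.

Lemma fin_None : fin (None : sphere R) = 0. Proof. by []. Qed.

Definition dominated V v psi K := forall y, V y -> v y <> None /\ cn (fin (v y)) <= K * cn (psi y).

Definition dominating V v psi K := forall y, V y -> v y <> None -> cn (psi y) <= K * cn (fin (v y)).

Lemma dominated_chart V v psi K M : sphol V v -> dominated V v psi K -> 0 <= K ->
  (forall z, V z -> cn (psi z) <= M) -> chart V v (K * M).
Proof.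
move=> vh o K0 pM; have [v1 v2] := sphol_fin vh (fun z Vz => (o z Vz).1).
split; first exact: v1.
split; first exact: v2.
by move=> z Vz; apply: le_trans (o z Vz).2 _; rewrite ler_wpM2l// pM.
Qed.

(* 1 / v is holomorphic, and its bound on the annulus, where psi is bounded below,
   propagates inside although psi may vanish there. *)
Lemma dominating_chart a r s e v psi K : sphol (disc a r) v -> dominating (disc a r) v psi K -> 0 <= K ->
  (forall z, disc a r z -> ~ (psi z = 0 /\ v z = Some 0)) -> 0 < s -> 4 * s <= r -> 0 < e ->
  (forall z, s <= cn (z - a) -> cn (z - a) <= 4 * s -> e <= cn (psi z)) ->
  chart (disc a s) (sinv \o v) (K / e).
Proof.
move=> vh o K0 n0 s0 sr e0 pe.
have fN z : disc a r z -> (sinv \o v) z <> None.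
  move=> zr /sinv_None vz; apply: (n0 z zr); split=> //; apply/eqP.
  have := o z zr; rewrite vz => /(_ (fun h => ltac:(discriminate h))).
  by rewrite fin_Some cn0 mulr0 -cn_eq0 eq_le cn_ge0 andbT.
have [_ fh] := sphol_fin (sphol_sinv vh) fN.
have sub4 : disc a (4 * s) `<=` disc a r by exact: disc_sub.
have subs : disc a s `<=` disc a r by apply: disc_sub; lra.
split; first by move=> z /subs; exact: fN.
split; first exact: hol_sub fh.
have Ke : 0 <= K / e by rewrite divr_ge0// ltW.
apply: (max_principle s0 (hol_sub sub4 fh)) => z z1 z2; rewrite /= fin_sinv cnV.
have zr : disc a r z by exact: sub4.
have [vz|vz] := pselect (v z = None); first by rewrite vz fin_None cn0 invr0.
have h := le_trans (pe z z1 (ltW z2)) (o z zr vz).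
have f0 : 0 < cn (fin (v z)).
  rewrite lt_def cn_ge0 andbT; apply/eqP => f0.
  by move: h; rewrite f0 mulr0; lra.
by rewrite ler_pdivlMr// mulrC ler_pdivrMr.
Qed.

Lemma chart_le V v M M' : M <= M' -> chart V v M -> chart V v M'.
Proof.
move=> MM [h1 [h2 h3]]; split; first exact: h1.
by split; [exact: h2|move=> z /h3 h; exact: le_trans h MM].
Qed.

End Options.

Section LimitTools.
Variable R : realType.
Local Notation C := R[i].
Local Notation hol := (@holomorphic R).
Variable U : set_system nat.
Hypothesis UU : UltraFilter U.
Implicit Types (V : set C) (a z w : C) (r s M e K : R).
Implicit Types (u : nat -> C -> sphere R) (F : C -> sphere R) (h : nat -> C -> C).

Lemma flimB V h1 h2 (g1 g2 : C -> C) : flim U V h1 g1 -> flim U V h2 g2 ->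
  flim U V (fun j z => h1 j z - h2 j z) (fun z => g1 z - g2 z).
Proof.
move=> [l1 p1] [l2 p2]; split=> [a Va|z Vz]; last exact: (ulimB UU (p1 z Vz) (p2 z Vz)).
have [r1 [M1 [r10 r1V h1M]]] := l1 a Va; have [r2 [M2 [r20 r2V h2M]]] := l2 a Va.
have s1 : disc a (Num.min r1 r2) `<=` disc a r1 by apply: disc_sub; rewrite ge_min lexx.
have s2 : disc a (Num.min r1 r2) `<=` disc a r2 by apply: disc_sub; rewrite ge_min lexx orbT.
exists (Num.min r1 r2), (M1 + M2); split; [by rewrite lt_min r10|exact: subset_trans r1V|].
apply: filterS2 h1M h2M => j [a1 b1] [a2 b2]; split.
  exact: holB (hol_sub s1 a1) (hol_sub s2 a2).
by move=> z zm; apply: le_trans (cnB _ _) (lerD (b1 z (s1 z zm)) (b2 z (s2 z zm))).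
Qed.

(** If it is the inverses that are bounded, their limit at [a] is nonzero because [F a] is finite;
    by equicontinuity they stay away from 0 on a smaller disc, where they can be inverted back. *)
Lemma slim_finite V u F a : chart_bounded U V u -> slim U u F -> V a -> F a <> None ->
  exists r M, [/\ 0 < r, disc a r `<=` V, slimit U (disc a r) u F &
    \forall j \near U, chart (disc a r) (u j) M].
Proof.
move=> H uF Va Fa; have [r [r0 rV [[M hM h]|[M hM [h1 h2]]]]] := slim_cases UU H uF Va.
  by exists r, M; split; [exact: r0|exact: rV|exact: h|exact: hM].
have ar := disc_center a r0; have f0 : fin (F a) != 0.
  apply/eqP => f0; apply: (h1 a ar); apply/sinv_None.
  by rewrite (finE Fa) f0.
pose y := cn (fin (sinv (F a))); have y0 : 0 < y.
  by rewrite /y fin_sinv cnV invr_gt0 cn_gt0.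
have y2 : 0 < y / 2 by rewrite divr_gt0.
have [d d0 hd] := flim_tight UU h2 ar y2.
have m0 : 0 < Num.min d r by rewrite lt_min d0.
have mr : disc a (Num.min d r) `<=` disc a r by apply: disc_sub; rewrite ge_min lexx orbT.
have md : disc a (Num.min d r) `<=` disc a d by apply: disc_sub; rewrite ge_min lexx.
have cM : \forall j \near U, chart (disc a (Num.min d r)) (u j) (y / 2)^-1.
  apply: filterS2 hM hd => j [j1 [jh _]] jd.
  have low z : disc a (Num.min d r) z -> y / 2 <= cn ((fin \o (sinv \o u j)) z).
    move=> /md /(jd z) h; have := cn_lb ((fin \o (sinv \o F)) a) ((fin \o (sinv \o u j)) z).
    rewrite cnC => h'; have := le_lt_trans h' h; rewrite -/y.
    by move: (cn _) => t; rewrite /y /=; lra.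
  have nz z : disc a (Num.min d r) z -> (fin \o (sinv \o u j)) z != 0.
    by move=> /low h; rewrite -cn_gt0; lra.
  have E : fin \o u j = (fun z => ((fin \o (sinv \o u j)) z)^-1).
    by apply/funext => z /=; rewrite fin_sinv invrK.
  split=> [z /nz|].
    by rewrite /= fin_sinv invr_eq0 => /eqP + uN; rewrite uN.
  rewrite E; split; first exact: holV (hol_sub mr jh) nz.
  by move=> z zm; rewrite cnV lef_pV2 ?posrE ?low// cn_gt0 nz.
exists (Num.min d r), (y / 2)^-1; split; [exact: m0|exact: subset_trans rV| |exact: cM].
exact: (slim_fin UU uF cM).
Qed.

End LimitTools.

(* With q = k + l + 1, beta = b / N and gamma = c / N this says
   beta < 1 - q / n, gamma < 1 - (l + 1) / m, beta + gamma > 1, and that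
   W^N / (G^b Rr^c) of plane_rigidity vanishes at the poles of F. *)
Definition rigid_exponents (n m k l : nat) : Prop := exists N b c,
  [/\ (b < N)%N, (c < N)%N, (N < b + c)%N, (N * (k + l).+1 + b * n < N * n)%N &
   [/\ (N * l.+1 + c * m < N * m)%N, (N * (n + (k + l).+1) < b * n + c * (n + k))%N,
     ((k + l).+1 <= n)%N & (l < m)%N]].

Section RescaledLimit.
Variable R : realType.
Local Notation C := R[i].
Local Notation hol := (@holomorphic R).
Variables (n m k l : nat).
Implicit Types (V : set C) (a z w : C) (r s M e : R) (v F : C -> sphere R) (P : C -> C).

(* The zeros and poles of v have order at least n, the zeros of v^(k) - P order
   at least m. *)
Definition multiplicities V v P := forall z, V z ->
  [/\ v z = Some 0 -> forall i, (i < n)%N -> derive1n i (fin \o v) z = 0,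
      v z = None -> forall i, (i < n)%N -> derive1n i (fin \o (sinv \o v)) z = 0 &
      v z <> None -> derive1n k (fin \o v) z - P z = 0 ->
        forall i, (i < m)%N -> derive1n i (fun w => derive1n k (fin \o v) w - P w) z = 0].

(* The alternative replacing a bound on spherical derivatives: on V either |v| is
   at most K |P| or |P| is at most K |v|. *)
Definition one_sided V v P K := dominated V v P K \/ dominating V v P K.

(** The radius 1/2 is the scale at which point picking guarantees the alternative, once the picked
    scale has been normalised to 1. *)
Definition tame A v P K := [/\ sphol (disc 0 A) v, hol (disc 0 A) P,
  forall z, disc 0 A z -> one_sided (disc z (1 / 2)) v P K,
  forall z, disc 0 A z -> ~ (P z = 0 /\ v z = Some 0) & multiplicities (disc 0 A) v P].

Variable U : set_system nat.
Hypothesis UU : UltraFilter U.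
Variables (K : R) (c0 : C) (Fs : nat -> C -> sphere R) (Ps : nat -> C -> C).
Hypotheses (rig : rigid_exponents n m k l) (k0 : (0 < k)%N) (c00 : c0 != 0) (K0 : 0 <= K).
Hypothesis Ft : forall A : R, 0 < A -> \forall j \near U, tame A (Fs j) (Ps j) K.
Hypothesis Pb : forall A : R, 0 < A -> exists M, \forall j \near U,
  forall z, disc 0 A z -> cn (Ps j z) <= M.
Hypothesis Pl : forall z, ulim U (fun j => Ps j z) (c0 * z ^+ l).
Hypothesis P0 : (0 < l)%N -> \forall j \near U, Ps j 0 = 0.

Let Pinf z : C := c0 * z ^+ l.

Let in0 a r : disc a r `<=` disc 0 (cn a + r).
Proof. by apply: disc_in; rewrite subr0. Qed.

Let flimP : flim U setT Ps Pinf.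
Proof.
split=> [a _|z _]; last exact: Pl.
have A0 : 0 < cn a + 1 by rewrite ltr_wpDl ?cn_ge0.
have [M hM] := Pb A0; exists 1, M; split; [exact: ltr01|by []|].
apply: filterS2 (Ft A0) hM => j [_ Ph _ _ _] jM; split.
  exact: hol_sub (@in0 a 1) Ph.
by move=> z /in0; exact: jM.
Qed.

Let Pinf_nz a s : 0 < s -> exists2 z, disc a s z & Pinf z != 0.
Proof.
move=> s0; have [z za z0] : exists2 z, disc a s z & z != 0.
  have [->|a0] := eqVneq a 0; first exact: disc_punctured.
  by exists a; [exact: disc_center|].
by exists z => //; rewrite mulf_neq0 ?expf_neq0.
Qed.

(** The limit [c0 z^l] is bounded below on an annulus about [a], so either side of the alternative
    bounds [Fs j] or its inverse. In the first case the value at [a] is recorded for [limit_0]. *)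
Let charts a : exists r M, 0 < r /\ \forall j \near U,
  [/\ Fs j a <> None, cn (fin (Fs j a)) <= K * cn (Ps j a) & chart (disc a r) (Fs j) M] \/
  chart (disc a r) (sinv \o Fs j) M.
Proof.
have h0 : 0 < 1 / 2 :> R by rewrite divr_gt0.
have Ph : hol (disc a (1 / 2)) Pinf.
  by apply: hol_sub (flim_hol UU flimP); exact: subsetT.
have [[s s0 hs]|[s [e [s0 e0 sr gl]]]] := annulus_lower h0 Ph.
  by have [z /hs z0 /eqP] := Pinf_nz a s0.
have A0 : 0 < cn a + 1 / 2 by rewrite ltr_wpDl ?cn_ge0.
have [M hM] := Pb A0.
have hP := flim_annulus UU flimP e0 (fun z _ => I) gl.
have e2 : 0 < e / 2 by rewrite divr_gt0.
exists s, (Num.max (K * M) (K / (e / 2))); split; first exact: s0.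
apply: filterS3 (Ft A0) hM hP => j [Fh _ jo jn _] jM jP.
have sub := @in0 a (1 / 2).
have sub2 : disc a s `<=` disc a (1 / 2) by apply: disc_sub; lra.
have Fh2 : sphol (disc a (1 / 2)) (Fs j) by exact: sphol_sub Fh.
have a0 : disc 0 (cn a + 1 / 2) a by exact/sub/disc_center.
case: (jo a a0) => o; [left|right].
  have [Fa Pa] := o a (disc_center a h0).
  split; [exact: Fa|exact: Pa|].
  apply: (@chart_le _ _ _ (K * M)); first by rewrite le_max lexx.
  apply: (dominated_chart (psi := Ps j)) => //; first exact: sphol_sub Fh2.
    by move=> z /sub2; exact: o.
  by move=> z /sub2/sub; exact: jM.
apply: (@chart_le _ _ _ (K / (e / 2))); first by rewrite le_max lexx orbT.
apply: (dominating_chart Fh2 o K0 _ s0 (ltW sr) e2 jP).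
by move=> z /sub; exact: jn.
Qed.

Lemma rescaled_chart_bounded : chart_bounded U setT Fs.
Proof.
move=> a _; have [r [M [r0 h]]] := charts a; exists r, M; split; [exact: r0|by []|].
by apply: filterS h => j [[_ _ c]|c]; [left|right].
Qed.

Variable F : C -> sphere R.
Hypothesis sF : slim U Fs F.

Let mult_near a r : 0 < r -> \forall j \near U, multiplicities (disc a r) (Fs j) (Ps j).
Proof.
move=> r0; have A0 : 0 < cn a + r by rewrite ltr_wpDl ?cn_ge0.
by apply: filterS (Ft A0) => j [_ _ _ _ h] z /in0; exact: h.
Qed.

Let ulim_le2 (b1 b2 : nat -> C) x y : ulim U b1 x -> ulim U b2 y ->
  (\forall j \near U, cn (b1 j) <= cn (b2 j)) -> cn x <= cn y.
Proof.
move=> h1 h2 h; apply/ler_addgt0Pl => e e0; have e2 : 0 < e / 2 by rewrite divr_gt0.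
have [j [j1 [j2 j3]]] := ultra_ex UU (filterI (h1 _ e2) (filterI (h2 _ e2) h)).
by have := cn_lb x (b1 j); have := cn_lb (b2 j) y; rewrite cnC in j1; lra.
Qed.

Lemma limit_zero a : F a = Some 0 -> forall i, (i < n)%N -> derive1n i (fin \o F) a = 0.
Proof.
move=> Fa; have Fn : F a <> None by rewrite Fa.
have [r [M [r0 _ [h1 h2] hM]]] := slim_finite UU rescaled_chart_bounded sF I Fn.
apply: (hurwitz_mult UU h2 r0 (@subset_refl _ _)); last by rewrite /= Fa.
  by apply: filterS hM => j [_ [h _]].
apply: filterS2 hM (mult_near a r0) => j [jN _] jm z zr fz.
have [h _ _] := jm z zr; apply: h; rewrite (finE (jN z zr)); congr Some; exact: fz.
Qed.

Lemma limit_pole a j : pole_of_order F a j -> (n <= j)%N.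
Proof.
move=> pF; have [Fa _ _] := pF.
have [r [r0 _ [[M _ [h1 _]]|[M hM h]]]] := slim_cases UU rescaled_chart_bounded sF (I : setT a).
  by case: (h1 a (disc_center a r0)).
apply: (order_pole r0 (slimit_finhol UU h) pF).
apply: (hurwitz_mult UU h.2 r0 (@subset_refl _ _)); last by rewrite /= Fa.
  by apply: filterS hM => i [_ [h3 _]].
apply: filterS2 hM (mult_near a r0) => i [jN _] jm z zr fz.
have [_ hp _] := jm z zr; apply: hp.
rewrite -[Fs i z]sinvK; apply/sinv_None; have e := finE (jN z zr).
by apply: (etrans e); congr Some; exact: fz.
Qed.

Lemma limit_diff a : F a <> None -> derive1n k (fin \o F) a - Pinf a = 0 ->
  forall i, (i < m)%N -> derive1n i (fun z => derive1n k (fin \o F) z - Pinf z) a = 0.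
Proof.
move=> Fa Ra; have [r [M [r0 _ [h1 h2] hM]]] := slim_finite UU rescaled_chart_bounded sF I Fa.
have A0 : 0 < cn a + r by rewrite ltr_wpDl ?cn_ge0.
have fP : flim U (disc a r) Ps Pinf.
  split=> [z zr|z _]; last exact: Pl.
  have [M' hM'] := Pb A0; apply: (loc_bounded_disc UU (M := M') _ zr).
  apply: filterS2 (Ft A0) hM' => j [_ Ph _ _ _] jM; split; first exact: hol_sub (@in0 a r) Ph.
  by move=> w /in0; exact: jM.
have fR := flimB UU (flim_dvn UU k h2) fP.
apply: (hurwitz_mult UU fR r0 (@subset_refl _ _)); last exact: Ra.
  apply: filterS2 hM (Ft A0) => j [_ [fh _]] [_ Ph _ _ _].
  apply: holB; first exact: (dvn_hol (i := k) (@disc_open _ a r) fh).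
  exact: hol_sub (@in0 a r) Ph.
apply: filterS2 hM (mult_near a r0) => j [jN _] jm z zr.
by have [_ _ h] := jm z zr; apply: h; exact: jN.
Qed.

(** As [Ps j] vanishes at 0, domination there would make 0 a common zero. Hence it is the inverses
    of the [Fs j] that are bounded near 0, and the limit cannot vanish there. *)
Lemma limit_0 : (0 < l)%N -> F 0 <> Some 0.
Proof.
move=> l0; have [r [M [r0 h]]] := charts 0.
have A0 : 0 < 1 :> R by [].
have h2 : \forall j \near U, chart (disc 0 r) (sinv \o Fs j) M.
  apply: filterS3 h (P0 l0) (Ft A0) => j jh p0 [_ _ _ jn _]; case: jh => [[FN le _]|c]; last exact: c.
  case: (jn 0 (disc_center 0 A0)); split; first exact: p0.
  rewrite (finE FN); congr Some; apply/eqP.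
  by move: le; rewrite p0 cn0 mulr0 -cn_eq0 eq_le cn_ge0 andbT.
have [h3 _] := slim_inv UU sF h2.
by move=> /sinv_None; exact: h3 (disc_center 0 r0).
Qed.

(** Finiteness of the limit is part of the claim: in the chart at infinity the inequality reads
    [8 <= |P / F|], which survives in the limit and excludes an infinite value. *)
Lemma limit_below a ws : ulim U ws a ->
  (\forall j \near U, Fs j (ws j) <> None /\ 8 * cn (fin (Fs j (ws j))) <= cn (Ps j (ws j))) ->
  F a <> None /\ 8 * cn (fin (F a)) <= cn (Pinf a).
Proof.
move=> wa h; have lP := flim_seq UU flimP (I : setT a) wa.
have c8 : cn (8 : C) = 8 by rewrite cn_nat.
have [r [r0 _ [[M hM [h1 h2]]|[M hM [h1 h2]]]]] := slim_cases UU rescaled_chart_bounded sF (I : setT a).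
  have ar := disc_center a r0; have lF := flim_seq UU h2 ar wa.
  split; first exact: h1.
  rewrite -c8 -cnM; apply: (ulim_le2 (ulimM UU (ulim_cst UU 8) lF) lP).
  by apply: filterS h => j [_]; rewrite cnM c8.
have ar := disc_center a r0; have lF := flim_seq UU h2 ar wa.
have : cn (8 : C) <= cn (Pinf a * (fin \o (sinv \o F)) a).
  apply: (ulim_le2 (ulim_cst UU 8) (ulimM UU lP lF)).
  apply: filterS3 h hM (wa r r0) => j [FN le] [jN _] wr; rewrite c8 cnM /= fin_sinv cnV.
  rewrite ler_pdivlMr// cn_gt0; apply/eqP => f0; apply: (jN _ wr); apply/sinv_None.
  by rewrite (finE FN) f0.
rewrite c8 cnM /= fin_sinv cnV => h8.
have f0 : 0 < cn (fin (F a)).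
  rewrite lt_def cn_ge0 andbT; apply/eqP => f0.
  by move: h8; rewrite f0 invr0 mulr0; lra.
split; last by rewrite -ler_pdivlMr.
by move=> FN; move: f0; rewrite FN fin_None cn0 ltxx.
Qed.

Lemma limit_above a ws : ulim U ws a ->
  (\forall j \near U, Fs j (ws j) <> None -> 8 * cn (Ps j (ws j)) <= cn (fin (Fs j (ws j)))) ->
  F a <> None -> 8 * cn (Pinf a) <= cn (fin (F a)).
Proof.
move=> wa h Fa; have lP := flim_seq UU flimP (I : setT a) wa.
have c8 : cn (8 : C) = 8 by rewrite cn_nat.
have [r [M [r0 _ [h1 h2] hM]]] := slim_finite UU rescaled_chart_bounded sF (I : setT a) Fa.
have lF := flim_seq UU h2 (disc_center a r0) wa.
rewrite -c8 -cnM; apply: (ulim_le2 (ulimM UU (ulim_cst UU 8) lP) lF).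
apply: filterS3 h hM (wa r r0) => j jh [jN _] wr; rewrite cnM c8; apply: jh.
exact: jN.
Qed.

End RescaledLimit.

(** Failure of both sides at unit scale gives bounded points with [8 |P| <= |F|] or [F] infinite,
    and others with [8 |F| <= |P|]; both pass to the limit. There [plane_rigidity] makes [F] a
    constant [v] with [l = 0], so [8 |c0| <= |v|] and [8 |v| <= |c0|]. *)
Theorem rescaling_impossible (R : realType) (n m k l : nat) (U : set_system nat)
    (UU : UltraFilter U) (K B : R) (c0 : R[i]) (Fs : nat -> R[i] -> sphere R)
    (Ps : nat -> R[i] -> R[i]) (zs : nat -> R[i]) :
  rigid_exponents n m k l -> (0 < k)%N -> c0 != 0 -> 0 <= K ->
  (forall A : R, 0 < A -> \forall j \near U, tame n m k A (Fs j) (Ps j) K) ->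
  (forall A : R, 0 < A -> exists M, \forall j \near U, forall z, disc 0 A z -> cn (Ps j z) <= M) ->
  (forall z, ulim U (fun j => Ps j z) (c0 * z ^+ l)) ->
  ((0 < l)%N -> \forall j \near U, Ps j 0 = 0) ->
  (\forall j \near U, cn (zs j) <= B) ->
  (\forall j \near U, ~ one_sided (disc (zs j) 1) (Fs j) (Ps j) 8) -> False.
Proof.
move=> rig k0 c00 K0 Ft Pb Pl P0 zB nopt.
have [F sF] := slim_ex UU Fs.
have near_pt (Q : nat -> R[i] -> Prop) :
    (\forall j \near U, exists2 w, disc (zs j) 1 w & Q j w) ->
    exists ws, exists2 a, ulim U ws a & \forall j \near U, Q j (ws j).
  move=> hQ; have /choice[ws hws] : forall j, exists w,
      (exists2 w, disc (zs j) 1 w & Q j w) -> disc (zs j) 1 w /\ Q j w.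
    move=> j; have [[w w1 w2]|nw] := pselect (exists2 w, disc (zs j) 1 w & Q j w).
      by exists w.
    by exists 0 => /nw.
  have hw : \forall j \near U, disc (zs j) 1 (ws j) /\ Q j (ws j) by apply: filterS hQ => j /hws.
  have [|a ha] := @ulim_ex _ _ UU ws (B + 1).
    apply: filterS2 hw zB => j [w1 _] zj; have := cn_lb (ws j) (zs j).
    by move: w1; rewrite /disc /=; lra.
  by exists ws, a => //; apply: filterS hw => j [].
have [w1 [a1 wa1 h1]] : exists ws, exists2 a, ulim U ws a & \forall j \near U,
    Fs j (ws j) <> None -> 8 * cn (Ps j (ws j)) <= cn (fin (Fs j (ws j))).
  apply: (near_pt (fun j w => Fs j w <> None -> 8 * cn (Ps j w) <= cn (fin (Fs j w)))).
  apply: filterS nopt => j no; apply: contrapT => nw; apply: no; left.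
  move=> y yd; apply: contrapT => ny; apply: nw; exists y; first exact: yd.
  move=> yN.
  by rewrite leNgt; apply/negP => lt; apply: ny; split; [exact: yN|exact: ltW].
have [w2 [a2 wa2 h2]] : exists ws, exists2 a, ulim U ws a & \forall j \near U,
    Fs j (ws j) <> None /\ 8 * cn (fin (Fs j (ws j))) <= cn (Ps j (ws j)).
  apply: (near_pt (fun j w => Fs j w <> None /\ 8 * cn (fin (Fs j w)) <= cn (Ps j w))).
  apply: filterS nopt => j no; apply: contrapT => nw; apply: no; right.
  move=> y yd yN; rewrite leNgt; apply/negP => lt; apply: nw; exists y; first exact: yd.
  by split; [exact: yN|exact: ltW].
have [F2 b2] := limit_below UU c00 K0 Ft Pb Pl sF wa2 h2.
have b1 := limit_above UU c00 K0 Ft Pb Pl sF wa1 h1.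
have [mF|FN] := sphol_mero openT (@connected_plane R)
  (slim_sphol UU (rescaled_chart_bounded UU c00 K0 Ft Pb Pl) sF); last by apply: F2; exact: FN.
have [N [b [c [bN cN Nbc H1 [H2 H3 qn lm]]]]] := rig.
have [l0 [v Fv]] := plane_rigidity c00 k0 qn lm bN cN Nbc H1 H2 H3 mF
  (fun a => limit_zero UU c00 K0 Ft Pb Pl sF (a := a))
  (fun a j => limit_pole UU c00 K0 Ft Pb Pl sF (a := a) (j := j))
  (fun a => limit_diff UU c00 K0 Ft Pb Pl sF (a := a))
  (limit_0 UU c00 K0 Ft Pb Pl P0 sF).
have p : 0 < cn c0 by rewrite cn_gt0.
move: b1 b2; rewrite !Fv !fin_Some l0 !expr0 mulr1 => /(_ (fun h => ltac:(discriminate h))).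
by lra.
Qed.

(** * Rescaling a family *)

Section RealEstimates.
Variable R : realType.
Implicit Types (W r t x : R).

Lemma bernoulli x E : 0 <= x <= 1 -> 1 - E%:R * x <= (1 - x) ^+ E.
Proof.
move=> /andP[x0 x1]; elim: E => [|E IH]; first by rewrite mul0r subr0 expr0.
rewrite exprS; have h : (1 - x) * (1 - E%:R * x) <= (1 - x) * (1 - x) ^+ E.
  by rewrite ler_wpM2l// subr_ge0.
apply: le_trans h; rewrite -natr1.
have : 0 <= E%:R * x * x by rewrite !mulr_ge0.
by move: (E%:R : R) => e; lra.
Qed.

(** By Bernoulli [(1 - r / W)^E] is at least 1/2, and [(1 + r / W)^E] is at most its inverse because
    [(1 + x) (1 - x) <= 1]. *)
Lemma pow_ratio E W r t : (0 < E)%N -> 0 < r -> 2 * E%:R * r < W -> W - r <= t -> t <= W + r ->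
  W ^+ E / 2 <= t ^+ E /\ t ^+ E <= 2 * W ^+ E.
Proof.
move=> E0 r0 rW t1 t2; have e1 : 1 <= E%:R :> R by rewrite ler1n.
have W0 : 0 < W by apply: lt_trans rW; rewrite !mulr_gt0// ltr0n.
have rr : r <= E%:R * r by rewrite ler_peMl// ltW.
have x0 : 0 < r / W by rewrite divr_gt0.
have Ex : E%:R * (r / W) <= 1 / 2.
  by rewrite mulrA ler_pdivrMr//; move: rW; rewrite -mulrA; lra.
have x1 : r / W <= 1 by rewrite ler_pdivrMr//; rewrite -mulrA in rW; lra.
have b : 1 / 2 <= (1 - r / W) ^+ E.
  by apply: le_trans (bernoulli E _); [lra|rewrite ltW].
have W1 : W - r = W * (1 - r / W) by field; rewrite gt_eqF.
have W2 : W + r = W * (1 + r / W) by field; rewrite gt_eqF.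
have nx : 0 <= 1 - r / W by rewrite subr_ge0.
split.
  have : (W - r) ^+ E <= t ^+ E.
    apply: lerXn2r => //; rewrite nnegrE; first by rewrite W1 mulr_ge0// ltW.
    by apply: le_trans t1; rewrite W1 mulr_ge0// ltW.
  apply: le_trans; rewrite W1 exprMn; apply: le_trans (ler_wpM2l (exprn_ge0 E (ltW W0)) b).
  by rewrite mul1r.
have t0 : 0 <= t by apply: le_trans t1; rewrite W1 mulr_ge0// ltW.
apply: (@le_trans _ _ ((W + r) ^+ E)).
  by apply: lerXn2r; rewrite ?nnegrE// addr_ge0// ltW.
rewrite W2 exprMn mulrC; apply: ler_wpM2r; first by rewrite exprn_ge0// ltW.
have le1 : ((1 + r / W) * (1 - r / W)) ^+ E <= 1.
  apply: exprn_ile1; first by rewrite mulr_ge0// addr_ge0// ltW.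
  have : 0 <= (r / W) * (r / W) by rewrite mulr_ge0// ltW.
  by move: (r / W) => x; lra.
have p0 : 0 <= (1 + r / W) ^+ E by rewrite exprn_ge0// addr_ge0// ltW.
have := ler_wpM2l p0 b; rewrite -exprMn => h.
by have := le_trans h le1; move: (_ ^+ E) => y; lra.
Qed.

End RealEstimates.

Section LocalGood.
Variable R : realType.
Local Notation C := R[i].
Local Notation hol := (@holomorphic R).
Implicit Types (V : set C) (a z w : C) (r s M e K : R) (v : C -> sphere R) (psi : C -> C).

Lemma sphol_chart V v a : sphol V v -> V a -> v a <> None ->
  exists r M, [/\ 0 < r, 0 < M & chart (disc a r) v M].
Proof.
move=> vh Va vN; have [r [r0 [v1 v2]]] : exists r, 0 < r /\ finhol (disc a r) v.
  have [r r0 [h|[h1 h2]]] := vh a Va; first by exists r; split; [exact: r0|exact: h].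
  have f0 : (fin \o (sinv \o v)) a != 0.
    rewrite /= fin_sinv invr_eq0; apply/eqP => f0; apply: (h1 a (disc_center a r0)).
    by apply/sinv_None; rewrite (finE vN) f0.
  have [s /andP[s0 sr] hs] := nonzero_disc r0 h2 f0; exists s; split; first exact: s0.
  split=> [z /hs|]; first by rewrite /= fin_sinv invr_eq0 => /eqP + zN; rewrite zN.
  have -> : fin \o v = (fun z => ((fin \o (sinv \o v)) z)^-1).
    by apply/funext => z /=; rewrite fin_sinv invrK.
  exact: holV (hol_sub (disc_sub sr) h2) hs.
have r4 : 0 < r / 4 by rewrite divr_gt0.
have r4r : 2 * (r / 4) < r by lra.
have [M M0 hM] := hol_bounded r4 r4r v2.
have sub : disc a (r / 4) `<=` disc a r by apply: disc_sub; lra.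
exists (r / 4), M; split; [exact: r4|exact: M0|].
split; first by move=> z /sub; exact: v1.
by split; [exact: hol_sub v2|move=> z zr; exact: hM].
Qed.

Lemma near_const (g : C -> C) a e : derivable g a 1 -> 0 < e ->
  exists2 d, 0 < d & forall z, disc a d z -> cn (g z - g a) < e.
Proof.
by move=> /derivable_cont/cont_discP ca e0; have [d d0 hd] := ca e e0; exists d.
Qed.

Lemma near_ratio2 (g : C -> C) a : derivable g a 1 -> g a != 0 ->
  exists e, 0 < e /\ exists2 d, 0 < d & forall z, disc a d z -> e <= cn (g z) <= 2 * e.
Proof.
move=> gh g0; have p : 0 < cn (g a) by rewrite cn_gt0.
have e0 : 0 < cn (g a) / 4 by rewrite divr_gt0.
have [d d0 hd] := near_const gh e0; exists (3 / 4 * cn (g a)); split; first lra.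
exists d => // z /hd h; have := cn_lb (g z) (g a); have := cn_lb (g a) (g z).
by rewrite cnC => h1 h2; apply/andP; split; lra.
Qed.

Lemma fin_mpow v n z : (0 < n)%N -> fin (mpow v n z) = fin (v z) ^+ n.
Proof. by move=> n0; rewrite /mpow; case: (v z) => //=; rewrite /fin /= expr0n gtn_eqF. Qed.

Lemma mpow_None v n z : mpow v n z = None <-> v z = None.
Proof. by rewrite /mpow; case: (v z). Qed.

Lemma mpow_0 v n z : (0 < n)%N -> mpow v n z = Some 0 <-> v z = Some 0.
Proof.
move=> n0; rewrite /mpow; case: (v z) => [x|] //=; split=> [[/eqP]|[->]].
  by rewrite expf_eq0 n0 => /eqP ->.
by rewrite expr0n gtn_eqF.
Qed.

(* Near a zero z of v of order N > k: for |w - z| <= 2 N r the r^N-smallness of v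
   on disc w r beats r^k, while for |w - z| > 2 N r Bernoulli's inequality makes v
   nearly constant in modulus on disc w r. *)
Lemma local_good V v psi n k z : sphol V v -> V z -> derivable psi z 1 -> (0 < k)%N -> (k < n)%N ->
  ~ (psi z = 0 /\ v z = Some 0) ->
  exists2 d, 0 < d & forall w r, cn (w - z) < d -> 0 < r < d ->
    one_sided (disc w r) (mpow v n) (fun y => (rC r : C) ^+ k * psi y) 8.
Proof.
move=> vh Vz ph k0 kn nz; have n0 : (0 < n)%N by exact: leq_ltn_trans kn.
have cq r y : 0 < r -> cn ((rC r : C) ^+ k * psi y) = r ^+ k * cn (psi y).
  by move=> r0; rewrite cnM cnX cn_rC_pos.
(* If [v z] is not 0, possibly infinite, then [1 / v^n] is bounded near [z] while [r^k psi] is small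
   with [r], so the second side of the alternative holds. *)
have [vz|vz] := pselect (v z = Some 0); last first.
  have vn : sphol V (sinv \o mpow v n) by exact: sphol_sinv (sphol_mpow n0 vh).
  have vnz : (sinv \o mpow v n) z <> None by move=> /sinv_None/(mpow_0 _ _ n0)/vz.
  have [r0 [M [r00 M0 [c1 [_ c2]]]]] := sphol_chart vn Vz vnz.
  have [d0 d00 hd] := near_const ph ltr01.
  pose Q := cn (psi z) + 1; have Q0 : 0 < Q by rewrite ltr_wpDl ?cn_ge0.
  exists (Num.min (Num.min r0 d0 / 2) (Num.min 1 (8 / (Q * M)))).
    have a1 : 0 < Num.min r0 d0 / 2 by rewrite divr_gt0// lt_min r00.
    have a2 : 0 < 8 / (Q * M) by rewrite divr_gt0// mulr_gt0.
    by rewrite !lt_min a1 a2 ltr01.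
  move=> w r; rewrite !lt_min => /andP[wz _] /andP[rp /and3P[rm r1 rQ]]; right=> y yr yN.
  have : disc z (Num.min r0 d0) y.
    by apply: le_lt_trans (cn_tri w _ _) _; rewrite [ltRHS]splitr; apply: ltrD => //; exact: lt_trans yr rm.
  rewrite /disc /= lt_min => /andP[yr0 yd0].
  have := c2 y yr0; have := c1 y yr0; rewrite /= fin_sinv cnV.
  have [f0|f0 _ fM] := eqVneq (fin (mpow v n y)) 0.
    by case; apply/sinv_None; rewrite (finE yN) f0.
  have fp : 0 < cn (fin (mpow v n y)) by rewrite cn_gt0.
  have fM1 : 1 <= M * cn (fin (mpow v n y)) by move: fM; rewrite -[X in X <= _]mul1r ler_pdivrMr.
  rewrite cq//; apply: (@le_trans _ _ (r * Q)).
    apply: ler_pM; rewrite ?exprn_ge0 ?cn_ge0 ?(ltW rp)//.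
      by rewrite -{2}[r]expr1; apply: ler_wiXn2l => //; exact: ltW.
    by have := hd y yd0; have := cn_lb (psi y) (psi z); rewrite /Q; lra.
  move: rQ; rewrite ltr_pdivlMr ?mulr_gt0// => rQ.
  rewrite -(ler_pM2r M0) -mulrA; apply: le_trans (ltW rQ) _.
  by rewrite -mulrA [_ * M]mulrC; lra.
have pz : psi z != 0 by apply/eqP => p0; apply: nz.
have vN : v z <> None by rewrite vz.
have [r0 [M [r00 _ [c1 [ch _]]]]] := sphol_chart vh Vz vN.
have fz : fin (v z) = 0 by rewrite vz.
have [[s s0 hs]|[E [q [qh qz qE]]]] := hol_order r00 ch.
  exists (Num.min r0 s / 2); first by rewrite divr_gt0 ?lt_min ?r00.
  move=> w r wz /andP[rp rm]; left=> y yr.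
  have : disc z (Num.min r0 s) y.
    by apply: le_lt_trans (cn_tri w _ _) _; rewrite [ltRHS]splitr; apply: ltrD => //; exact: lt_trans yr rm.
  rewrite /disc /= lt_min => /andP[yr0 /hs /= ys]; split; first by move=> /mpow_None; exact: c1.
  by rewrite fin_mpow// ys expr0n gtn_eqF// cn0 mulr_ge0 ?cn_ge0.
have E0 : (0 < E)%N.
  case: E qE => // qE; have := qE z; rewrite /= fz expr0 mul1r => q0.
  by rewrite -q0 eqxx in qz.
have [h [h0 [d1 d10 hd1]]] := near_ratio2 (holX (n := n) qh (disc_center z r00)) (expf_neq0 n qz).
have [p [p0 [d2 d20 hd2]]] := near_ratio2 ph pz.
pose N := (E * n)%N; have N0 : (0 < N)%N by rewrite muln_gt0 E0.
have kN : (k < N)%N by rewrite (leq_trans kn)// leq_pmull.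
pose T : R := (2 * N%:R + 1) ^+ N; have T0 : 0 < T by rewrite exprn_gt0// ltr_wpDl// mulr_ge0.
pose m := Num.min r0 (Num.min d1 d2); have m0 : 0 < m by rewrite !lt_min r00 d10.
exists (Num.min (m / 2) (Num.min 1 (4 * p / (T * h)))).
  have a1 : 0 < m / 2 by rewrite divr_gt0.
  have a2 : 0 < 4 * p / (T * h) by rewrite divr_gt0// mulr_gt0.
  by rewrite !lt_min a1 a2 ltr01.
move=> w r; rewrite !lt_min => /andP[wz _] /andP[rp /and3P[rm r1 rT]].
have inm y : disc w r y -> [/\ disc z r0 y, disc z d1 y & disc z d2 y].
  move=> yr; have : disc z m y.
    by apply: le_lt_trans (cn_tri w _ _) _; rewrite [ltRHS]splitr; apply: ltrD => //; exact: lt_trans yr rm.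
  by rewrite /disc /m /= !lt_min => /and3P[].
have vE y : cn (fin (mpow v n y)) = cn (y - z) ^+ N * cn (q y ^+ n).
  have e : fin (v y) = (y - z) ^+ E * q y by exact: qE.
  by rewrite fin_mpow// e exprMn -exprM cnM !cnX.
have Tr y : disc w r y -> cn (y - z) <= (2 * N%:R + 1) * r -> cn (fin (mpow v n y)) <= 8 * cn ((rC r : C) ^+ k * psi y).
  move=> yr yT; have [_ /hd1/andP[_ h2] /hd2/andP[p1 _]] := inm y yr.
  rewrite vE cq//; apply: (@le_trans _ _ (T * r ^+ N * (2 * h))).
    apply: ler_pM; rewrite ?exprn_ge0 ?cn_ge0//.
    by rewrite /T -exprMn; apply: lerXn2r; rewrite ?nnegrE ?cn_ge0// mulr_ge0 ?ltW// ltr_wpDl// mulr_ge0.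
  apply: (@le_trans _ _ (8 * (r ^+ k * p))); last first.
    by rewrite ler_wpM2l// ler_wpM2l// exprn_ge0// ltW.
  have rN : r ^+ N <= r ^+ k * r.
    by rewrite -exprSr; apply: ler_wiXn2l => //; exact: ltW.
  apply: (@le_trans _ _ (T * (r ^+ k * r) * (2 * h))).
    by rewrite ler_wpM2r ?ler_wpM2l ?mulr_ge0// ltW.
  move: rT; rewrite ltr_pdivlMr ?mulr_gt0// => rT.
  have -> : T * (r ^+ k * r) * (2 * h) = 2 * (r ^+ k * (r * (T * h))) by ring.
  have : r ^+ k * (r * (T * h)) <= r ^+ k * (4 * p) by rewrite ler_wpM2l ?exprn_ge0// ltW.
  by move: (_ ^+ k) => x; lra.
have [wK|wK] := lerP (cn (w - z)) (2 * N%:R * r).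
  left=> y yr; have [yr0 _ _] := inm y yr.
  split; first by move=> /mpow_None; exact: c1.
  apply: Tr => //; apply: le_trans (cn_tri w _ _) _; rewrite mulrDl mul1r addrC.
  by apply: lerD => //; exact: ltW.
have near y : disc w r y -> cn (w - z) ^+ N / 2 <= cn (y - z) ^+ N /\ cn (y - z) ^+ N <= 2 * cn (w - z) ^+ N.
  move=> yr; apply: (pow_ratio N0 rp wK).
    have := cn_tri y w z; rewrite [cn (w - y)]cnC; move: yr; rewrite /disc /=; lra.
  have := cn_tri w y z; move: yr; rewrite /disc /=; lra.
have W0 : 0 <= cn (w - z) ^+ N by rewrite exprn_ge0 ?cn_ge0.
have rk0 : 0 < r ^+ k by rewrite exprn_gt0.
(* Write [W] for [|w - z|]. On the whole disc [|v^n|] lies between [W^N h / 2] and [4 W^N h], and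
   [|psi|] between [p] and [2 p], so comparing [W^N h] with [2 r^k p] decides the side, within the
   factor 8. *)
have [XY|XY] := lerP (cn (w - z) ^+ N * h) (2 * (r ^+ k * p)).
  left=> y yr; have [yr0 /hd1/andP[_ h2] /hd2/andP[p1 _]] := inm y yr.
  split; first by move=> /mpow_None; exact: c1.
  rewrite vE cq//; have [_ y2] := near y yr.
  apply: (@le_trans _ _ (2 * cn (w - z) ^+ N * (2 * h))).
    by apply: ler_pM; rewrite ?exprn_ge0 ?cn_ge0.
  apply: (@le_trans _ _ (8 * (r ^+ k * p))); last by rewrite ler_wpM2l// ler_wpM2l// ltW.
  by move: XY; move: (_ ^+ N) (_ ^+ k) => x y'; lra.
right=> y yr _; have [yr0 /hd1/andP[h1 _] /hd2/andP[_ p2]] := inm y yr.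
rewrite vE cq//; have [y1 _] := near y yr.
apply: (@le_trans _ _ (r ^+ k * (2 * p))); first by rewrite ler_wpM2l// ltW.
apply: (@le_trans _ _ (8 * (cn (w - z) ^+ N / 2 * h))).
  have : 0 <= cn (w - z) ^+ N * h by rewrite mulr_ge0// ltW.
  by move: XY; move: (_ ^+ N) (_ ^+ k) => x y'; lra.
by rewrite ler_wpM2l// ler_pM// ?divr_ge0// ltW.
Qed.

End LocalGood.

(** * Rescaling of sphere-valued functions *)

Section Scaled.
Variable R : realType.
Local Notation C := R[i].
Local Notation hol := (@holomorphic R).
Implicit Types (V D : set C) (a z w c : C) (v : C -> sphere R) (psi : C -> C).

Definition smul (s : C) (x : sphere R) : sphere R := omap (fun w => s * w) x.

Lemma fin_smul s x : fin (smul s x) = s * fin x.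
Proof. by case: x => //=; rewrite mulr0. Qed.

Lemma smul_None s x : smul s x = None <-> x = None.
Proof. by case: x. Qed.

Lemma smul_0 s x : s != 0 -> smul s x = Some 0 <-> x = Some 0.
Proof.
move=> s0; case: x => [z|] //=; split=> [[/eqP]|[->]]; last by rewrite mulr0.
by rewrite mulf_eq0 (negbTE s0) /= => /eqP ->.
Qed.

Lemma smulK s x : s != 0 -> smul s^-1 (smul s x) = x.
Proof. by move=> s0; case: x => [z|] //=; rewrite mulKf. Qed.

Lemma sinv_smul s x : s != 0 -> sinv (smul s x) = smul s^-1 (sinv x).
Proof.
move=> s0; case: x => [z|] /=; last by rewrite mulr0.
by rewrite mulf_eq0 (negbTE s0) /=; case: eqP => //= _; rewrite invfM.
Qed.

Definition scaled (c r s : C) v : C -> sphere R := fun w => smul s (v (c + r * w)).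

Lemma one_sided_scaled V W v psi (c r s t q : C) K K' :
  (forall w, W w -> V (c + r * w)) -> q != 0 ->
  K * cn (s * q) <= K' * cn t -> K * cn t <= K' * cn (s * q) ->
  one_sided V v (fun y => q * psi y) K -> one_sided W (scaled c r s v) (fun w => t * psi (c + r * w)) K'.
Proof.
move=> WV q0 h1 h2 [] o; [left|right]; move=> w /WV Vw.
  have [vN le] := o _ Vw; split; first by move=> /smul_None.
  rewrite /scaled fin_smul !cnM in le *.
  apply: (@le_trans _ _ (cn s * (K * (cn q * cn (psi (c + r * w)))))).
    by rewrite ler_wpM2l ?cn_ge0.
  rewrite cnM in h1; rewrite mulrA [K' * _]mulrA.
  have -> : cn s * K * (cn q * cn (psi (c + r * w))) = K * (cn s * cn q) * cn (psi (c + r * w)).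
    by ring.
  by rewrite ler_wpM2r ?cn_ge0.
move=> vN; have vN' : v (c + r * w) <> None by move=> E; apply: vN; rewrite /scaled E.
have := o _ Vw vN'; rewrite /scaled fin_smul !cnM => le.
have qp : 0 < cn q by rewrite cn_gt0.
rewrite -(ler_pM2l qp); rewrite cnM in h2.
have -> : cn q * (cn t * cn (psi (c + r * w))) = cn t * (cn q * cn (psi (c + r * w))) by ring.
apply: (@le_trans _ _ (cn t * (K * cn (fin (v (c + r * w)))))).
  by rewrite ler_wpM2l ?cn_ge0.
have -> : cn t * (K * cn (fin (v (c + r * w)))) = (K * cn t) * cn (fin (v (c + r * w))) by ring.
have -> : cn q * (K' * (cn s * cn (fin (v (c + r * w))))) =
  (K' * (cn s * cn q)) * cn (fin (v (c + r * w))) by ring.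
by rewrite ler_wpM2r ?cn_ge0.
Qed.

Lemma sinv_scaled c r s v : s != 0 -> sinv \o scaled c r s v = scaled c r s^-1 (sinv \o v).
Proof. by move=> s0; apply/funext => w; rewrite /scaled /= sinv_smul. Qed.

Lemma fin_scaled c r s v : fin \o scaled c r s v = (fun w => s * (fin \o v) (c + r * w)).
Proof. by apply/funext => w; rewrite /scaled /= fin_smul. Qed.

Lemma sphol_scaled V W v (c r s : C) : r != 0 -> s != 0 -> (forall w, W w -> V (c + r * w)) ->
  sphol V v -> sphol W (scaled c r s v).
Proof.
move=> r0 s0 WV vh w Ww; have [e e0 h] := vh _ (WV w Ww).
have rp : 0 < cn r by rewrite cn_gt0.
have sub x : disc w (e / cn r) x -> disc (c + r * w) e (c + r * x).
  rewrite /disc /= opprD addrACA subrr add0r -mulrBr cnM => h1.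
  by rewrite mulrC -ltr_pdivlMr.
have key u t : finhol (disc (c + r * w) e) u -> finhol (disc w (e / cn r)) (scaled c r t u).
  move=> [h1 h2]; split; first by move=> x /sub /h1 h3 /smul_None.
  by rewrite fin_scaled; exact (scale_hol h2 sub).
exists (e / cn r); first by rewrite divr_gt0.
by case: h => /key h; [left; exact: h|right; rewrite sinv_scaled//; exact: h].
Qed.

Lemma sphol_chart_in D v a : open D -> sphol D v -> D a -> v a <> None ->
  exists V, [/\ open V, V a, V `<=` D & hol V (fin \o v)].
Proof.
move=> oD vh Da vN; have [e [M [e0 _ [_ [h _]]]]] := sphol_chart vh Da vN.
exists (disc a e `&` D); split.
- by apply: openI; [exact: disc_open|exact: oD].
- by split; [exact: disc_center|exact: Da].
- by move=> z [].
- by move=> z [/h].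
Qed.

(** The choice [t = s r^k] makes the [k]-th derivative of the rescaled function minus [t psi] equal
    to [t] times the original difference, so its zeros keep their orders. *)
Lemma multiplicities_scaled n m k D W v psi (c r s t : C) : open D -> r != 0 -> s != 0 ->
  s * r ^+ k = t -> (forall w, W w -> D (c + r * w)) ->
  sphol D v -> hol D psi -> multiplicities n m k D v psi ->
  multiplicities n m k W (scaled c r s v) (fun w => t * psi (c + r * w)).
Proof.
move=> oD r0 s0 tE WD vh ph vm w Ww; have Dx := WD w Ww; have [m1 m2 m3] := vm _ Dx.
split.
- move=> /(smul_0 _ s0) v0 i im.
  have vN : v (c + r * w) <> None by rewrite v0.
  have [V [oV Vx _ fV]] := sphol_chart_in oD vh Dx vN.
  by rewrite fin_scaled (scale_dvn s i oV fV Vx) m1// mulr0.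
- move=> /smul_None v0 i im.
  have vN : (sinv \o v) (c + r * w) <> None by rewrite /= v0.
  have [V [oV Vx _ fV]] := sphol_chart_in oD (sphol_sinv vh) Dx vN.
  by rewrite sinv_scaled// fin_scaled (scale_dvn s^-1 i oV fV Vx) m2// mulr0.
- move=> sN R0 i im.
  have vN : v (c + r * w) <> None by move=> E; apply: sN; rewrite /scaled E.
  have [V [oV Vx VD fV]] := sphol_chart_in oD vh Dx vN.
  pose Q z := derive1n k (fin \o v) z - psi z.
  have E x : V (c + r * x) -> derive1n k (fin \o scaled c r s v) x - t * psi (c + r * x) =
      t * Q (c + r * x).
    by move=> Vc; rewrite fin_scaled (scale_dvn s k oV fV Vc) tE -mulrBr.
  have t0 : t != 0 by rewrite -tE mulf_neq0// expf_neq0.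
  have Q0 : Q (c + r * w) = 0.
    by apply: (mulfI t0); rewrite mulr0 -E.
  have hQ : hol V Q by apply: holB; [exact: (dvn_hol (i := k) oV fV)|exact: hol_sub ph].
  have EE : \forall x \near w, derive1n k (fin \o scaled c r s v) x - t * psi (c + r * x) =
      t * Q (c + r * x).
    by apply: filterS (scale_near oV Vx) => x /E.
  by rewrite (derive1n_near i EE) (scale_dvn t i oV hQ Vx) m3// mulr0.
Qed.

End Scaled.

Section UniformChart.
Variable R : realType.
Local Notation C := R[i].
Local Notation hol := (@holomorphic R).
Implicit Types (V D : set C) (a z w c : C) (f : C -> sphere R) (psi : C -> C).

Lemma chart_root V f n M : (0 < n)%N -> 0 <= M -> sphol V f -> chart V (mpow f n) M ->
  chart V f (M + 1).
Proof.
move=> n0 M0 fh [h1 [_ h3]].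
have fN z : V z -> f z <> None by move=> /h1 h /(mpow_None f n z).
have [h4 h5] := sphol_fin fh fN; split; first exact: h4.
split; first exact: h5.
move=> z /h3; rewrite /= fin_mpow// cnX => le.
have [x1|x1] := lerP (cn (fin (f z))) 1; first by lra.
have : cn (fin (f z)) <= cn (fin (f z)) ^+ n.
  by rewrite -{1}[cn _]expr1; apply: ler_weXn2l => //; exact: ltW.
by lra.
Qed.

(** At a fixed scale the alternative already yields a chart with a bound independent of [f]. In the
    contrapositive, a family without a common chart at [a] has, at every small scale, a member
    violating the alternative. *)
Lemma uniform_chart a rho n k psi : (0 < n)%N -> 0 < rho -> hol (disc a rho) psi ->
  (forall s, 0 < s -> exists2 z, disc a s z & psi z != 0) ->
  exists s M, [/\ 0 < s, s <= rho & forall f, sphol (disc a rho) f ->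
    (forall z, disc a rho z -> ~ (psi z = 0 /\ f z = Some 0)) ->
    one_sided (disc a rho) (mpow f n) (fun y => (rC rho : C) ^+ k * psi y) 8 ->
    chart (disc a s) f M \/ chart (disc a s) (sinv \o f) M].
Proof.
move=> n0 rho0 ph pn.
pose P y := (rC rho : C) ^+ k * psi y.
have q0 : (rC rho : C) ^+ k != 0 by rewrite expf_neq0// -cn_gt0 cn_rC_pos.
have Ph : hol (disc a rho) P by apply: holM; [exact: hol_cst|exact: ph].
have [[s s0 hs]|[s [e [s0 e0 sr gl]]]] := annulus_lower rho0 Ph.
  have [z zs /eqP pz] := pn s s0; case: pz.
  by apply: (mulfI q0); rewrite mulr0; exact: hs.
have s2 : 2 * s < rho by lra.
have [M M0 hM] := hol_bounded s0 s2 Ph.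
have sub : disc a s `<=` disc a rho by apply: disc_sub; lra.
have M1 : 0 <= 8 * M by lra.
have M2 : 0 <= 8 / e by rewrite divr_ge0// ltW.
exists s, (Num.max (8 * M) (8 / e) + 1); split; [exact: s0|lra|].
move=> f fh nz o.
have vh := sphol_mpow n0 fh.
have c0 : 0 <= Num.max (8 * M) (8 / e) by rewrite le_max M1.
case: o => o; [left|right].
  apply: (chart_root n0 c0); first exact: sphol_sub fh.
  apply: (@chart_le _ _ _ (8 * M)); first by rewrite le_max lexx.
  apply: (dominated_chart (psi := P)); [exact: sphol_sub vh|by move=> z /sub/o|by []|exact: hM].
apply: (chart_root n0 c0); first by apply: sphol_sinv; exact: sphol_sub fh.
apply: (@chart_le _ _ _ (8 / e)); first by rewrite le_max lexx orbT.
rewrite -sinv_mpow//; apply: (dominating_chart vh o _ _ s0 (ltW sr) e0 gl) => //.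
move=> z zr [P0 /(mpow_0 _ _ n0) fz]; apply: (nz z zr); split; last exact: fz.
by apply: (mulfI q0); rewrite mulr0; exact: P0.
Qed.

End UniformChart.

Section Zalcman.
Variable R : realType.
Local Notation C := R[i].
Local Notation hol := (@holomorphic R).
Implicit Types (V D : set C) (a z w c s t : C) (f v : C -> sphere R) (psi phi : C -> C).
Implicit Types (r e A B : R).

Lemma one_sided_unscaled v psi c z r s t k : 0 < r -> s != 0 -> t != 0 -> s * rC r ^+ k = t ->
  one_sided (disc ((z - c) / rC r) 1) (scaled c (rC r) s v) (fun w => t * psi (c + rC r * w)) 8 ->
  one_sided (disc z r) v (fun y => (rC r : C) ^+ k * psi y) 8.
Proof.
move=> r0 s0 t0 tE o; have rn : rC r != 0 :> C by rewrite -cn_gt0 cn_rC_pos.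
have o' : one_sided (disc ((z - c) / rC r) 1) (scaled c (rC r) s v)
    (fun w => 1 * (t * psi (c + rC r * w))) 8.
  case: o => o; [left|right] => w /o; rewrite mul1r; exact.
have E : s^-1 = rC r ^+ k / t.
  by rewrite -tE; field; rewrite s0 expf_neq0.
have back y : c + rC r * (- c / rC r + (rC r)^-1 * y) = y by field.
have sub y : disc z r y -> disc ((z - c) / rC r) 1 (- c / rC r + (rC r)^-1 * y).
  rewrite /disc /= => yr; have -> : - c / rC r + (rC r)^-1 * y - (z - c) / rC r = (y - z) / rC r.
    by field.
  by rewrite cnf cn_rC_pos// ltr_pdivrMr// mul1r.
have := one_sided_scaled (s := s^-1) (t := rC r ^+ k / t) (K' := 8) sub (oner_neq0 _) _ _ o'.
have -> : scaled (- c / rC r) (rC r)^-1 s^-1 (scaled c (rC r) s v) = v.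
  by apply/funext => y; rewrite /scaled back smulK.
have -> : (fun w => rC r ^+ k / t * (t * psi (c + rC r * (- c / rC r + (rC r)^-1 * w)))) =
    (fun y => rC r ^+ k * psi y).
  by apply/funext => y; rewrite back mulrA divfK.
by rewrite mulr1 E; apply.
Qed.

(** The alternative is known with weight [(r / 2)^k] whereas the rescaling uses [r^k]; the quotient
    [2^k] goes into the constant. *)
Lemma tame_scaled D v psi c r s t A n m k : open D -> hol D psi -> sphol D v ->
  (forall z, D z -> ~ (psi z = 0 /\ v z = Some 0)) -> multiplicities n m k D v psi ->
  0 < r -> s != 0 -> t != 0 -> s * rC r ^+ k = t ->
  (forall w, disc 0 A w -> D (c + rC r * w)) ->
  (forall w, disc 0 A w ->
    one_sided (disc (c + rC r * w) (r / 2)) v (fun y => (rC (r / 2) : C) ^+ k * psi y) 8) ->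
  tame n m k A (scaled c (rC r) s v) (fun w => t * psi (c + rC r * w)) (8 * 2 ^+ k).
Proof.
move=> oD ph vh nz vm r0 s0 t0 tE AD o.
have rn : rC r != 0 :> C by rewrite -cn_gt0 cn_rC_pos.
have r20 : 0 < r / 2 by rewrite divr_gt0.
have q0 : (rC (r / 2) : C) ^+ k != 0 by rewrite expf_neq0// -cn_gt0 cn_rC_pos.
have k1 : 1 <= 2 ^+ k :> R by rewrite exprn_ege1// ler1n.
have qt : cn (s * rC (r / 2) ^+ k) * 2 ^+ k = cn t.
  rewrite -tE !cnM !cnX !cn_rC_pos// -mulrA -exprMn divfK//.
have st : cn (s * rC (r / 2) ^+ k) <= cn t by rewrite -qt ler_peMr ?cn_ge0.
split.
- exact: sphol_scaled rn s0 AD vh.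
- exact (scale_hol ph AD).
- move=> w wA; apply: (one_sided_scaled (K := 8) (q := rC (r / 2) ^+ k) (V := disc (c + rC r * w) (r / 2))) => //.
  + move=> x; rewrite /disc /= opprD addrACA subrr add0r -mulrBr cnM cn_rC_pos// => h.
    by rewrite ltr_pM2l// -div1r.
  + by rewrite -mulrA ler_wpM2l//; apply: le_trans st _; rewrite ler_peMl ?cn_ge0.
  + by rewrite -mulrA ler_wpM2l// [leRHS]mulrC qt.
  + exact: o.
- move=> w wA [P0 /(smul_0 _ s0) v0]; apply: (nz _ (AD w wA)); split; last exact: v0.
  by apply: (mulfI t0); rewrite mulr0.
- exact: (multiplicities_scaled oD rn s0 tE AD vh ph vm).
Qed.

End Zalcman.

Section FamilyChart.
Variable R : realType.
Local Notation C := R[i].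
Local Notation hol := (@holomorphic R).
Implicit Types (z w c s t : C) (f v : C -> sphere R) (r e A B : R).
Variable U : set_system nat.
Hypothesis UU : UltraFilter U.
Hypothesis Uoo : forall P : nat -> Prop, (\forall j \near \oo, P j) -> \forall j \near U, P j.
Variables (n m k l : nat) (D : set C) (psi phi : C -> C) (a : C) (eps e0 : R).
Variable FF : set (C -> sphere R).

Definition admissible f := [/\ sphol D f, forall z, D z -> ~ (psi z = 0 /\ f z = Some 0) &
  multiplicities n m k D (mpow f n) psi].

Hypotheses (oD : open D) (ph : hol D psi) (k0 : (0 < k)%N) (kn : (k < n)%N).
Hypotheses (rigl : rigid_exponents n m k l) (rig0 : rigid_exponents n m k 0).
Hypotheses (eps0 : 0 < eps) (epsD : disc a eps `<=` D) (fa : derivable phi a 1).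
Hypothesis psiE : forall z, disc a eps z -> psi z = (z - a) ^+ l * phi z.
Hypotheses (e00 : 0 < e0) (phiE : forall z, disc a eps z -> e0 <= cn (phi z) <= 2 * e0).
Hypothesis FFa : forall f, FF f -> admissible f.

Let n0 : (0 < n)%N. Proof. exact: leq_ltn_trans kn. Qed.

Let J (j : nat) : R := j.+1%:R.
Let J1 j : 1 <= J j. Proof. by rewrite ler1n. Qed.
Let J0 j : 0 < J j. Proof. by rewrite ltr0n. Qed.

Let largeJ B : \forall j \near U, B < J j.
Proof.
apply: Uoo; have [N hN] : exists N : nat, B < N%:R.
  by exists (Num.truncn B).+1; exact: truncnS_gt.
by near=> j; apply: lt_trans hN _; rewrite ltr_nat ltnS; near: j; exact: nbhs_infty_ge.
Unshelve. all: by end_near. Qed.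

Let phi_nz z : disc a eps z -> phi z != 0.
Proof. by move=> /phiE/andP[h _]; rewrite -cn_gt0; apply: lt_le_trans h. Qed.

Let psi_nz z : disc a eps z -> z != a -> psi z != 0.
Proof. by move=> ze za; rewrite psiE// mulf_neq0 ?expf_neq0 ?subr_eq0 ?phi_nz. Qed.

(** The outcome of point picking with magnification [J j]. The numerical bounds make [r] and the
    distance from [z] to [a] tend to 0 and keep the disc of radius [J j * r] about [z] inside that
    of radius [eps] about [a]. *)
Definition chosen j f z r := [/\ FF f, 0 < r, r <= eps / (8 * J j) /\ J j * r <= eps / 8,
  cn (z - a) <= eps / (4 * J j) /\
  ~ one_sided (disc z r) (mpow f n) (fun y => (rC r : C) ^+ k * psi y) 8 &
  forall w, cn (w - z) < J j * r ->
    one_sided (disc w (r / 2)) (mpow f n) (fun y => (rC (r / 2) : C) ^+ k * psi y) 8].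

Lemma chosen_ex : ~ (exists r M, [/\ 0 < r, disc a r `<=` D &
    forall f, FF f -> chart (disc a r) f M \/ chart (disc a r) (sinv \o f) M]) ->
  forall j, exists f z r, chosen j f z r.
Proof.
move=> no j; have j0 := J0 j; have j1 := J1 j; have ee := eps0.
(* The square makes up for the magnification: the search radius [2 * J j * r0] of point picking
   becomes [eps / (4 * J j)]. *)
pose r0 := eps / (8 * J j ^+ 2); have r00 : 0 < r0 by rewrite divr_gt0// mulr_gt0// exprn_gt0.
have Jr : J j * r0 = eps / (8 * J j) by rewrite /r0; field; rewrite gt_eqF.
have r0e : r0 <= eps / (8 * J j) by rewrite -Jr ler_peMl// ltW.
have J8 : J j * (eps / (8 * J j)) = eps / 8 by field; rewrite gt_eqF.
have e8 : eps / (8 * J j) <= eps / 8 by rewrite -J8 ler_peMl// divr_ge0 ?mulr_ge0 ?ltW.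
have r0eps : r0 <= eps.
  by apply: le_trans r0e (le_trans e8 _); rewrite ler_pdivrMr// ler_peMr ?ler1n// ltW.
have sub : disc a r0 `<=` D by apply: subset_trans epsD; exact: disc_sub.
have [f [Ff bad0]] : exists f, FF f /\
    ~ one_sided (disc a r0) (mpow f n) (fun y => (rC r0 : C) ^+ k * psi y) 8.
  apply: contrapT => nf; have pn (s : R) : 0 < s -> exists2 z, disc a s z & psi z != 0.
    move=> s0; have m0 : 0 < Num.min s eps by rewrite lt_min s0.
    have [z zm za] := disc_punctured a m0; move: zm; rewrite /disc /= lt_min => /andP[zs ze].
    by exists z => //; exact: psi_nz.
  have [s [M [s0 sr h]]] := @uniform_chart R a r0 n k psi n0 r00 (hol_sub sub ph) pn.
  apply: no; exists s, M; split; [exact: s0|exact: subset_trans (disc_sub sr) sub|].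
  move=> f Ff; have [fh nz _] := FFa Ff; apply: h.
  - exact: sphol_sub fh.
  - by move=> z /sub; exact: nz.
  - by apply: contrapT => no'; apply: nf; exists f.
have [fh nz _] := FFa Ff.
pose bad (z : C) (r : R) := ~ one_sided (disc z r) (mpow f n) (fun y => (rC r : C) ^+ k * psi y) 8.
have [|z [r [/andP[rp rr] za zb zg]]] := doubling r00 j0 (bad0 : bad a r0).
  move=> z za; have Dz : D z.
    apply: epsD; rewrite /disc /=; move: za e8; rewrite -mulrA Jr.
    by move: (eps / (8 * J j)) (cn _) => x y; lra.
  have [d d0 hd] := local_good fh Dz (ph Dz) k0 kn (nz z Dz).
  by exists d => // w r wz rd; apply; exact: hd.
exists f, z, r; split; [exact: Ff|exact: rp| | |].
- split; first exact: le_trans rr r0e.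
  by rewrite -J8 ler_pM2l//; exact: le_trans rr r0e.
- split; last exact: zb.
  by move: za; rewrite -mulrA Jr; have -> : eps / (4 * J j) = 2 * (eps / (8 * J j));
    [field; rewrite gt_eqF|].
- move=> w wz; apply: contrapT; apply: zg => //.
  by rewrite divr_gt0//= lexx.
Qed.

Section Sequence.
Variables (fs : nat -> C -> sphere R) (zs : nat -> C) (rs : nat -> R).
Hypothesis ch : forall j, chosen j (fs j) (zs j) (rs j).

Let rp j : 0 < rs j. Proof. by have [] := ch j. Qed.

Let small_r A e : 0 < e -> \forall j \near U, rs j * A < e.
Proof.
move=> e1; have := largeJ (eps * `|A| / (8 * e)); apply: filterS => j.
rewrite ltr_pdivrMr ?mulr_gt0// => h; have [_ r0 [h1 _] _ _] := ch j.
apply: le_lt_trans (ler_wpM2l (ltW r0) (ler_norm A)) _.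
apply: le_lt_trans (ler_wpM2r (normr_ge0 A) h1) _.
rewrite mulrAC ltr_pdivrMr ?mulr_gt0//.
by have -> : e * (8 * J j) = J j * (8 * e) by ring.
Qed.

Let zs_lim : ulim U zs a.
Proof.
move=> e e1; have := largeJ (eps / (4 * e)); apply: filterS => j.
rewrite ltr_pdivrMr ?mulr_gt0// => h; have [_ _ _ [h1 _] _] := ch j.
apply: le_lt_trans h1 _.
rewrite ltr_pdivrMr ?mulr_gt0//.
by have -> : e * (4 * J j) = J j * (4 * e) by ring.
Qed.

Let in_eps j w : cn (w - zs j) < J j * rs j -> disc a eps w.
Proof.
move=> wz; have [_ _ [_ h1] [h2 _] _] := ch j; have ee := eps0; rewrite /disc /=.
have : eps / (4 * J j) <= eps / 4.
  by rewrite ler_pM2l// lef_pV2 ?posrE ?mulr_gt0// ler_peMr.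
move: h2 (cn_tri (zs j) w a) h1 wz; move: (_ / _) (J j * _) (cn _) (cn (w - _)) (cn _).
by move=> x1 x2 x3 x4 x5; lra.
Qed.

Let phi_lim (ws : nat -> C) : ulim U ws a -> ulim U (fun j => phi (ws j)) (phi a).
Proof.
move=> h e e1; have [d d0 hd] := near_const fa e1.
by apply: filterS (h d d0) => j; exact: hd.
Qed.

Let tame_near A (cs ts : nat -> C) : (forall j, ts j != 0) ->
  (\forall j \near U, forall w, disc 0 A w -> cn (cs j + rC (rs j) * w - zs j) < J j * rs j) ->
  \forall j \near U, tame n m k A
    (scaled (cs j) (rC (rs j)) (ts j / rC (rs j) ^+ k) (mpow (fs j) n))
    (fun w => ts j * psi (cs j + rC (rs j) * w)) (8 * 2 ^+ k).
Proof.
move=> t0; apply: filterS => j h; have [/FFa[fh nz fm] r0 _ _ good] := ch j.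
have rn : rC (rs j) != 0 :> C by rewrite -cn_gt0 cn_rC_pos.
apply: (tame_scaled oD ph (sphol_mpow n0 fh) _ fm r0 _ (t0 j)).
- by move=> z Dz [p0 /(mpow_0 _ _ n0) f0]; exact: (nz z Dz).
- by rewrite mulf_neq0 ?invr_eq0 ?expf_neq0.
- by rewrite divfK// expf_neq0.
- by move=> w /h/in_eps/epsD.
- by move=> w /h; exact: good.
Qed.

Let not_one_sided j c t : t != 0 ->
  ~ one_sided (disc ((zs j - c) / rC (rs j)) 1)
    (scaled c (rC (rs j)) (t / rC (rs j) ^+ k) (mpow (fs j) n))
    (fun w => t * psi (c + rC (rs j) * w)) 8.
Proof.
move=> t0; have [_ r0 _ [_ bad] _] := ch j.
have rn : rC (rs j) != 0 :> C by rewrite -cn_gt0 cn_rC_pos.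
move=> o; apply: bad; apply: (one_sided_unscaled r0 _ t0 _ o).
  by rewrite mulf_neq0 ?invr_eq0 ?expf_neq0.
by rewrite divfK// expf_neq0.
Qed.

Let K0 : 0 <= 8 * 2 ^+ k :> R. Proof. by rewrite mulr_ge0// exprn_ge0. Qed.

Let phi_a : phi a != 0. Proof. exact/phi_nz/disc_center. Qed.

(* Rescaling around a itself turns psi into phi(a) w^l. *)
Lemma centred_case B : (\forall j \near U, cn (zs j - a) <= B * rs j) -> False.
Proof.
move=> zB; pose ts j : C := rC (rs j) ^- l.
have rn j : rC (rs j) != 0 :> C by rewrite -cn_gt0 cn_rC_pos.
have t0 j : ts j != 0 by rewrite invr_eq0 expf_neq0.
have near A : \forall j \near U, forall w, disc 0 A w ->
    cn (a + rC (rs j) * w - zs j) < J j * rs j.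
  apply: filterS2 zB (largeJ (A + B)) => j h1 h2 w; rewrite /disc /= subr0 => wA.
  have := cn_tri a (a + rC (rs j) * w) (zs j).
  have -> : a + rC (rs j) * w - a = rC (rs j) * w by rewrite addrC addKr.
  rewrite cnM cn_rC_pos// [cn (a - _)]cnC => h3.
  have h4 : rs j * cn w < rs j * A by rewrite ltr_pM2l.
  have h5 : rs j * (A + B) < rs j * J j by rewrite ltr_pM2l.
  by rewrite [_ * rs j]mulrC; lra.
have PE A : \forall j \near U, forall w, disc 0 A w ->
    disc a eps (a + rC (rs j) * w) /\
    ts j * psi (a + rC (rs j) * w) = w ^+ l * phi (a + rC (rs j) * w).
  apply: filterS (near A) => j h w /h /in_eps we; split; first exact: we.
  rewrite psiE// [a + _]addrC addrK exprMn /ts.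
  by rewrite !mulrA mulVf ?mul1r// expf_neq0.
have inA w : disc 0 (cn w + 1) w by rewrite /disc /= subr0 ltrDl.
apply: (rescaling_impossible UU (B := B) (zs := fun j => (zs j - a) / rC (rs j))
  (Ps := fun j w => ts j * psi (a + rC (rs j) * w)) rigl k0 phi_a K0
  (fun A _ => tame_near t0 (near A))).
- move=> A A0; exists (A ^+ l * (2 * e0)); apply: filterS (PE A) => j h w wA.
  have [we ->] := h w wA; rewrite cnM cnX; have /andP[_ p2] := phiE we.
  apply: ler_pM; rewrite ?exprn_ge0 ?cn_ge0//.
  apply: lerXn2r; rewrite ?nnegrE ?cn_ge0 ?(ltW A0)//.
  by move: wA; rewrite /disc /= subr0 => /ltW.
- move=> w; have xl : ulim U (fun j => a + rC (rs j) * w) a.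
    move=> e e1; apply: filterS (small_r (cn w) e1) => j.
    by rewrite addrC addKr cnM cn_rC_pos.
  have := ulimM UU (ulim_cst UU (w ^+ l)) (phi_lim xl); rewrite [phi a * _]mulrC.
  apply: (ulim_near UU); apply: filterS (PE (cn w + 1)) => j h.
  by rewrite (h w (inA w)).2.
- move=> l0; apply: filterS (PE 1) => j h.
  by rewrite (h 0 (disc_center 0 ltr01)).2 expr0n gtn_eqF// mul0r.
- by apply: filterS zB => j; rewrite cnf cn_rC_pos// ler_pdivrMr.
- by apply: nearW => j; exact: not_one_sided.
Qed.

(* Rescaling around the points zs j turns psi into a constant. *)
Lemma escaping_case : (forall B, \forall j \near U, B * rs j < cn (zs j - a)) -> False.
Proof.
(* This normalises the rescaled [psi] to 1 at the centre. The value 1 for [zs j = a] only keeps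
   [ts j] nonzero for every [j]; along [U] the centres differ from [a]. *)
move=> zB; pose ts j : C := if zs j == a then 1 else (psi (zs j))^-1.
have zin j : disc a eps (zs j).
  by apply: (in_eps (j := j)); rewrite subrr cn0 mulr_gt0.
have rn j : rC (rs j) != 0 :> C by rewrite -cn_gt0 cn_rC_pos.
have t0 j : ts j != 0.
  rewrite /ts; case: (eqVneq (zs j) a) => [_|za]; first exact: oner_neq0.
  by rewrite invr_eq0 psi_nz.
have za : \forall j \near U, zs j != a.
  by apply: filterS (zB 0) => j; rewrite mul0r cn_gt0 subr_eq0.
have near A : \forall j \near U, forall w, disc 0 A w ->
    cn (zs j + rC (rs j) * w - zs j) < J j * rs j.
  apply: filterS (largeJ A) => j h1 w; rewrite /disc /= subr0 => wA.
  by rewrite addrC addKr cnM cn_rC_pos// mulrC ltr_pM2r//; exact: lt_trans h1.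
(* The quotient of [zs j + rs j w - a] by [zs j - a]. It tends to 1 because [rs j] is negligible
   against [|zs j - a|], so the factor [(z - a)^l] of [psi] flattens to a constant. *)
pose y w j : C := 1 + rC (rs j) * w / (zs j - a).
have PE A : \forall j \near U, forall w, disc 0 A w ->
    disc a eps (zs j + rC (rs j) * w) /\
    ts j * psi (zs j + rC (rs j) * w) =
      y w j ^+ l * (phi (zs j + rC (rs j) * w) * (phi (zs j))^-1).
  apply: filterS2 (near A) za => j h zj w /h /in_eps we; split; first exact: we.
  rewrite /ts (negbTE zj) (psiE we) (psiE (zin j)).
  have zj0 : zs j - a != 0 by rewrite subr_eq0.
  have -> : zs j + rC (rs j) * w - a = (zs j - a) * y w j by rewrite /y; field.
  rewrite exprMn; field.
  by rewrite phi_nz// expf_neq0.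
have inA w : disc 0 (cn w + 1) w by rewrite /disc /= subr0 ltrDl.
have one0 : (1 : C) != 0 by exact: oner_neq0.
apply: (rescaling_impossible UU (B := 0) (zs := fun j => (zs j - zs j) / rC (rs j))
  (Ps := fun j w => ts j * psi (zs j + rC (rs j) * w)) rig0 k0 one0 K0
  (fun A _ => tame_near t0 (near A))).
- move=> A A0; exists (2 ^+ l * (2 * e0 / e0)); apply: filterS3 (PE A) (zB A) za => j h zA zj w wA.
  have [we ->] := h w wA; rewrite cnM cnX cnf.
  have /andP[_ p2] := phiE we; have /andP[q1 _] := phiE (zin j).
  apply: ler_pM; rewrite ?exprn_ge0 ?cn_ge0 ?divr_ge0 ?cn_ge0//.
    apply: lerXn2r; rewrite ?nnegrE ?cn_ge0//.
    apply: le_trans (cnD _ _) _; rewrite cn1 cnf cnM cn_rC_pos//.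
    have zp : 0 < cn (zs j - a) by rewrite cn_gt0 subr_eq0.
    have : rs j * cn w / cn (zs j - a) <= 1; last by lra.
    rewrite ler_pdivrMr// mul1r; apply: le_trans (ltW zA).
    rewrite mulrC ler_wpM2r ?(ltW (rp j))//.
    by move: wA; rewrite /disc /= subr0 => /ltW.
  apply: ler_pM; rewrite ?cn_ge0 ?invr_ge0 ?cn_ge0//.
  by rewrite lef_pV2 ?posrE// (lt_le_trans e00).
- move=> w; have rl : ulim U (fun j => rC (rs j) * w) 0.
    by move=> e e1; apply: filterS (small_r (cn w) e1) => j; rewrite subr0 cnM cn_rC_pos.
  have xl := ulimD UU zs_lim rl; rewrite addr0 in xl.
  have yl : ulim U (y w) 1.
    move=> e e1; apply: filterS2 (zB ((cn w + 1) / e)) za => j h zj.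
    rewrite /y addrC addKr cnf cnM cn_rC_pos//.
    rewrite ltr_pdivrMr ?cn_gt0 ?subr_eq0//; move: h.
    rewrite mulrAC ltr_pdivrMr// [_ * e]mulrC; apply: le_lt_trans.
    by rewrite mulrC ler_wpM2r ?(ltW (rp j))// lerDl.
  have := ulimM UU (ulimX UU l yl) (ulimM UU (phi_lim xl) (ulimV UU phi_a (phi_lim zs_lim))).
  rewrite expr1n mul1r mulfV// expr0 mulr1.
  apply: (ulim_near UU); apply: filterS (PE (cn w + 1)) => j h.
  by rewrite (h w (inA w)).2.
- by [].
- by apply: nearW => j; rewrite subrr mul0r cn0.
- by apply: nearW => j; exact: not_one_sided.
Qed.

End Sequence.

(** Along an ultrafilter the ratio of [|zs j - a|] to [rs j] is either bounded or exceeds every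
    bound, so the two blow-ups exhaust all cases. *)
Theorem family_chart : exists r M, [/\ 0 < r, disc a r `<=` D &
  forall f, FF f -> chart (disc a r) f M \/ chart (disc a r) (sinv \o f) M].
Proof.
apply: contrapT => /chosen_ex h.
have /choice[g hg] : forall j, exists g : (C -> sphere R) * (C * R), chosen j g.1 g.2.1 g.2.2.
  by move=> j; have [f [z [r c]]] := h j; exists (f, (z, r)).
have [[B zB]|nB] := pselect (exists B, \forall j \near U, cn ((g j).2.1 - a) <= B * (g j).2.2).
  exact: (centred_case hg zB).
apply: (escaping_case hg) => B.
have [zB|] := ultra_or UU (fun j => cn ((g j).2.1 - a) <= B * (g j).2.2).
  by case: nB; exists B.
by apply: filterS => j /negP; rewrite -ltNge.
Qed.

End FamilyChart.

(** * Exponents and multiplicities *)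

(** The extreme exponents [b / N = 1 - q / n] and [c / N = 1 - L / m] turn the inequality at poles,
    multiplied by [m], into exactly the hypothesis. The other inequalities must be strict, so [b]
    and [c] are lowered by 1 after scaling everything by a large [M]. *)
Lemma rigid_exponents_of (n m k l : nat) : (0 < n)%N ->
  (m * (k + 2 * l.+1) + n * l.+1 + k * l.+1 < m * n)%N -> rigid_exponents n m k l.
Proof.
move=> n0; set L := l.+1 => H; have L0 : (0 < L)%N by [].
have qE : (k + l).+1 = (k + L)%N by rewrite addnS.
have Ln : (L < m)%N.
  rewrite -(ltn_pmul2l n0) [(n * m)%N]mulnC; apply: leq_ltn_trans H.
  by rewrite -addnA addnC -addnA leq_addr.
have m0 : (0 < m)%N by apply: leq_ltn_trans Ln.
have qn : (k + L < n)%N.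
  rewrite -(ltn_pmul2l m0); apply: leq_ltn_trans H.
  by rewrite -addnA (leq_trans _ (leq_addr _ _))// leq_mul2l leq_add2l leq_pmull ?orbT.
have [x nE] : exists x, n = (k + L + x)%N by exists (n - (k + L))%N; rewrite subnKC// ltnW.
have [y mE] : exists y, m = (L + y)%N by exists (m - L)%N; rewrite subnKC// ltnW.
have x0 : (0 < x)%N by rewrite -(ltn_add2l (k + L)) addn0 -nE.
have y0 : (0 < y)%N by rewrite -(ltn_add2l L) addn0 -mE.
have key : (m * (n + (k + L)) + 1 <= m * x + y * (n + k))%N.
  have e1 : (m * x + m * (k + L) = m * n)%N by rewrite nE -mulnDr addnC.
  have e2 : (y * (n + k) + L * (n + k) = m * (n + k))%N by rewrite mE mulnDl addnC.
  by move: H e1 e2; rewrite !mulnDr; lia.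
have key2 : (m * n + 2 <= m * x + n * y)%N.
  have e1 : (m * x + m * (k + L) = m * n)%N by rewrite nE -mulnDr addnC.
  have e2 : (n * y + n * L = m * n)%N by rewrite mE [(_ * n)%N]mulnC -mulnDr addnC.
  have e3 : (1 <= m * L)%N by rewrite muln_gt0 m0.
  by move: H e1 e2; rewrite !mulnDr; lia.
(* Lowering [b] and [c] by 1 costs [n + (n + k)] in the inequality at poles, whose margin is [M * n]
   after scaling. *)
pose M := (2 * n + k + 1)%N; have M0 : (0 < M)%N by rewrite /M addn1.
have bE : (M * m * x = (M * m * x).-1.+1)%N by rewrite prednK// !muln_gt0 M0 m0.
have cE : (M * n * y = (M * n * y).-1.+1)%N by rewrite prednK// !muln_gt0 M0 n0.
have Mn : (2 * n + k < M * n)%N.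
  by rewrite /M (leq_trans _ (leq_pmulr _ n0))// addn1.
exists (M * n * m)%N, (M * m * x).-1, (M * n * y).-1.
have Nx : (M * m * x + M * m * (k + L) = M * n * m)%N.
  by rewrite -mulnDr -[(M * n * m)%N]mulnA [(n * m)%N]mulnC nE mulnA [(x + _)%N]addnC.
have Ny : (M * n * y + M * n * L = M * n * m)%N by rewrite -mulnDr mE [(y + _)%N]addnC.
move: bE cE; move: (_.-1) (_.-1) => b c bE cE.
have Mmx : (0 < M * m * (k + L))%N by rewrite !muln_gt0 M0 m0 addn_gt0 orbT.
rewrite qE; split.
- by lia.
- by lia.
- have : (M * (m * n + 2) <= M * (m * x + n * y))%N by rewrite leq_mul2l key2 orbT.
  have : (3 <= M)%N by rewrite /M; lia.
  by rewrite !mulnDr !mulnA [(M * m * n)%N]mulnAC; lia.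
- have e : (M * m * x * n + M * m * (k + L) * n = M * n * m * n)%N by rewrite -mulnDl Nx.
  have e2 : (M * m * (k + L) * n = M * n * m * (k + L))%N by ring.
  by move: e; rewrite bE mulSn e2; lia.
split.
- have e : (M * n * y * m + M * n * L * m = M * n * m * m)%N by rewrite -mulnDl Ny.
  have e2 : (M * n * L * m = M * n * m * L)%N by ring.
  by move: e; rewrite cE mulSn e2; lia.
- have : (M * n * (m * (n + (k + L)) + 1) <= M * n * (m * x + y * (n + k)))%N.
    by rewrite leq_mul2l key orbT.
  have -> : (M * n * (m * x + y * (n + k)) = M * m * x * n + M * n * y * (n + k))%N by ring.
  rewrite bE cE !mulSn.
  have -> : (M * n * (m * (n + (k + L)) + 1) = M * n * m * (n + (k + L)) + M * n)%N by ring.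
  by lia.
- exact: ltnW.
- by apply: leq_ltn_trans Ln; rewrite /L.
Qed.

(** Multiplied by [m n], the condition compares natural numbers, and its left side grows with [p];
    so it persists with [l + 1] in place of [p + 1]. *)
Lemma rigid_exponents_real (R : realType) (n m k p l : nat) : (0 < n)%N -> (0 < m)%N ->
  (l <= p)%N ->
  (k + 2 * (p + 1))%:R / n%:R + (p + 1)%:R / m%:R
    + (k * (p + 1))%:R / (m * n)%:R < 1 :> R -> rigid_exponents n m k l.
Proof.
move=> n0 m0 lp H; apply: rigid_exponents_of => //.
have nR : n%:R != 0 :> R by rewrite pnatr_eq0 -lt0n.
have mR : m%:R != 0 :> R by rewrite pnatr_eq0 -lt0n.
have mn0 : 0 < (m * n)%:R :> R by rewrite ltr0n muln_gt0 m0.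
have : (m * (k + 2 * (p + 1)) + n * (p + 1) + k * (p + 1))%:R < (m * n)%:R :> R.
  move: H; rewrite -(ltr_pM2r mn0) mul1r; apply: le_lt_trans.
  by rewrite le_eqVlt; apply/orP; left; apply/eqP; rewrite !natrD !natrM; field; rewrite nR.
rewrite ltr_nat; apply: leq_ltn_trans; rewrite addn1.
have h : (l.+1 <= p.+1)%N by [].
by rewrite !leq_add// ?leq_mul2l ?leq_add2l ?leq_mul2l ?h ?orbT.
Qed.

Section FromMultiplicities.
Variable R : realType.
Local Notation C := R[i].
Local Notation hol := (@holomorphic R).
Implicit Types (D : set C) (a z w : C) (f v : C -> sphere R) (psi : C -> C).

Lemma zero_mult_ge f a m : (0 < m)%N -> (m%:R%:E <= zero_mult f a)%E ->
  exists2 j, (m <= j)%N & divisible_at f a j.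
Proof.
move=> m0 h; apply: contrapT => no.
have : (zero_mult f a <= m.-1%:R%:E)%E.
  apply: ge_ereal_sup => _ [j dj <-]; rewrite lee_fin ler_nat -ltnS prednK// ltnNge.
  by apply/negP => mj; apply: no; exists j.
by move=> /(le_trans h); rewrite lee_fin ler_nat leqNgt prednK// leqnn.
Qed.

Lemma divisible_dvn f (g : C -> C) a j : divisible_at f a j -> (forall z, f z <> None -> f z = Some (g z)) ->
  forall i, (i < j)%N -> derive1n i g a = 0.
Proof.
move=> [h hh fE] fg i ij; have [r r0 hr] := near_discE (filterI hh fE).
have E z : disc a r z -> g z = (z - a) ^+ j * h z.
  by move=> /hr[_ fz]; have := fg z; rewrite fz => /(_ (fun e => ltac:(discriminate e)))[].
rewrite (derive1n_near (g := fun z => (z - a) ^+ j * h z)).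
  by apply: (dvn_zero r0 (f := fun z => (z - a) ^+ j * h z) (q := h)) ij => // z /hr[].
by apply: (near_discI r0) => z /E.
Qed.

Lemma mpow_zero_dvn D v n z i : (0 < n)%N -> sphol D v -> D z -> v z = Some 0 -> (i < n)%N ->
  derive1n i (fin \o mpow v n) z = 0.
Proof.
move=> n0 vh Dz vz im; have vN : v z <> None by rewrite vz.
have [r [M [r0 _ [_ [fh _]]]]] := sphol_chart vh Dz vN.
have f0 : (fin \o v) z = 0 by rewrite /= vz.
have [q [qh _ qE]] := hol_factor r0 fh f0.
apply: (dvn_zero r0 (holX (n := n) qh) _ im) => w _.
by rewrite /= fin_mpow// -exprMn; congr (_ ^+ _); exact: qE.
Qed.

(** Orders are passed on as vanishing derivatives, the form in which Hurwitz's argument transports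
    them to limits; poles of [f^n] are handled as zeros of its inverse. *)
Lemma admissible_of D f psi n m k : (0 < n)%N -> (0 < m)%N -> meromorphic D f ->
  (forall z, zeros D (msub (mderive k (mpow f n)) psi) z ->
     (m%:R%:E <= zero_mult (msub (mderive k (mpow f n)) psi) z)%E) ->
  (forall z, D z -> ~ (psi z = 0 /\ f z = Some 0)) -> admissible n m k D psi f.
Proof.
move=> n0 m0 mf zm nz; have fh := mero_sphol mf; split; [exact: fh|exact: nz|].
move=> z Dz; split.
- by move=> /(mpow_0 _ _ n0) fz i im; exact: (mpow_zero_dvn n0 fh).
- move=> /mpow_None fz i im; rewrite sinv_mpow//.
  by apply: (mpow_zero_dvn n0 (sphol_sinv fh) Dz) => //=; rewrite fz.
- move=> vN R0 i im.
  pose g w := derive1n k (fin \o mpow f n) w - psi w.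
  have E w : msub (mderive k (mpow f n)) psi w <> None ->
      msub (mderive k (mpow f n)) psi w = Some (g w).
    by rewrite /msub /mderive; case: (mpow f n w).
  have zN : msub (mderive k (mpow f n)) psi z <> None.
    by move: vN; rewrite /msub /mderive; case: (mpow f n z).
  have [j mj dj] := zero_mult_ge m0 (zm z (conj Dz (etrans (E z zN) (congr1 Some R0)))).
  exact: (divisible_dvn dj E (leq_trans im mj)).
Qed.

(** The identity theorem, read off from [sphol_mero] for [1 / psi]: this is either infinite on all
    of [D] or meromorphic, and a meromorphic function is not infinite on a whole disc. *)
Lemma hol_not_locally0 D psi a : open D -> connected D -> hol D psi ->
  (exists z, D z /\ psi z != 0) -> D a ->
  ~ exists2 s : R, 0 < s & forall z, disc a s z -> psi z = 0.
Proof.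
move=> oD cD ph [z0 [Dz0 pz0]] Da [s s0 hs].
pose F z := sinv (Some (psi z)).
have Fh : sphol D F.
  move=> b Db; have [r r0 hr] : exists2 r, 0 < r & disc b r `<=` D.
    by apply/nbhs_discP; exact: oD.
  exists r; first exact: r0.
  have E z : (sinv \o F) z = Some (psi z) by exact: sinvK.
  right; split; first by move=> z zr; rewrite E.
  have -> : fin \o (sinv \o F) = psi by apply/funext => z; rewrite -[RHS]fin_Some -E.
  exact: hol_sub ph.
have [mF|FN] := sphol_mero oD cD Fh; last first.
  by have := FN z0 Dz0; rewrite /F /= (negbTE pz0).
have FN z : disc a s z -> F z = None by move=> /hs; rewrite /F => ->; rewrite /= eqxx.
have Fa := FN a (disc_center a s0).
have [[g _ /nbhs_singleton]|[j [_ _ [h [_ _ hE]]]]] := mF a Da; first by rewrite Fa.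
have /near_discE[r r0 hr] : \forall z \near a, z != a -> F z = Some (h z / (z - a) ^+ j).
  exact: hE.
have m0 : 0 < Num.min s r by rewrite lt_min s0.
have [z zm za] := disc_punctured a m0; move: zm; rewrite /disc /= lt_min => /andP[zs zr].
by have := hr z zr za; rewrite FN.
Qed.

(** The exponent is the order of [psi] at [a], finite by the identity theorem. It is at most [p]
    because it belongs to the set whose supremum is [zero_mult]. *)
Lemma psi_factor D psi p a : open D -> connected D -> hol D psi ->
  (exists z, D z /\ psi z != 0) -> D a ->
  (psi a = 0 -> (zero_mult (of_fun psi) a <= p%:R%:E)%E) ->
  exists l phi eps e0, [/\ (l <= p)%N, 0 < eps, disc a eps `<=` D,
    (forall z, disc a eps z -> psi z = (z - a) ^+ l * phi z) &
    [/\ derivable phi a 1, 0 < e0 & forall z, disc a eps z -> e0 <= cn (phi z) <= 2 * e0]].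
Proof.
move=> oD cD ph pn Da pm; have [r r0 hr] : exists2 r, 0 < r & disc a r `<=` D.
  by apply/nbhs_discP; exact: oD.
have [/(hol_not_locally0 oD cD ph pn Da)//|[l [phi [fh fa fE]]]] := hol_order r0 (hol_sub hr ph).
have fd := fh a (disc_center a r0).
have [e0 [e00 [d d0 hd]]] := near_ratio2 fd fa.
exists l, phi, (Num.min r d), e0; split.
- case: l fE => // l fE; have p0 : psi a = 0 by rewrite fE subrr expr0n mul0r.
  rewrite -(ler_nat R) -lee_fin; apply: le_trans (pm p0).
  apply: ereal_sup_ubound; exists l.+1 => //; exists phi.
    by apply: (near_discI r0) => z /fh.
  by apply: (near_discI r0) => z _; rewrite /of_fun fE.
- by rewrite lt_min r0.
- by apply: subset_trans hr; apply: disc_sub; rewrite ge_min lexx.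
- by move=> z _; exact: fE.
- by split; [exact: fd|exact: e00|move=> z; rewrite /disc /= lt_min => /andP[_ /hd]].
Qed.

End FromMultiplicities.

(** * Normality *)

Section Normality.
Variable R : realType.
Local Notation C := R[i].
Implicit Types (D K : set C) (a z w : C) (F f : C -> sphere R) (u : nat -> C -> sphere R).
Variable U : set_system nat.
Hypothesis UU : UltraFilter U.
Hypothesis Uoo : forall P : nat -> Prop, (\forall j \near \oo, P j) -> \forall j \near U, P j.

Definition exhaustion D (N : nat) : set C :=
  [set z | cn z <= N%:R /\ disc z N.+1%:R^-1 `<=` D].

(** Otherwise points of [K] outside ever larger members of the exhaustion have a limit along [U] in
    [K]; a disc about it lies in [D], so late points do belong to their member. *)
Lemma compact_exhaustion D K : open D -> compact K -> K `<=` D ->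
  \forall N \near \oo, K `<=` exhaustion D N.
Proof.
move=> oD cK KD; apply: contrapT => no.
have /choice[Nz hN] : forall j : nat, exists Nz : nat * C,
    [/\ (j <= Nz.1)%N, K Nz.2 & ~ exhaustion D Nz.1 Nz.2].
  move=> j; apply: contrapT => nj; apply: no; exists j => // N /= jN z Kz.
  by apply: contrapT => nE; apply: nj; exists (N, z).
pose zs j := (Nz j).2.
have UK : (zs @ U) K by apply: nearW => j; have [] := hN j.
have [a [Ka aK]] := cK (zs @ U) _ UK.
have za : ulim U zs a.
  move=> e e0; have [//|ne] := ultra_or UU (fun j => cn (zs j - a) < e).
  have [|z [nz ze]] := aK (fun z => ~ disc a e z) (disc a e) _ (disc_nbhs (disc_center a e0)).
    exact: ne.
  by [].
have /near_discE[r r0 hr] : \forall z \near a, D z by apply: oD; exact: KD.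
have r2 : 0 < r / 2 by rewrite divr_gt0.
have big B : \forall j \near U, B < (Nz j).1%:R :> R.
  apply: Uoo; have BN := truncnS_gt B; near=> j.
  apply: lt_le_trans BN _; rewrite ler_nat; have [jN _ _] := hN j.
  by apply: leq_trans jN; near: j; exact: nbhs_infty_ge.
have [j [j1 [j2 j3]]] := ultra_ex UU (filterI (za _ r2) (filterI (big (cn a + r)) (big (r / 2)^-1))).
have [_ _] := hN j; apply; split.
  have h := cn_lb (zs j) a; rewrite -/(zs j).
  by move: ((Nz j).1%:R) (cn (zs j)) (cn a) (cn (zs j - a)) h j1 j2 => x1 x2 x3 x4; lra.
have rN : (Nz j).1.+1%:R^-1 < r / 2 :> R.
  rewrite -[r / 2]invrK ltf_pV2 ?posrE ?invr_gt0// ?ltr0n//.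
  by apply: lt_trans j3 _; rewrite ltr_nat.
move=> w /= zw; apply: hr; apply: le_lt_trans (cn_tri (zs j) w a) _.
have {}zw := lt_trans (zw : cn (w - zs j) < _) rN.
by rewrite [ltRHS]splitr; exact: ltrD.
Unshelve. all: by end_near. Qed.

(** Points with a large error would have a limit [a] along [U]. Each of them is the centre of a disc
    in [D] of one fixed radius, so [a] lies in [D], and [slim_dist] applies near [a]. *)
Lemma uniform_on_exhaustion D u F (N : nat) e : chart_bounded U D u -> slim U u F -> 0 < e ->
  \forall j \near U, forall z, exhaustion D N z -> spherical_dist (u j z) (F z) < e.
Proof.
move=> H uF e0.
have bn : \forall j \near U, forall z,
    ~ (exhaustion D N z /\ e <= spherical_dist (u j z) (F z)).
  apply: (bdd_seq_near UU (M := N%:R)); first by apply: nearW => j z [[]].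
  move=> a zs za Q; have N0 : 0 < N.+1%:R^-1 :> R by rewrite invr_gt0 ltr0n.
  have [j [zj [[_ jD] _]]] := ultra_ex UU (filterI (za _ N0) Q).
  have Da : D a by apply: jD; rewrite /disc /= cnC.
  have [d d0 hd] := slim_dist UU H uF Da e0.
  have [i [i1 [i2 [_ i3]]]] := ultra_ex UU (filterI hd (filterI (za d d0) Q)).
  by have := lt_le_trans (i1 _ i2) i3; rewrite ltxx.
by apply: filterS bn => j hj z Ez; rewrite ltNge; apply/negP => le; exact: (hj z).
Qed.

(** The passage from the ultrafilter back to a genuine subsequence: the [N]-th term has error below
    [1 / (N + 1)] on the [N]-th member of the exhaustion. *)
Lemma subsequence D u F : open D -> chart_bounded U D u -> slim U u F ->
  exists s : nat -> nat, {homo s : i j / (i < j)%N} /\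
    spherically_locally_uniform_cvg D (u \o s) F.
Proof.
move=> oD H uF.
pose P N t := forall z, exhaustion D N z -> spherical_dist (u t z) (F z) < N.+1%:R^-1.
have unif N : \forall j \near U, P N j.
  by apply: (uniform_on_exhaustion _ H uF); rewrite invr_gt0 ltr0n.
have [t0 P0] := ultra_ex UU (unif 0%N).
have [|s [_ sP sQ]] := @dep_choice nat P (fun _ t t' => (t < t')%N) t0 P0.
  move=> N t _; have ht : \forall j \near U, (t < j)%N.
    by apply: Uoo; exact: nbhs_infty_gt.
  have [t' [h1 h2]] := ultra_ex UU (filterI (unif N.+1) ht).
  by exists t'.
exists s; split; first by apply: homo_ltn => [x y z|//]; exact: ltn_trans.
move=> K cK KD e e0; have KE := compact_exhaustion oD cK KD.
have BN := truncnS_gt e^-1; near=> i => z Kz.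
have Ez : exhaustion D i z by move: z Kz; near: i; exact: KE.
apply: lt_trans (sP i z Ez) _.
rewrite -[e]invrK ltf_pV2 ?posrE ?invr_gt0// ?ltr0n//.
apply: lt_trans BN _; rewrite ltr_nat ltnS; near: i; exact: nbhs_infty_gt.
Unshelve. all: by end_near. Qed.

End Normality.

Theorem theorem1p3 (R : realType) (D : set R[i])
    (F : set (R[i] -> sphere R)) (k p m n : nat) (psi : R[i] -> R[i]) :
  complex_domain D ->
  (forall f, F f -> meromorphic D f) ->
  (0 < k)%N -> (0 < p)%N -> (0 < m)%N -> (0 < n)%N ->
  (k + 2 * (p + 1))%:R / n%:R + (p + 1)%:R / m%:R
    + (k * (p + 1))%:R / (m * n)%:R < 1 :> R ->
  (p + 1)%:R / m%:R + 2 * ((k + p + 1)%:R / n%:R) < 1 :> R ->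
  holomorphic D psi ->
  (exists z, D z /\ psi z != 0) ->
  (forall z, D z -> psi z = 0 ->
     (zero_mult (of_fun psi) z <= p%:R%:E)%E) ->
  (forall f, F f ->
    [/\ (forall z, zeros D (msub (mderive k (mpow f n)) psi) z ->
           (m%:R%:E <= zero_mult (msub (mderive k (mpow f n)) psi) z)%E),
        (forall z, D z -> ~ (psi z = 0 /\ f z = Some 0)) &
        (poles D f !=set0 -> (num_zeros D f <= num_poles D f)%E)]) ->
  normal_family D F.
Proof.
move=> [_ oD cD] mF k0 _ m0 n0 Ha _ ph pn pm hF.
have [U [UU Usub]] := @ultraFilterLemma nat \oo _.
have Uoo (P : nat -> Prop) : (\forall j \near \oo, P j) -> \forall j \near U, P j.
  by move=> /Usub.
have adm f : F f -> admissible n m k D psi f.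
  by move=> Ff; have [h1 h2 _] := hF f Ff; exact: (admissible_of n0 m0 (mF f Ff) h1 h2).
have charts a : D a -> exists r M, [/\ 0 < r, disc a r `<=` D &
    forall f, F f -> chart (disc a r) f M \/ chart (disc a r) (sinv \o f) M].
  move=> Da; have [l [phi [eps [e0 [lp eps0 epsD psiE [fa e00 phiE]]]]]] :=
    psi_factor oD cD ph pn Da (pm a Da).
  have rigl := rigid_exponents_real n0 m0 lp Ha.
  (* Order 0 serves the centres that escape from [a] on the scale of the blow-up; it also contains
     [k < n]. *)
  have rig0 := rigid_exponents_real n0 m0 (leq0n p) Ha.
  have kn : (k < n)%N.
    have [N [b [c [_ _ _ _ [_ _ h _]]]]] := rig0.
    by rewrite addn0 in h.
  exact: (family_chart UU Uoo oD ph k0 kn rigl rig0 eps0 epsD fa psiE e00 phiE adm).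
move=> u Fu.
have H : chart_bounded U D u.
  move=> a /charts[r [M [r0 rD h]]]; exists r, M; split; [exact: r0|exact: rD|].
  by apply: nearW => j; exact: h.
have [f uf] := slim_ex UU u.
have [s [s1 s2]] := subsequence UU Uoo oD H uf.
exists s; split; first exact: s1.
exists f; split; last exact: s2.
exact: sphol_mero oD cD (slim_sphol UU H uf).
Qed.
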